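(* For each $u\in\{2,3,4,6,12\}$, let $f^\sharp_{u}$ denote the weight three Hecke eigenform associated to the datum $\mathrm{HD}_{\mathrm{DM}}(u,3)=\{\{1/u,1/3,2/3\},\{1,1,1\}\}$, that is, $f^\sharp_2=f_{12.3.c.a}$, $f^\sharp_3=f_{27.3.b.b}$, $f^\sharp_4=f_{16.3.c.a}$, $f^\sharp_6=f_{108.3.c.b}$, $f^\sharp_{12}=f_{432.3.g.e}$. Then there exist algebraic numbers $\alpha_u\in\mathbb C$ and $\beta_j\in\mathbb C$ (for $j\in(\mathbb Z/u\mathbb Z)^\times$) such that $$\alpha_u\cdot\pi\cdot L(f^\sharp_u,1)=\sum_{j\in(\mathbb Z/u\mathbb Z)^\times}\beta_j\cdot{}_3P_2(\mathrm{HD}_{\mathbb K_3}(j/u,1);1),$$ where $j$ is represented by the integer with $1\le j<u$.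
   Context: Let $q=e^{2\pi i\tau}$, $\eta(\tau)=q^{1/24}\prod_{n\ge1}(1-q^n)$, and $\mathbb K_3(r,1)(\tau)=\eta(\tau)^{9-12r}\eta(3\tau)^{12r-3}$. The eigenforms (denoted by LMFDB labels) are $$f_{12.3.c.a}=\mathbb K_3(\tfrac12,1)(2\tau),\qquad f_{27.3.b.b}=\mathbb K_3(\tfrac13,1)(3\tau)+3\sqrt{-1}\,\mathbb K_3(\tfrac23,1)(3\tau),$$ $$f_{16.3.c.a}=\mathbb K_3(\tfrac14,1)(4\tau),\qquad f_{108.3.c.b}=\mathbb K_3(\tfrac16,1)(6\tau)+9\sqrt{-1}\,\mathbb K_3(\tfrac56,1)(6\tau),$$ $$f_{432.3.g.e}=\mathbb K_3(\tfrac1{12},1)(12\tau)+3\sqrt5\,\mathbb K_3(\tfrac5{12},1)(12\tau)-3\sqrt{-15}\,\mathbb K_3(\tfrac7{12},1)(12\tau)-9\sqrt{-3}\,\mathbb K_3(\tfrac{11}{12},1)(12\tau),$$ where $\sqrt{-15}=\sqrt5\,\sqrt{-3}$. The special $L$-value at $1$ of a cusp form $f$ is $L(f,1)=-2\pi i\int_0^{i\infty}f(t)\,dt$. For rational $0<r<1$, $\mathrm{HD}_{\mathbb K_3}(r,1)=\{\{1/3,2/3,r\},\{1,1,1\}\}$ and $${}_3P_2(\mathrm{HD}_{\mathbb K_3}(r,1);1)=\frac{2\sqrt3}{3}\,\pi\,B(r,1-r)\cdot{}_3F_2(\mathrm{HD}_{\mathbb K_3}(r,1);1),\qquad {}_3F_2(\mathrm{HD}_{\mathbb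 K_3}(r,1);1)=\sum_{k\ge0}\frac{(1/3)_k(2/3)_k(r)_k}{(k!)^3},$$ where $B$ is the beta function and $(a)_k=a(a+1)\cdots(a+k-1)$, $(a)_0=1$. *)

(* Defs.v *)
From HB Require Import structures.
From mathcomp Require Import all_boot all_order all_algebra.
From mathcomp Require Import all_classical all_reals all_analysis.
From mathcomp Require Import complex.

Set Implicit Arguments.
Unset Strict Implicit.
Unset Printing Implicit Defensive.

Import Order.TTheory GRing.Theory Num.Theory numFieldNormedType.Exports.

Local Open Scope classical_set_scope.
Local Open Scope ring_scope.
Local Open Scope complex_scope.

Definition algebraic_number (R : realType) (z : R[i]) : Prop :=
  algebraicOver (ratr : rat -> R[i]) z.

Definition expC (R : realType) (z : R[i]) : R[i] :=
  (expR (complex.Re z) * cos (complex.Im z)) +i* (expR (complex.Re z) * sin (complex.Im z)).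

(* [nome s tau] is q ^ s, that is exp (2 pi i s tau); the branch of the
   fractional power of q is the one determined by tau. *)
Definition nome (R : realType) (s : rat) (tau : R[i]) : R[i] :=
  expC (2 * pi%:C * 'i%C * ratr s * tau).

(* The limit is taken in R[i] with the topology of its modulus.  The functions
   of tau below are meaningful for 0 < Im tau only. *)
Definition eta (R : realType) (tau : R[i]) : R[i] :=
  nome (1 / 24) tau *
  lim ((fun N : nat => \prod_(1 <= n < N.+1) (1 - nome 1 tau ^+ n) : R[i]^o)
       @ \oo).

(* eta(tau) ^ (9 - 12 r) * eta(3 tau) ^ (12 r - 3).  It is only applied to r
   with 12 r an integer, so that [Num.floor] merely reads the exponents as
   integers. *)
Definition K3 (R : realType) (r : rat) (tau : R[i]) : R[i] :=
  eta tau ^ Num.floor (9 - 12 * r) * eta (3 * tau) ^ Num.floor (12 * r - 3).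

Definition f_12_3_c_a (R : realType) (tau : R[i]) : R[i] :=
  K3 (1 / 2) (2 * tau).

Definition f_27_3_b_b (R : realType) (tau : R[i]) : R[i] :=
  K3 (1 / 3) (3 * tau) + 3 * 'i%C * K3 (2 / 3) (3 * tau).

Definition f_16_3_c_a (R : realType) (tau : R[i]) : R[i] :=
  K3 (1 / 4) (4 * tau).

Definition f_108_3_c_b (R : realType) (tau : R[i]) : R[i] :=
  K3 (1 / 6) (6 * tau) + 9 * 'i%C * K3 (5 / 6) (6 * tau).

Definition f_432_3_g_e (R : realType) (tau : R[i]) : R[i] :=
  let sqrt5 : R[i] := (Num.sqrt 5)%:C in
  let sqrtN3 : R[i] := 'i%C * (Num.sqrt 3)%:C in
  let sqrtN15 : R[i] := sqrt5 * sqrtN3 in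
  K3 (1 / 12) (12 * tau) + 3 * sqrt5 * K3 (5 / 12) (12 * tau)
  - 3 * sqrtN15 * K3 (7 / 12) (12 * tau) - 9 * sqrtN3 * K3 (11 / 12) (12 * tau).

(* The value 0 for the other u is a dummy. *)
Definition f_sharp (R : realType) (u : nat) : R[i] -> R[i] :=
  match u with
  | 2 => @f_12_3_c_a R
  | 3 => @f_27_3_b_b R
  | 4 => @f_16_3_c_a R
  | 6 => @f_108_3_c_b R
  | 12 => @f_432_3_g_e R
  | _ => fun=> 0
  end.

Definition Cintegral (R : realType) (D : set R) (g : R -> R[i]) : R[i] :=
  (\int[lebesgue_measure]_(y in D) complex.Re (g y))
    +i* (\int[lebesgue_measure]_(y in D) complex.Im (g y)).

(* L(f,1) = - 2 pi i int_0^(i oo) f(t) dt, along t = i y with dt = i dy. *)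
Definition Lvalue1 (R : realType) (f : R[i] -> R[i]) : R[i] :=
  - (2 * pi%:C * 'i%C) *
  Cintegral [set` `]0, +oo[] (fun y : R => f ('i%C * y%:C) * 'i%C).

Definition Beta (R : realType) (a b : R) : R :=
  \int[lebesgue_measure]_(t in [set` `]0, 1[])
    (t `^ (a - 1) * (1 - t) `^ (b - 1)).

Definition pochhammer (R : realType) (a : R) (k : nat) : R :=
  \prod_(0 <= i < k) (a + i%:R).

(* 3F2 and 3P2 at the datum {{1/3, 2/3, r}, {1, 1, 1}} and argument 1. *)
Definition hyp3F2_K3 (R : realType) (r : rat) : R :=
  limn (series (fun k : nat =>
    pochhammer (1 / 3 : R) k * pochhammer (2 / 3 : R) k
    * pochhammer (ratr r : R) k / (k`!%:R) ^+ 3)).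

Definition hyp3P2_K3 (R : realType) (r : rat) : R :=
  2 * Num.sqrt 3 / 3 * pi * Beta (ratr r) (1 - ratr r) * hyp3F2_K3 R r.

(* Main.v *)
Require Import Defs.
From HB Require Import structures.
From mathcomp Require Import all_boot all_order all_algebra.
From mathcomp Require Import all_classical all_reals all_analysis.
From mathcomp Require Import measurable_realfun complex.
From mathcomp Require Import ring lra zify.

Set Implicit Arguments.
Unset Strict Implicit.
Unset Printing Implicit Defensive.

Import Order.TTheory GRing.Theory Num.Theory numFieldNormedType.Exports.

Local Open Scope classical_set_scope.
Local Open Scope ring_scope.
Local Open Scope complex_scope.

(** The L-value of f is an integral of eta quotients along the imaginary axis,
    and the integral of each of them is a hypergeometric value: for
    0 < r < 1 and u > 0,

      2 pi u int_0^oo K_3(r, 1)(i u y) dy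
        = 3^(-3 r) B(r, 1 - r) 3F2(1/3, 2/3, r; 1, 1; 1).

    If the eigenform is the sum of the c_j K_3(j/u, 1)(u tau), this makes
    pi L(f, 1) the sum of the c_j 3^(-3 j/u) (sqrt 3 / (2 u)) 3P2(j/u), whose
    coefficients are algebraic; so alpha_u = 1 will do.

    The displayed formula is Euler's integral for 3F2 transported by the cubic
    theory of the Borweins.  Let a be the weight one Eisenstein series for the
    character modulo 3, and put b(q) = (3 a(q^3) - a(q)) / 2 and
    c(q^3) = (a(q) - a(q^3)) / 2.  These are Lambert series; a terminating
    form of Kronecker's expansion of a quotient of theta functions
    ([finite_kronecker]) and dominated convergence give their product
    expansions ([cubic_b_euler], [cubic_C_euler]), that is, b and c are eta
    quotients.  With x = c^3 / a^3 and a^3 = b^3 + c^3 it follows that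
    K_3(r, 1) = 3^(-3 r) x^r (1 - x)^(1 - r) a^3 ([cubic_eta_quotient]).

    All the other identities come from comparing q with q^3.  A function H
    with H(q) = m(q) H(q^3), where m is bounded and H(q) = O(q) near 0, is
    zero ([cubic_iteration_eq0]), and a function invariant under q -> q^3 is
    equal to its limit at 0 ([cubic_invariant]).  With D = q d/dq this proves
      - the identity a^3 = b^3 + c^3 ([cubic_identity]), hence the modular
        equation x(q^3) = s^3 for s = c(q^3) / a(q^3), where x(q) itself is
        1 - ((1 - s) / (1 + 2 s))^3;
      - D x = x (1 - x) a^2 ([hasD_cubic_x]);
      - D (D a / a^2) = (2/9) x (1 - x) a^3 ([cubic_a_ode]), which is the
        hypergeometric equation for a as a function of x.
    Since a is regular at x = 0, a = 2F1(1/3, 2/3; 1; x)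
    ([cubic_a_hypergeometric]).

    On the imaginary axis q = exp(- 2 pi u y), so that
    dx = - 2 pi u x (1 - x) a^2 dy, and the period of K_3(r, 1) becomes the
    integral of x^(r - 1) (1 - x)^(- r) 2F1(1/3, 2/3; 1; x) over the unit
    interval ([modular_integral]).  Termwise integration, with the moments of
    the beta density, gives the 3F2 series ([integral_hypergeometric]). *)

(** * A finite partial fraction expansion *)

(** A terminating form of Kronecker's expansion of a quotient of theta
    functions.  Passing from M to M + 1 multiplies the right-hand side by
    (1 - x Y Q^M) / (1 - Y Q^(M+1)); the same factor on each summand is split
    into partial fractions in Y, and the residue at the new pole is the same
    sum taken at Y = Q^-(M+1), which is known by induction. *)
Lemma finite_kronecker (F : fieldType) (x Q : F) (M : nat) (Y : F) :
  Q != 0 -> (forall j, 1 - Q ^+ j.+1 != 0) ->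
  (forall i, (i <= M)%N -> 1 - Y * Q ^+ i != 0) ->
  \sum_(0 <= i < M.+1)
    (\prod_(0 <= j < i) ((x - Q ^+ j.+1) / (1 - Q ^+ j.+1))) *
    (\prod_(0 <= j < M - i) ((1 - x * Q ^+ j) / (1 - Q ^+ j.+1))) /
    (1 - Y * Q ^+ i)
  = (\prod_(0 <= j < M) (1 - x * Y * Q ^+ j)) /
    \prod_(0 <= j < M.+1) (1 - Y * Q ^+ j).
Proof.
move=> Q0 Q1; elim: M Y => [|M IH] Y Y1.
  by rewrite big_nat1 subn0 big_nat1 !big_geq // !mul1r.
set A := fun i : nat => \prod_(0 <= j < i) ((x - Q ^+ j.+1) / (1 - Q ^+ j.+1)).
set B := fun i : nat => \prod_(0 <= j < i) ((1 - x * Q ^+ j) / (1 - Q ^+ j.+1)).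
have Y1M : 1 - Y * Q ^+ M.+1 != 0 by apply: Y1.
pose Y0 := (Q ^+ M.+1)^-1.
have QM0 : Q ^+ M.+1 != 0 by rewrite expf_neq0.
have Y0i i : (i <= M)%N -> Y0 * Q ^+ i = (Q ^+ (M.+1 - i))^-1.
  move=> iM; rewrite /Y0 -[in LHS](subnK (leq_trans iM (leqnSn M))).
  by rewrite exprD invfM -mulrA mulVf ?mulr1 // expf_neq0.
have Y0n i : (i <= M)%N -> 1 - Y0 * Q ^+ i != 0.
  move=> iM; rewrite Y0i // subr_eq0 eq_sym invr_eq1 eq_sym -subr_eq0.
  by rewrite subSn.
(* The splitting of one summand; Y0 is the location of the new pole. *)
have step i : (i <= M)%N ->
    A i * B (M.+1 - i)%N / (1 - Y * Q ^+ i) =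
    (1 - x * Y * Q ^+ M) / (1 - Y * Q ^+ M.+1) *
      (A i * B (M - i)%N / (1 - Y * Q ^+ i))
    - (1 - x / Q) / (1 - Y * Q ^+ M.+1) *
      (A i * B (M - i)%N / (1 - Y0 * Q ^+ i)).
  move=> iM; rewrite subSn // {1}/B big_nat_recr //= -/(B (M - i)%N) Y0i //.
  rewrite subSn //.
  have q1 := Q1 (M - i)%N; have yi := Y1 i (leq_trans iM (leqnSn M)).
  have MiE : Q ^+ M = Q ^+ (M - i) * Q ^+ i by rewrite -exprD subnK.
  move: Y1M q1 yi; rewrite !exprS MiE.
  have: Q ^+ (M - i) != 0 by rewrite expf_neq0.
  have: Q ^+ i != 0 by rewrite expf_neq0.
  move: (Q ^+ (M - i)) (Q ^+ i) (A i) (B (M - i)%N) => u v a b.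
  move=> v0 u0 h1 h2 h3; field.
  do ?[apply/andP; split] => //.
  by rewrite -opprB oppr_eq0.
rewrite big_nat_recr //= -/(A M.+1) subnn (big_geq (leqnn 0)) mulr1.
rewrite (eq_big_nat _ _ (F2 := fun i =>
  (1 - x * Y * Q ^+ M) / (1 - Y * Q ^+ M.+1) *
      (A i * B (M - i)%N / (1 - Y * Q ^+ i))
    - (1 - x / Q) / (1 - Y * Q ^+ M.+1) *
      (A i * B (M - i)%N / (1 - Y0 * Q ^+ i)))); last first.
  by move=> i /andP[_ iM]; rewrite step.
rewrite sumrB -!mulr_sumr IH; last first.
  by move=> i iM; apply: Y1; apply: leq_trans iM _.
rewrite IH //.
(* The last summand cancels the contribution of the new pole. *)
have -> : A M.+1 = (1 - x / Q) * (\prod_(0 <= j < M) (1 - x * Y0 * Q ^+ j) /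
                     \prod_(0 <= j < M.+1) (1 - Y0 * Q ^+ j)).
  have -> : 1 - x / Q = 1 - x * Y0 * Q ^+ M.
    by rewrite -mulrA Y0i // subSnn expr1.
  rewrite mulrA [X in X / _]mulrC -(big_nat_recr _ _ (fun j => 1 - x * Y0 * Q ^+ j)) //=.
  rewrite -prodf_div big_nat_rev /= add0n /A; apply: eq_big_nat => j /andP[_ jM].
  rewrite subSS -mulrA Y0i ?leq_subr // subSn ?leq_subr // subKn //.
  have q1 := Q1 j; have qj : Q ^+ j.+1 != 0 by rewrite expf_neq0.
  move: (Q ^+ j.+1) qj q1 => z z0 z1; field; rewrite z0 z1 /= andbT.
  by rewrite -opprB oppr_eq0.
rewrite [in RHS](big_nat_recr M) //= [in RHS](big_nat_recr M.+1) //=.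
set P1 := \prod_(0 <= j < M) (1 - x * Y * Q ^+ j).
set P2 := \prod_(0 <= j < M.+1) (1 - Y * Q ^+ j).
rewrite invfM.
set P3 := _ / \prod_(0 <= j < M.+1) (1 - Y0 * _).
by move: (P2^-1) (_^-1) => p2 w; ring.
Qed.

(** * Dominated convergence for series *)

(** The terms beyond a large K contribute at most a tail of the dominating
    series, and the first K terms tend to 0. *)
Lemma tannery0 (R : realType) (u : nat -> nat -> R) (g : nat -> R) :
  (forall N n, (n < N)%N -> `|u N n| <= g n) -> cvgn (series g) ->
  (forall n, u ^~ n @ \oo --> 0) ->
  (fun N => \sum_(0 <= n < N) u N n) @ \oo --> 0.
Proof.
move=> ug cg u0.
have g0 n : 0 <= g n by apply: le_trans (ug n.+1 n (ltnSn _)).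
have ndg : nondecreasing_seq (series g).
  by apply/nondecreasing_seqP => n; rewrite /series /= big_nat_recr //= lerDl.
apply/cvgrPdist_lt => e e0.
have e2 : 0 < e / 2 by rewrite divr_gt0.
have [K _ HK] := (cvgrPdist_lt _ _).1 cg _ e2.
have : (fun N => \sum_(0 <= n < K) `|u N n|) @ \oo --> \sum_(0 <= n < K) (0 : R).
  apply: cvg_big => [|n _]; first exact: add_continuous.
  by have h := cvg_norm (u0 n); rewrite normr0 in h; exact: h.
rewrite big1 // => /cvgrPdist_lt /(_ _ e2) [N0 _ HN0].
exists (maxn K N0) => // N /=; rewrite geq_max => /andP[KN N0N].
rewrite sub0r normrN (big_cat_nat (n := K)) //=.
have := HN0 N N0N; rewrite /= sub0r normrN ger0_norm ?sumr_ge0 // => h1.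
have := HK K (leqnn K); rewrite /= => h2.
have h3 : \sum_(K <= n < N) g n <= limn (series g) - series g K.
  rewrite lerBrDl -[series g K]/(\sum_(0 <= n < K) g n) -(big_cat_nat (n := K)) //=.
  exact: (nondecreasing_cvgn_le ndg cg N).
apply: (le_lt_trans (ler_normD _ _)).
have h4 : `|\sum_(0 <= n < K) u N n| < e / 2.
  by apply: le_lt_trans h1; apply: ler_norm_sum.
have h5 : `|\sum_(K <= n < N) u N n| < e / 2.
  apply: (le_lt_trans (ler_norm_sum _ _ _)).
  apply: le_lt_trans (le_lt_trans (ler_norm _) h2).
  apply: le_trans h3; rewrite !big_nat; apply: ler_sum => n /andP[_ nN].
  exact: ug.
by rewrite [e]splitr ltrD.
Qed.

Lemma tannery (R : realType) (u : nat -> nat -> R) (v g : nat -> R) :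
  (forall N n, (n < N)%N -> `|u N n| <= g n) -> cvgn (series g) ->
  (forall n, u ^~ n @ \oo --> v n) ->
  cvgn (series v) /\
  (fun N => \sum_(0 <= n < N) u N n) @ \oo --> limn (series v).
Proof.
move=> ug cg uv.
have vg n : `|v n| <= g n.
  have h : (fun N => `|u N n|) @ \oo --> `|v n| by apply: cvg_norm; apply: uv.
  rewrite -(cvg_lim _ h) //.
  apply: limr_le.
    by apply: is_cvg_norm; apply/cvg_ex; exists (v n); apply: uv.
  by exists n.+1 => // N /= nN; apply: ug.
have cv : cvgn (series v).
  apply: normed_cvg; apply: series_le_cvg cg => n //=.
  by apply: le_trans (vg n).
split=> //.
have h : (fun N => \sum_(0 <= n < N) (u N n - v n)) @ \oo --> 0.
  apply: (@tannery0 _ (fun N n => u N n - v n) (fun n => g n + g n)).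
  - move=> N n nN; apply: (le_trans (ler_normB _ _)).
    by apply: lerD; [apply: ug|apply: vg].
  - have -> : series (fun n => g n + g n) = series g + series g.
      by apply/funext => n; rewrite /series /= big_split.
    exact: is_cvgD.
  - by move=> n; rewrite -[X in _ --> X](subrr (v n)); apply: cvgB (uv n) (cvg_cst _).
have -> : (fun N => \sum_(0 <= n < N) u N n) =
   (fun N => \sum_(0 <= n < N) (u N n - v n)) + series v.
  by apply/funext => N /=; rewrite /series /= fctE sumrB subrK.
by rewrite -[limn _]add0r; apply: cvgD h cv.
Qed.

Lemma cvgn_geom (R : realType) (K q : R) : 0 <= q < 1 ->
  cvgn (series (fun n => K * q ^+ n)).
Proof.
move=> /andP[q0 q1].
have := @is_cvg_geometric_series R K q; rewrite ger0_norm // => /(_ q1).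
by congr (cvgn _); apply/funext => n.
Qed.

(** * Double series indexed by residues modulo 3 *)

(** The coefficient of q^k in the double series of w m n q^(m n) over
    positive m and n. *)
Definition dcoef (R : realType) (w : nat -> nat -> R) (k : nat) : R :=
  \sum_(0 <= m < k) \sum_(0 <= n < k)
    (if (m.+1 * n.+1 == k)%N then w m.+1 n.+1 else 0).

(** The double series, defined as a power series so that it can be
    differentiated term by term. *)
Definition dseries (R : realType) (w : nat -> nat -> R) (q : R) : R :=
  limn (pseries (dcoef w) q).

Lemma sum_nat_widen0 (R : realType) (k N : nat) (f : nat -> R) :
  (k <= N)%N -> (forall m, (k <= m)%N -> f m = 0) ->
  \sum_(0 <= m < N) f m = \sum_(0 <= m < k) f m.
Proof.
move=> kN f0; rewrite (big_cat_nat (n := k)) //= [X in _ + X]big1_seq ?addr0 //.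
by move=> m; rewrite mem_index_iota => /andP[_ /andP[/f0]].
Qed.

Lemma dcoef_widen (R : realType) (w : nat -> nat -> R) (k N : nat) :
  (k <= N)%N ->
  dcoef w k = \sum_(0 <= m < N) \sum_(0 <= n < N)
    (if (m.+1 * n.+1 == k)%N then w m.+1 n.+1 else 0).
Proof.
move=> kN; rewrite [RHS](sum_nat_widen0 kN); last first.
  move=> m km; rewrite big1 // => n _; case: eqP => // e.
  by move: km; rewrite -e mulnS ltnNge leq_addr.
apply: eq_bigr => m _; rewrite [RHS](sum_nat_widen0 kN) //.
move=> n kn; case: eqP => // e.
by move: kn; rewrite -e mulSn ltnNge leq_addr.
Qed.

Lemma pseries_dcoef (R : realType) (w : nat -> nat -> R) (q : R) (N : nat) :
  pseries (dcoef w) q N = \sum_(0 <= m < N) \sum_(0 <= n < N)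
    (if (m.+1 * n.+1 < N)%N then w m.+1 n.+1 * q ^+ (m.+1 * n.+1) else 0).
Proof.
rewrite /pseries /series /=.
under eq_big_nat => k /andP[_ kN].
  rewrite (dcoef_widen w (ltnW kN)) mulr_suml.
  under eq_bigr do rewrite mulr_suml.
  over.
rewrite exchange_big /=; apply: eq_bigr => m _.
rewrite exchange_big /=; apply: eq_bigr => n _.
case: ltnP => mnN.
  rewrite (big_cat_nat (n := m.+1 * n.+1)) //; last exact: ltnW.
  rewrite big_nat big1 ?add0r; last first.
    by move=> k /andP[_ kmn]; rewrite gtn_eqF // mul0r.
  rewrite big_ltn //= eqxx big_nat big1 ?addr0 ?add0r //.
  by move=> k /andP[kmn _]; rewrite ltn_eqF // mul0r.
rewrite big_nat big1 // => k /andP[_ kN].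
by rewrite gtn_eqF ?mul0r //; apply: leq_trans mnN.
Qed.

Lemma dseriesT (R : realType) (w : nat -> nat -> R) :
  dcoef (fun m n => w n m) = dcoef w.
Proof.
apply/funext => k; rewrite /dcoef exchange_big /=.
by apply: eq_bigr => m _; apply: eq_bigr => n _; rewrite mulnC.
Qed.

(** Dominated convergence twice: the bound m n >= m + n - 1 dominates the
    double sum by a product of geometric series. *)
Lemma dseries_rows (R : realType) (w : nat -> nat -> R) (K q : R) :
  0 <= q < 1 -> (forall m n, `|w m n| <= K) ->
  let row := fun m => limn (series (fun n => w m.+1 n.+1 * q ^+ (m.+1 * n.+1))) in
  [/\ forall m, cvgn (series (fun n => w m.+1 n.+1 * q ^+ (m.+1 * n.+1))),
      cvgn (series row), cvgn (pseries (dcoef w) q)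
    & limn (series row) = dseries w q].
Proof.
move=> q01 wK row; have /andP[q0 q1] := q01.
have K0 : 0 <= K by apply: le_trans (wK 0%N 0%N).
have qle (m n : nat) : q ^+ (m.+1 * n.+1) <= q ^+ m.+1 * q ^+ n.
  by rewrite -exprD; apply: ler_wiXn2l => //; [exact: ltW|nia].
have bnd (m n : nat) : `|w m.+1 n.+1 * q ^+ (m.+1 * n.+1)| <= K * q ^+ m.+1 * q ^+ n.
  rewrite normrM -mulrA; apply: ler_pM => //.
  by rewrite ger0_norm ?exprn_ge0.
pose u N m := \sum_(0 <= n < N)
    (if (m.+1 * n.+1 < N)%N then w m.+1 n.+1 * q ^+ (m.+1 * n.+1) else 0).
have Hrow m : cvgn (series (fun n => w m.+1 n.+1 * q ^+ (m.+1 * n.+1))) /\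
    u ^~ m @ \oo --> row m.
  apply: (@tannery _ (fun N n =>
    if (m.+1 * n.+1 < N)%N then w m.+1 n.+1 * q ^+ (m.+1 * n.+1) else 0) _
    (fun n => K * q ^+ m.+1 * q ^+ n)).
  - move=> N n _; case: ifP => // _.
    by rewrite normr0 !mulr_ge0 ?exprn_ge0.
  - exact: cvgn_geom.
  - move=> n; apply: cvg_near_cst.
    by exists (m.+1 * n.+1).+1 => // N /= ->.
have Hall : cvgn (series row) /\
    (fun N => \sum_(0 <= m < N) u N m) @ \oo --> limn (series row).
  apply: (@tannery _ u _ (fun m => (K * q / (1 - q)) * q ^+ m)).
  - move=> N m _; apply: (le_trans (ler_norm_sum _ _ _)).
    apply: (@le_trans _ _ (\sum_(0 <= n < N) (K * q ^+ m.+1 * q ^+ n))).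
      apply: ler_sum => n _; case: ifP => // _.
      by rewrite normr0 !mulr_ge0 ?exprn_ge0.
    have -> : K * q / (1 - q) * q ^+ m = K * q ^+ m.+1 * (1 - q)^-1.
      by rewrite exprS; ring.
    rewrite -mulr_sumr ler_wpM2l ?mulr_ge0 ?exprn_ge0 //.
    have q1' : 1 - q != 0 by rewrite subr_eq0 eq_sym lt_eqF.
    have -> : \sum_(0 <= n < N) q ^+ n = (1 - q ^+ N) / (1 - q).
      by apply: (mulIf q1'); rewrite divfK // big_mkord -[RHS]opprB subrX1 -mulNr opprB mulrC.
    by rewrite ler_pdivrMr ?subr_gt0 // mulVf // gerBl exprn_ge0.
  - exact: cvgn_geom.
  - by move=> m; case: (Hrow m).
have E : pseries (dcoef w) q = (fun N => \sum_(0 <= m < N) u N m).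
  by apply/funext => N; rewrite pseries_dcoef.
split.
- by move=> m; case: (Hrow m).
- by case: Hall.
- by rewrite E; apply/cvg_ex; exists (limn (series row)); case: Hall.
- by rewrite /dseries E; apply/esym/cvg_lim => //; case: Hall.
Qed.

(** A 3-periodic row is summed by comparing the series with its own shift
    by three terms. *)
Lemma periodic_row (R : realType) (f : nat -> R) (y : R) :
  (forall n, f n.+3 = f n) -> `|y| < 1 -> cvgn (series (fun n => f n.+1 * y ^+ n.+1)) ->
  limn (series (fun n => f n.+1 * y ^+ n.+1)) =
  (f 1%N * y + f 2%N * y ^+ 2 + f 0%N * y ^+ 3) / (1 - y ^+ 3).
Proof.
move=> fp y1 cf.
set S := series _; set P := _ + _ + _.
have SS N : S N.+1 = S N + f N.+1 * y ^+ N.+1.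
  by rewrite /S /series /= big_nat_recr.
have E N : S (N + 3)%N = P + y ^+ 3 * S N.
  elim: N => [|N IH].
    by rewrite add0n /S /series /= !big_nat_recr //= big_geq // fp /P; ring.
  by rewrite addSn 2!SS IH addn3 fp !exprS; ring.
have h : (S (N + 3)%N) @[N --> \oo] --> limn S by rewrite cvg_shiftn.
have h' : (S (N + 3)%N) @[N --> \oo] --> P + y ^+ 3 * limn S.
  under eq_fun do rewrite E.
  by apply: cvgD; [exact: cvg_cst|apply: cvgM => //; exact: cvg_cst].
have e : limn S = P + y ^+ 3 * limn S.
  by rewrite -[LHS](cvg_lim _ h) // -[RHS](cvg_lim _ h').
have y3 : 1 - y ^+ 3 != 0.
  rewrite subr_eq0; apply/eqP => y31.
  have : `|y| ^+ 3 < 1 by rewrite exprn_ilt1.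
  by rewrite -normrX -y31 normr1 ltxx.
apply: (mulIf y3); rewrite divfK //.
by rewrite mulrBr mulr1 {1}e mulrC addrK.
Qed.

(** * Cubic theta functions *)

Definition res3 (R : realType) (i n : nat) : R := (n %% 3 == i)%N%:R.

(** The sum of q^(m n) over the positive m = i and n = j modulo 3. *)
Definition lambert3 (R : realType) (q : R) (i j : nat) : R :=
  dseries (fun m n => res3 R i m * res3 R j n) q.

(** The sum of the y^n over the positive n congruent to j modulo 3. *)
Definition geom3 (R : realType) (j : nat) (y : R) : R :=
  y ^+ (if j is 0 then 3 else j) / (1 - y ^+ 3).

Lemma lambert3C (R : realType) (q : R) (i j : nat) :
  lambert3 q i j = lambert3 q j i.
Proof.
rewrite /lambert3 /dseries -[in LHS]dseriesT; congr (limn (pseries (dcoef _) q)).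
by apply/funext => m; apply/funext => n; rewrite mulrC.
Qed.

Lemma res3_le1 (R : realType) (i n : nat) : `|res3 R i n| <= 1.
Proof. by rewrite /res3; case: eqP => _; rewrite ?normr0 ?normr1. Qed.

Lemma lambert3_rows (R : realType) (q : R) (i j : nat) : 0 <= q < 1 -> (j < 3)%N ->
  series (fun m => res3 R i m.+1 * geom3 j (q ^+ m.+1)) @ \oo --> lambert3 q i j.
Proof.
move=> q01 j3; have /andP[q0 q1] := q01.
have wle m n : `|res3 R i m * res3 R j n| <= 1.
  by rewrite normrM; apply: mulr_ile1; rewrite ?res3_le1.
have [crow cs _ E] := @dseries_rows R (fun m n => res3 R i m * res3 R j n) 1 q q01 wle.
rewrite /lambert3 -E.
suff -> : (fun m => res3 R i m.+1 * geom3 j (q ^+ m.+1)) =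
  (fun m => limn (series (fun n => res3 R i m.+1 * res3 R j n.+1 * q ^+ (m.+1 * n.+1)))).
  exact: cs.
apply/funext => m.
have e1 : (fun n => res3 R i m.+1 * res3 R j n.+1 * q ^+ (m.+1 * n.+1)) =
  (fun n => (fun n => res3 R i m.+1 * res3 R j n) n.+1 * (q ^+ m.+1) ^+ n.+1).
  by apply/funext => n; rewrite exprM.
rewrite e1 (@periodic_row R (fun n => res3 R i m.+1 * res3 R j n)).
- by rewrite /geom3 /res3 /=; case: j j3 {wle crow cs E e1} => [|[|[|]]] //= _; ring.
- by move=> n; rewrite /res3 -(addn3 n) modnDr.
- by rewrite ger0_norm ?exprn_ge0 // exprn_ilt1.
- by have := crow m; rewrite e1.
Qed.

Lemma eq_cvgn (R : realType) (f g : nat -> R) (l : R) :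
  g @ \oo --> l -> (forall N, f N = g N) -> f @ \oo --> l.
Proof. by move=> h /funext ->. Qed.

(** The coefficients of the Eisenstein series of weight one for the
    character modulo 3, that is of the theta function of the hexagonal
    lattice. *)
Definition acoef (R : realType) (k : nat) : R :=
  (k == 0)%N%:R + 6 * dcoef (fun m _ => res3 R 1 m - res3 R 2 m) k.

Definition cubic_a (R : realType) (q : R) : R := limn (pseries (@acoef R) q).

Lemma cvg_pseries_acoef (R : realType) (q : R) : 0 <= q < 1 ->
  cvgn (pseries (@acoef R) q) /\
  (fun N => 1 + 6 * series (fun m => (res3 R 1 m.+1 - res3 R 2 m.+1) *
    (q ^+ m.+1 / (1 - q ^+ m.+1))) N) @ \oo --> cubic_a q.
Proof.
move=> q01; have /andP[q0 q1] := q01.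
pose w (m _ : nat) := res3 R 1 m - res3 R 2 m.
have wle m n : `|w m n| <= 2.
  apply: (le_trans (ler_normB _ _)).
  by rewrite -[2]/(1 + 1); apply: lerD; exact: res3_le1.
have [crow cs cp E] := @dseries_rows R w 2 q q01 wle.
have SE N : pseries (@acoef R) q N.+1 = 1 + 6 * pseries (dcoef w) q N.+1.
  rewrite /pseries /series /= mulr_sumr.
  under eq_bigr do rewrite /acoef mulrDl -mulrA.
  rewrite big_split /=; congr (_ + _).
  by rewrite big_ltn //= expr0 mulr1 big_nat big1 ?addr0 // => -[|i] // _; rewrite mul0r.
have cvga : pseries (@acoef R) q @ \oo --> 1 + 6 * dseries w q.
  rewrite -(cvg_shiftS (pseries _ q)) /=.
  under eq_fun do rewrite SE.
  apply: cvgD; first exact: cvg_cst.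
  apply: cvgM; first exact: cvg_cst.
  by rewrite (cvg_shiftS (pseries (dcoef w) q)).
split; first by apply/cvg_ex; exists (1 + 6 * dseries w q).
rewrite /cubic_a (cvg_lim _ cvga) //.
apply: cvgD; first exact: cvg_cst.
apply: cvgM; first exact: cvg_cst.
rewrite -E.
suff -> : (fun m => (res3 R 1 m.+1 - res3 R 2 m.+1) * (q ^+ m.+1 / (1 - q ^+ m.+1))) =
  (fun m => limn (series (fun n => w m.+1 n.+1 * q ^+ (m.+1 * n.+1)))).
  exact: cs.
apply/funext => m.
have e1 : (fun n => w m.+1 n.+1 * q ^+ (m.+1 * n.+1)) =
  (fun n => (w m.+1) n.+1 * (q ^+ m.+1) ^+ n.+1).
  by apply/funext => n; rewrite exprM.
have y1 : q ^+ m.+1 < 1 by rewrite exprn_ilt1.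
have y0 : 0 <= q ^+ m.+1 by rewrite exprn_ge0.
rewrite e1 (@periodic_row R (w m.+1)) //; last 2 first.
- by rewrite ger0_norm.
- by have := crow m; rewrite e1.
rewrite /w; move: (q ^+ m.+1) y0 y1 (_ - _) => y y0 y1 c.
have y3 : y ^+ 3 < 1 by rewrite exprn_ilt1.
by field; rewrite !subr_eq0 !(eq_sym 1) !lt_eqF.
Qed.

(** The Borweins' functions c(q^3) and b(q).  The function c is a power series
    in q up to a factor q^(1/3), which disappears at q^3. *)
Definition cubic_C (R : realType) (q : R) : R := (cubic_a q - cubic_a (q ^+ 3)) / 2.
Definition cubic_b (R : realType) (q : R) : R := (3 * cubic_a (q ^+ 3) - cubic_a q) / 2.

Lemma cubic_aE (R : realType) (q : R) : 0 <= q < 1 ->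
  cubic_a q = 1 + 6 * (lambert3 q 1 0 + lambert3 q 1 1 + lambert3 q 1 2
                       - lambert3 q 2 0 - lambert3 q 2 1 - lambert3 q 2 2).
Proof.
move=> q01; have /andP[q0 q1] := q01.
have [_ h] := cvg_pseries_acoef q01.
rewrite -(cvg_lim _ h) //; apply: cvg_lim => //.
apply: cvgD; first exact: cvg_cst.
apply: cvgM; first exact: cvg_cst.
have L i j := @lambert3_rows R q i j q01.
apply: (eq_cvgn (cvgB (cvgB (cvgB (cvgD (cvgD (L 1%N 0%N isT) (L 1%N 1%N isT))
  (L 1%N 2%N isT)) (L 2%N 0%N isT)) (L 2%N 1%N isT)) (L 2%N 2%N isT))) => N.
rewrite !fctE /series /= -!(sumrN, big_split) /=; apply: eq_bigr => m _.
rewrite /geom3.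
have y1 : q ^+ m.+1 < 1 by rewrite exprn_ilt1.
have y0 : 0 <= q ^+ m.+1 by rewrite exprn_ge0.
move: (q ^+ m.+1) y0 y1 (res3 _ _ _) (res3 _ _ _) => y y0 y1 c d.
have y3 : y ^+ 3 < 1 by rewrite exprn_ilt1.
by field; rewrite !subr_eq0 !(eq_sym 1) !lt_eqF.
Qed.

Lemma cubic_a3E (R : realType) (q : R) : 0 <= q < 1 ->
  cubic_a (q ^+ 3) = 1 + 6 * (lambert3 q 1 0 - lambert3 q 2 0).
Proof.
move=> q01; have /andP[q0 q1] := q01.
have q301 : 0 <= q ^+ 3 < 1 by rewrite exprn_ge0 // exprn_ilt1.
have [_ h] := cvg_pseries_acoef q301.
rewrite -(cvg_lim _ h) //; apply: cvg_lim => //.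
apply: cvgD; first exact: cvg_cst.
apply: cvgM; first exact: cvg_cst.
have L i j := @lambert3_rows R q i j q01.
apply: (eq_cvgn (cvgB (L 1%N 0%N isT) (L 2%N 0%N isT))) => N.
rewrite !fctE /series /= -!(sumrN, big_split) /=; apply: eq_bigr => m _.
by rewrite /geom3 mulrBl -!exprM mulnC.
Qed.

(** Since [lambert3] is symmetric, only the classes (1, 1) and (2, 2) survive
    in the difference of a(q) and a(q^3). *)
Lemma cubic_CE (R : realType) (q : R) : 0 <= q < 1 ->
  cubic_C q = 3 * (lambert3 q 1 1 - lambert3 q 2 2).
Proof.
move=> q01; rewrite /cubic_C cubic_aE // cubic_a3E // (lambert3C q 2 1).
by field.
Qed.

Lemma cubic_bE (R : realType) (q : R) : 0 <= q < 1 ->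
  cubic_b q = 1 + 3 * (2 * (lambert3 q 0 1 - lambert3 q 0 2)
    - (lambert3 q 1 1 - lambert3 q 1 2) - (lambert3 q 2 1 - lambert3 q 2 2)).
Proof.
move=> q01; rewrite /cubic_b cubic_a3E // cubic_aE // !(lambert3C q 0) (lambert3C q 2 1).
by field.
Qed.

(** * Product expansions *)

Lemma cvg_subn (R : realType) (f : nat -> R) (l : R) (n : nat) :
  f @ \oo --> l -> (fun N => f (N - n)%N) @ \oo --> l.
Proof.
move=> fl; rewrite -(cvg_shiftn n (fun N => f (N - n)%N)).
by under eq_fun do rewrite addnK.
Qed.

Lemma cvg_addn (R : realType) (f : nat -> R) (l : R) (n : nat) :
  f @ \oo --> l -> (fun N => f (N + n)%N) @ \oo --> l.
Proof. by move=> fl; rewrite cvg_shiftn. Qed.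

Lemma cvg_mul3n (R : realType) (f : nat -> R) (l : R) :
  f @ \oo --> l -> (fun N => f (3 * N)%N) @ \oo --> l.
Proof.
move=> fl; apply: (cvg_comp (fun N => (3 * N)%N) f) fl.
move=> A [N0 _ HN0]; exists N0 => // N /= NN0; apply: HN0 => /=.
by apply: leq_trans NN0 _; rewrite leq_pmull.
Qed.

Lemma cvgn_decreasing_prod (R : realType) (f : nat -> R) :
  (forall n, 0 < f n <= 1) ->
  let P := fun N => \prod_(0 <= n < N) f n in
  [/\ forall N, 0 < P N <= 1, cvgn P & forall N, limn P <= P N].
Proof.
move=> f01 P.
have P01 N : 0 < P N <= 1.
  elim: N => [|N /andP[P0 P1]]; first by rewrite /P big_geq // ltr01 lexx.
  have /andP[f0 f1] := f01 N.
  by rewrite /P big_nat_recr //= mulr_gt0 //= mulr_ile1 // ltW.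
have nP : nonincreasing_seq P.
  apply/nonincreasing_seqP => n; have /andP[P0 _] := P01 n.
  have /andP[_ f1] := f01 n.
  by rewrite {1}/P big_nat_recr //= ler_piMr // ltW.
have cP : cvgn P.
  apply: nonincreasing_is_cvgn => //.
  by exists 0 => _ [N _ <-]; case/andP: (P01 N) => /ltW.
by split=> // N; apply: nonincreasing_cvgn_ge.
Qed.

(** This is q^(-1/24) eta. *)
Definition euler (R : realType) (q : R) : R :=
  limn (fun N => \prod_(0 <= n < N) (1 - q ^+ n.+1)).

Lemma euler_factor (R : realType) (q : R) (n : nat) : 0 <= q < 1 ->
  0 < 1 - q ^+ n.+1 <= 1.
Proof.
move=> /andP[q0 q1]; rewrite subr_gt0 exprn_ilt1 //= gerBl.
by rewrite exprn_ge0.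
Qed.

Lemma cvg_euler (R : realType) (q : R) : 0 <= q < 1 ->
  (fun N => \prod_(0 <= n < N) (1 - q ^+ n.+1)) @ \oo --> euler q.
Proof.
by move=> q01; have [] := cvgn_decreasing_prod (fun n => euler_factor n q01).
Qed.

Lemma weierstrass_prod (R : realType) (f : nat -> R) (K N : nat) :
  (forall n, 0 <= f n <= 1) ->
  1 - \sum_(K <= n < N) f n <= \prod_(K <= n < N) (1 - f n).
Proof.
move=> f01; have [KN|NK] := leqP K N; last by rewrite !big_geq ?subr0 // ltnW.
rewrite -(subnK KN) addnC; elim: (N - K)%N => [|m IH].
  by rewrite addn0 !big_geq // subr0.
rewrite addnS !big_nat_recr ?leq_addr //=.
have /andP[f0 f1] := f01 (K + m)%N.
have s0 : 0 <= \sum_(K <= n < K + m) f n.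
  by apply: sumr_ge0 => n _; case/andP: (f01 n).
have f1' : 0 <= 1 - f (K + m)%N by rewrite subr_ge0.
apply: le_trans (ler_wpM2r f1' IH).
have : 0 <= (\sum_(K <= n < K + m) f n) * f (K + m)%N by rewrite mulr_ge0.
by move: (\sum_(_ <= _ < _) _) => s; nra.
Qed.

(** Beyond finitely many factors the product stays above 1/2, by the
    inequality of Weierstrass. *)
Lemma euler_gt0 (R : realType) (q : R) : 0 <= q < 1 -> 0 < euler q.
Proof.
move=> q01; have /andP[q0 q1] := q01.
have [P01 cP _] := cvgn_decreasing_prod (fun n => euler_factor n q01).
have cg : cvgn (series (fun n => q * q ^+ n)) by exact: cvgn_geom.
have [K _ HK] := (cvgrPdist_lt _ _).1 cg (1 / 2) (divr_gt0 ltr01 (ltr0n _ 2)).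
have ndg : nondecreasing_seq (series (fun n => q * q ^+ n)).
  apply/nondecreasing_seqP => n; rewrite /series /= big_nat_recr //= lerDl.
  by rewrite mulr_ge0 ?exprn_ge0.
have /andP[PK0 _] := P01 K.
apply: (@lt_le_trans _ _ ((\prod_(0 <= n < K) (1 - q ^+ n.+1)) / 2)).
  by rewrite divr_gt0.
apply: limr_ge => //; exists K => // N /= KN.
rewrite [leRHS](big_cat_nat (n := K)) //= ler_wpM2l ?(ltW PK0) //.
apply: le_trans (weierstrass_prod K N _); last first.
  by move=> n; rewrite exprn_ge0 //= exprn_ile1 // ltW.
have := HK K (leqnn K); rewrite /=.
have h : \sum_(K <= n < N) q ^+ n.+1 <= limn (series (fun n => q * q ^+ n)) - series (fun n => q * q ^+ n) K.
  rewrite lerBrDl; under eq_bigr do rewrite exprS.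
  rewrite -[series _ K]/(\sum_(0 <= n < K) q * q ^+ n) -(big_cat_nat (n := K)) //=.
  exact: (nondecreasing_cvgn_le ndg cg N).
move=> /(le_lt_trans (ler_norm _)) h2.
by move: h h2; move: (limn _) (series _ K) (\sum_(_ <= _ < _) _) => a b c; lra.
Qed.

(** Theta-like sums and products run over the integers; their truncations are
    indexed from their centre N in both directions. *)
Lemma big_split_middle (T : Type) (idx : T) (op : Monoid.com_law idx) (N K : nat)
  (F : nat -> T) :
  \big[op/idx]_(0 <= i < N + K) F i =
  op (\big[op/idx]_(0 <= n < K) F (N + n)%N)
     (\big[op/idx]_(0 <= m < N) F (N - m.+1)%N).
Proof.
rewrite (big_cat_nat (n := N)) ?leq_addr //= Monoid.mulmC; congr (op _ _).
  rewrite -{1}[N]add0n big_addn addKn; apply: eq_bigr => i _.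
  by rewrite addnC.
by rewrite big_nat_rev add0n.
Qed.

(** The coefficients of the finite expansion at base p^3 and x = p. *)
Definition prodA (R : realType) (p : R) (m : nat) : R :=
  \prod_(0 <= j < m) ((1 - p ^+ (3 * j + 2)) / (1 - p ^+ (3 * j + 3))).
Definition prodB (R : realType) (p : R) (m : nat) : R :=
  \prod_(0 <= j < m) ((1 - p ^+ (3 * j + 1)) / (1 - p ^+ (3 * j + 3))).

(** The finite expansion at base p^3, with x = p and Y = p^(1 - 3 N): its
    indices are centred at N, and its right-hand side telescopes. *)
Lemma finite_cubic_C (R : realType) (p : R) (N : nat) : 0 < p < 1 ->
  \sum_(0 <= n < N.+1) (prodA p (N + n) * prodB p (N - n) *
     (p ^+ n / (1 - p ^+ (3 * n + 1))))
  - \sum_(0 <= m < N) (prodA p (N - m.+1) * prodB p (N + m.+1) *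
     (p ^+ (2 * m + 1) / (1 - p ^+ (3 * m + 2))))
  = (1 - p ^+ (3 * N + 1))^-1.
Proof.
move=> /andP[p0 p1].
have pn0 n : p ^+ n != 0 by rewrite expf_neq0 // gt_eqF.
have p1n n : 1 - p ^+ n.+1 != 0 by rewrite subr_eq0 gt_eqF // exprn_ilt1 // ltW.
have p1na n k : 1 - p ^+ (n + k.+1) != 0 by rewrite addnS.
pose Y := p / p ^+ (3 * N).
have YR n : Y * (p ^+ 3) ^+ (N + n) = p ^+ (3 * n + 1).
  rewrite /Y -exprM mulnDr exprD addn1 exprS.
  by have := pn0 (3 * N)%N; move: (p ^+ (3 * N)) => z z0; field.
have YL m : (m < N)%N -> Y * (p ^+ 3) ^+ (N - m.+1) = (p ^+ (3 * m + 2))^-1.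
  move=> mN; rewrite /Y -exprM.
  have {1}-> : (3 * N)%N = (3 * (N - m.+1) + (3 * m + 2).+1)%N by lia.
  rewrite exprD [p ^+ (_ + 2).+1]exprS.
  have := pn0 (3 * (N - m.+1))%N; have := pn0 (3 * m + 2)%N.
  have := gt_eqF p0; move: (p ^+ (3 * _)) (p ^+ (_ + 2)) => z w p0' w0 z0.
  by field; rewrite p0' w0 z0.
have Yn i : 1 - Y * (p ^+ 3) ^+ i != 0.
  have [iN|Ni] := ltnP i N.
    have {1}-> : i = (N - (N - i.+1).+1)%N by lia.
    rewrite YL; last by lia.
    by rewrite subr_eq0 eq_sym invr_eq1 eq_sym -subr_eq0; exact: (p1na _ 1%N).
  have {1}-> : i = (N + (i - N))%N by lia.
  by rewrite YR; exact: (p1na _ 0%N).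
have Q1 j : 1 - (p ^+ 3) ^+ j.+1 != 0 by rewrite -exprM mulnS; exact: p1n.
have K := @finite_kronecker R p (p ^+ 3) (N + N) Y (pn0 3%N) Q1 (fun i _ => Yn i).
have {}K : \sum_(0 <= i < N + N.+1) p ^+ i * (prodA p i * prodB p (N + N - i)) /
    (1 - Y * (p ^+ 3) ^+ i)
  = (\prod_(0 <= j < N + N) (1 - p * Y * (p ^+ 3) ^+ j)) /
    \prod_(0 <= j < N + N.+1) (1 - Y * (p ^+ 3) ^+ j).
  rewrite !addnS -K.
  apply: eq_bigr => i _; congr (_ / _); rewrite mulrA; congr (_ * _).
    rewrite /prodA.
    have -> : p ^+ i = \prod_(0 <= j < i) p by rewrite prodr_const_nat subn0.
    rewrite -big_split /=; apply: eq_bigr => j _.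
    rewrite -exprM mulrA; congr (_ / _); last by rewrite mulnS addnC.
    by rewrite mulrBr mulr1 -exprS; congr (_ - p ^+ _); lia.
  rewrite /prodB; apply: eq_bigr => j _.
  by rewrite -!exprM -exprS; congr ((1 - p ^+ _) / (1 - p ^+ _)); lia.
have N0 := pn0 N.
apply: (mulfI N0).
transitivity (\sum_(0 <= i < N + N.+1) p ^+ i * (prodA p i * prodB p (N + N - i)) /
    (1 - Y * (p ^+ 3) ^+ i)).
  rewrite big_split_middle /= mulrBr !mulr_sumr -sumrN; congr (_ + _).
    apply: eq_bigr => n _; rewrite YR (exprD _ N) subnDl.
    by move: (1 - _)^-1 => z; ring.
  apply: eq_big_nat => m /andP[_ mN]; rewrite YL //.
  have -> : (N + N - (N - m.+1) = N + m.+1)%N by lia.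
  have -> : p ^+ N = p ^+ (N - m.+1) * p ^+ m.+1 by rewrite -exprD subnK.
  have -> : (3 * m + 2 = (2 * m + 1) + m.+1)%N by lia.
  have := p1n (2 * m + 1 + m)%N; rewrite -addnS exprD.
  have := pn0 (2 * m + 1)%N; have := pn0 m.+1.
  move: (p ^+ (2 * m + 1)) (p ^+ m.+1) (p ^+ (N - _)) (prodA _ _) (prodB _ _).
  move=> z w v a b w0 z0 zw; field.
  by rewrite w0 z0 zw /= andbT -opprB oppr_eq0 zw.
rewrite K !big_split_middle /= big_nat_recr //= YR.
set P1 := \prod_(0 <= n < N) (1 - p * Y * (p ^+ 3) ^+ (N + n)).
set P2 := \prod_(0 <= n < N) (1 - p * Y * (p ^+ 3) ^+ (N - n.+1)).
set P3 := \prod_(0 <= n < N) (1 - Y * (p ^+ 3) ^+ (N + n)).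
set P4 := \prod_(0 <= n < N) (1 - Y * (p ^+ 3) ^+ (N - n.+1)).
have P30 : P3 != 0 by rewrite prodf_seq_neq0; apply/allP => i _ /=.
have P40 : P4 != 0 by rewrite prodf_seq_neq0; apply/allP => i _ /=.
(* The factors of P1 and P4, and of P2 and P3, are of the form 1 - z and
   1 - 1 / z, whose quotient is - z. *)
have E : P1 * P2 = p ^+ N * (P3 * P4).
  have -> : p ^+ N = \prod_(0 <= j < N) p by rewrite prodr_const_nat subn0.
  rewrite /P1 /P2 /P3 /P4 -!big_split /=; apply: eq_big_nat => m /andP[_ mN].
  rewrite -[p * Y * _ ^+ (N + m)]mulrA -[p * Y * _ ^+ (N - _)]mulrA YL // YR.
  have -> : (3 * m + 2 = (3 * m + 1).+1)%N by lia.
  rewrite exprS; have := pn0 (3 * m + 1)%N.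
  by have := gt_eqF p0; move: (p ^+ _) => z p0' z0; field; rewrite p0' z0.
have := p1na (3 * N)%N 0%N; move: (p ^+ (3 * N + 1)) => z z1.
by rewrite E; field; rewrite P30 P40 z1.
Qed.

Lemma cubic_factor (R : realType) (p : R) (i n : nat) : 0 < p < 1 -> (i <= 2)%N ->
  0 < (1 - p ^+ (3 * n + i.+1)) / (1 - p ^+ (3 * n + 3)) <= 1.
Proof.
move=> /andP[p0 p1] i2.
have h k : 0 < 1 - p ^+ (3 * n + k.+1) by rewrite subr_gt0 addnS exprn_ilt1 // ltW.
rewrite divr_gt0 ?h //= ler_pdivrMr ?(h 2%N) // mul1r.
by rewrite lerB // ler_wiXn2l ?ltW // leq_add2l.
Qed.

Lemma cvgn_prodA (R : realType) (p : R) : 0 < p < 1 ->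
  (forall m, 0 < prodA p m <= 1) /\ cvgn (prodA p).
Proof.
by move=> p01; have [] := cvgn_decreasing_prod (fun n => cubic_factor n p01 (isT : 1 <= 2)%N).
Qed.

Lemma cvgn_prodB (R : realType) (p : R) : 0 < p < 1 ->
  (forall m, 0 < prodB p m <= 1) /\ cvgn (prodB p).
Proof.
by move=> p01; have [] := cvgn_decreasing_prod (fun n => cubic_factor n p01 (isT : 0 <= 2)%N).
Qed.

Lemma prodAB_euler (R : realType) (p : R) : 0 < p < 1 ->
  limn (prodA p) * limn (prodB p) = euler p / euler (p ^+ 3) ^+ 3.
Proof.
move=> p01; have /andP[p0 p1] := p01.
have [_ cA] := cvgn_prodA p01; have [_ cB] := cvgn_prodB p01.
have p01' : 0 <= p < 1 by rewrite p1 ltW.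
have p301 : 0 <= p ^+ 3 < 1 by rewrite exprn_ge0 ?exprn_ilt1 // ltW.
have h1 := cvg_mul3n (cvg_euler p01').
have h3 := cvg_euler p301.
have e30 : euler (p ^+ 3) != 0 by rewrite gt_eqF // euler_gt0.
have hAB : (fun N => prodA p N * prodB p N) @ \oo --> limn (prodA p) * limn (prodB p).
  exact: cvgM.
have hE : (fun N => (\prod_(0 <= n < 3 * N) (1 - p ^+ n.+1)) /
    (\prod_(0 <= n < N) (1 - (p ^+ 3) ^+ n.+1)) ^+ 3) @ \oo -->
    euler p / euler (p ^+ 3) ^+ 3.
  apply: cvgM => //; apply: cvgV; first exact: expf_neq0.
  by apply: (cvgM h3 (cvgM h3 h3)).
rewrite -(cvg_lim _ hAB) // -(cvg_lim _ hE) //.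
congr (limn _); apply/funext => N.
elim: N => [|N IH].
  by rewrite /prodA /prodB muln0 !big_geq // expr1n invr1 !mul1r.
rewrite (_ : (3 * N.+1 = (3 * N).+3)%N); last by lia.
rewrite /prodA /prodB !big_nat_recr //= -/(prodA p N) -/(prodB p N).
rewrite mulrACA IH -exprM (_ : (3 * N.+1 = (3 * N).+3)%N); last by lia.
rewrite addn1 addn2 addn3.
have q0 k : 1 - p ^+ k.+1 != 0.
  by rewrite subr_eq0 gt_eqF // exprn_ilt1 // ltW.
have := q0 (3 * N).+2.
have : \prod_(0 <= n < N) (1 - (p ^+ 3) ^+ n.+1) != 0.
  rewrite prodf_seq_neq0; apply/allP => i _ /=.
  by rewrite -exprM mulnS; exact: q0.
set x := \prod_(0 <= n < N) _; set y := \prod_(0 <= i < 3 * N) _ => x0.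
by move: (p ^+ (3 * N).+3) => z z0; field; rewrite x0 z0.
Qed.

(** The limit of [finite_cubic_C] as N grows: its coefficients lie between 0
    and 1, so a geometric series dominates the sum. *)
Lemma kronecker_cubic (R : realType) (p : R) : 0 < p < 1 ->
  series (fun n => p ^+ n / (1 - p ^+ (3 * n + 1))
                   - p ^+ (2 * n + 1) / (1 - p ^+ (3 * n + 2))) @ \oo -->
  euler (p ^+ 3) ^+ 3 / euler p.
Proof.
move=> p01; have /andP[p0 p1] := p01.
have [A01 cA] := cvgn_prodA p01; have [B01 cB] := cvgn_prodB p01.
have p1n n k : 1 - p <= 1 - p ^+ (n + k.+1).
  by rewrite lerB // addnS exprS ler_piMr ?(ltW p0) // exprn_ile1 // ltW.
have p1n' n k : (1 - p ^+ (n + k.+1))^-1 <= (1 - p)^-1.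
  have p1' : 0 < 1 - p by rewrite subr_gt0.
  by rewrite lef_pV2 ?p1n // posrE //; apply: lt_le_trans (p1n n k).
have p1n0 n k : 0 <= (1 - p ^+ (n + k.+1))^-1.
  by rewrite invr_ge0 (le_trans _ (p1n n k)) // subr_ge0 ltW.
pose t1 n := p ^+ n / (1 - p ^+ (3 * n + 1)).
pose t2 n := p ^+ (2 * n + 1) / (1 - p ^+ (3 * n + 2)).
have t10 n : 0 <= t1 n <= p ^+ n / (1 - p).
  by rewrite mulr_ge0 ?p1n0 ?exprn_ge0 ?(ltW p0) //= ler_wpM2l ?p1n' ?exprn_ge0 // ltW.
have t20 n : 0 <= t2 n <= p ^+ n / (1 - p).
  rewrite mulr_ge0 ?p1n0 ?exprn_ge0 ?(ltW p0) //=.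
  apply: ler_pM; rewrite ?p1n0 ?p1n' ?exprn_ge0 ?(ltW p0) //.
  by apply: ler_wiXn2l; rewrite ?ltW //; lia.
set A := limn (prodA p); set B := limn (prodB p).
pose u N n := prodA p (N + n) * prodB p (N - n) * t1 n
              - prodA p (N - n.+1) * prodB p (N + n.+1) * t2 n.
have [cs lims] : cvgn (series (fun n => A * B * t1 n - A * B * t2 n)) /\
    (fun N => \sum_(0 <= n < N) u N n) @ \oo -->
      limn (series (fun n => A * B * t1 n - A * B * t2 n)).
  apply: (@tannery _ u _ (fun n => (2 / (1 - p)) * p ^+ n)).
  - move=> N n _ /=; apply: (le_trans (ler_normB _ _)).
    have AB a b t : 0 < prodA p a <= 1 -> 0 < prodB p b <= 1 ->
        0 <= t <= p ^+ n / (1 - p) ->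
        `|prodA p a * prodB p b * t| <= p ^+ n / (1 - p).
      move=> /andP[a0 a1] /andP[b0 b1] /andP[t0 t1'].
      rewrite ger0_norm ?mulr_ge0 ?(ltW a0) ?(ltW b0) //.
      by apply: le_trans t1'; rewrite ler_piMl // mulr_ile1 ?(ltW a0) ?(ltW b0).
    rewrite [leRHS](_ : _ = p ^+ n / (1 - p) + p ^+ n / (1 - p)); last by ring.
    by apply: lerD; apply: AB.
  - by apply: cvgn_geom; rewrite p1 ltW.
  - move=> n; apply: cvgB.
      apply: cvgM; last exact: cvg_cst.
      by apply: cvgM; [exact: cvg_addn|exact: cvg_subn].
    apply: cvgM; last exact: cvg_cst.
    by apply: cvgM; [exact: cvg_subn|exact: cvg_addn].
have pN0 : (fun N => p ^+ N) @ \oo --> (0 : R).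
  by apply: cvg_expr; rewrite ger0_norm // ltW.
have fin N : \sum_(0 <= n < N) u N n
    = (1 - p ^+ (3 * N + 1))^-1 - prodA p (N + N) * t1 N.
  rewrite -finite_cubic_C // big_nat_recr //= subnn.
  have -> : prodB p 0 = 1 by rewrite /prodB big_geq.
  by rewrite mulr1 /u sumrB -/(t1 N); ring.
have l1 : (fun N => (1 - p ^+ (3 * N + 1))^-1 - prodA p (N + N) * t1 N) @ \oo --> (1 : R).
  rewrite -[X in _ --> X](subr0 1); apply: cvgB.
    rewrite -[X in _ --> X]invr1; apply: cvgV; first exact: oner_neq0.
    rewrite -[X in _ --> X](subr0 1); apply: cvgB; first exact: cvg_cst.
    by apply: cvg_mul3n (cvg_addn 1%N pN0).
  apply: (@squeeze_cvgr _ _ _ _ (fun=> 0) (fun N => p ^+ N / (1 - p))).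
  - apply: nearW => N; have /andP[h0 h1] := A01 (N + N)%N.
    have /andP[g0 g1] := t10 N.
    by rewrite mulr_ge0 ?(ltW h0) //=; apply: le_trans g1; rewrite ler_piMl.
  - exact: cvg_cst.
  - rewrite -[X in _ --> X](mul0r (1 - p)^-1).
    by apply: cvgM => //; exact: cvg_cst.
have E1 : limn (series (fun n => A * B * t1 n - A * B * t2 n)) = 1.
  by rewrite -(cvg_lim _ lims) // -[RHS](cvg_lim _ l1) //; congr (limn _); apply/funext.
have ABE : A * B = euler p / euler (p ^+ 3) ^+ 3 by exact: prodAB_euler.
have e0 : euler p != 0 by rewrite gt_eqF // euler_gt0 // p1 ltW.
have e30 : euler (p ^+ 3) != 0.
  by rewrite gt_eqF // euler_gt0 // exprn_ge0 ?exprn_ilt1 // ltW.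
have AB0 : A * B != 0 by rewrite ABE mulf_neq0 // invr_neq0 // expf_neq0.
have -> : euler (p ^+ 3) ^+ 3 / euler p =
    (A * B)^-1 * limn (series (fun n => A * B * t1 n - A * B * t2 n)).
  by rewrite E1 ABE mulr1 invf_div.
apply: (eq_cvgn (cvgM (cvg_cst (A * B)^-1) cs)) => N.
rewrite /series /= mulr_sumr; apply: eq_bigr => n _.
by rewrite -mulrBr mulKf.
Qed.

Lemma sum_group3 (V : nmodType) (f : nat -> V) (N : nat) :
  \sum_(0 <= m < 3 * N) f m =
  \sum_(0 <= n < N) (f (3 * n)%N + f (3 * n).+1 + f (3 * n).+2).
Proof.
elim: N => [|N IH]; first by rewrite muln0 !big_geq.
rewrite [in RHS]big_nat_recr //= -IH (_ : (3 * N.+1 = (3 * N).+3)%N); last by lia.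
move: (3 * N)%N => k.
by rewrite !big_nat_recr //= !addrA.
Qed.

Lemma res3E (R : realType) (i n k : nat) : res3 R i (3 * n + k) = (k %% 3 == i)%N%:R.
Proof. by rewrite /res3 mulnC modnMDl. Qed.

(** By [cubic_CE] the Lambert series of C runs over the m = 1 and m = 2
    modulo 3 only; it is the series of [kronecker_cubic] at p = q^3. *)
Lemma cubic_C_euler (R : realType) (q : R) : 0 < q < 1 ->
  cubic_C q = 3 * q * euler (q ^+ 9) ^+ 3 / euler (q ^+ 3).
Proof.
move=> q01; have /andP[q0 q1] := q01.
have q01' : 0 <= q < 1 by rewrite q1 ltW.
have q301 : 0 < q ^+ 3 < 1 by rewrite exprn_gt0 // exprn_ilt1 // ltW.
rewrite cubic_CE // (_ : _ / _ = 3 * (q * (euler (q ^+ 9) ^+ 3 / euler (q ^+ 3))));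
  last by rewrite !mulrA.
congr (_ * _).
have h := kronecker_cubic q301; rewrite -exprM (_ : (3 * 3 = 9)%N) // in h.
have h1 := cvg_mul3n (@lambert3_rows R q 1 1 q01' isT).
have h2 := cvg_mul3n (@lambert3_rows R q 2 2 q01' isT).
have h12 : (fun N =>
    series (fun m => res3 R 1 m.+1 * geom3 1 (q ^+ m.+1)) (3 * N)%N -
    series (fun m => res3 R 2 m.+1 * geom3 2 (q ^+ m.+1)) (3 * N)%N) @ \oo -->
    lambert3 q 1 1 - lambert3 q 2 2 by exact: cvgB h1 h2.
have hq : (fun N => q * series (fun n =>
    (q ^+ 3) ^+ n / (1 - (q ^+ 3) ^+ (3 * n + 1))
    - (q ^+ 3) ^+ (2 * n + 1) / (1 - (q ^+ 3) ^+ (3 * n + 2))) N) @ \oo -->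
    q * (euler (q ^+ 9) ^+ 3 / euler (q ^+ 3)).
  by apply: cvgM; [exact: cvg_cst|exact: h].
rewrite -(cvg_lim _ h12) // -[RHS](cvg_lim _ hq) //.
congr (limn _); apply/funext => N.
rewrite /series /= !sum_group3 -sumrB mulr_sumr; apply: eq_bigr => n _.
have r i k : res3 R i (3 * n + k).+1 = (k.+1 %% 3 == i)%N%:R.
  by rewrite -addnS res3E.
have r0 i := r i 0%N; rewrite addn0 in r0.
have r1 i := r i 1%N; rewrite addn1 in r1.
have r2 i := r i 2%N; rewrite addn2 in r2.
rewrite !r0 !r1 !r2 /geom3 -!exprM /=.
rewrite !(mul0r, mul1r, add0r, addr0) mulrBr !mulrA -!exprS.
by congr (q ^+ _ / (1 - q ^+ _) - q ^+ _ / (1 - q ^+ _)); lia.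
Qed.

(** The finite expansion at a cube root of unity w, with x = w: the sums at
    Y = w q^-N and at Y = w^2 q^-N are subtracted, the second one being zero.
    The difference of the two fractions is invariant under the change of sign
    of the centred index, and decays on both sides. *)
Lemma finite_cubic_b (F : fieldType) (w q : F) (N : nat) :
  w ^+ 2 + w + 1 = 0 -> (3 : F) != 0 -> q != 0 ->
  (forall j, 1 - q ^+ j.+1 != 0) ->
  (forall j, 1 - w * q ^+ j != 0) -> (forall j, 1 - w ^+ 2 * q ^+ j != 0) ->
  let U m := \prod_(0 <= j < m) ((1 - w ^+ 2 * q ^+ j.+1) / (1 - q ^+ j.+1)) in
  let V m := \prod_(0 <= j < m) ((1 - w * q ^+ j.+1) / (1 - q ^+ j.+1)) in
  let g n := q ^+ n / (1 + q ^+ n + q ^+ n ^+ 2) in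
  (0 < N)%N ->
  \sum_(0 <= n < N.+1) w ^+ n * (U (N + n)%N * V (N - n)%N / (1 - w * q ^+ (N - n))) * g n
  + \sum_(0 <= m < N) (w ^+ 2) ^+ m.+1 *
      (U (N - m.+1)%N * V (N + m.+1)%N / (1 - w * q ^+ (N + m.+1))) * g m.+1
  = (3 * (1 - w ^+ 2 * q ^+ N))^-1.
Proof.
move=> w3 F3 q0 q1 wq w2q U V g N0.
have qn0 n : q ^+ n != 0 by rewrite expf_neq0.
have w0 : w != 0.
  by apply/eqP => wz; move: w3; rewrite wz expr0n /= !add0r => /eqP; rewrite oner_eq0.
have w2E : w ^+ 2 = - w - 1 by apply/eqP; rewrite -subr_eq0 -w3; apply/eqP; ring.
have w31 : w ^+ 3 = 1 by rewrite exprS w2E mulrDr mulrN -expr2 w2E; ring.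
have gE y : (1 - w * y) * (1 - w ^+ 2 * y) = 1 + y + y ^+ 2.
  transitivity (1 - (w ^+ 2 + w) * y + w ^+ 3 * y ^+ 2); first by ring.
  by rewrite w31 w2E; ring.
have sgn (v : F) : (forall j, 1 - v * q ^+ j != 0) -> forall v', v * v' = 1 ->
    (forall j, 1 - v' * q ^+ j != 0) ->
    forall i, (i <= N + N)%N -> 1 - v / q ^+ N * q ^+ i != 0.
  move=> vq v' vv' v'q i iN.
  have [Ni|iN'] := leqP N i.
    by rewrite -(subnK Ni) addnC exprD mulrA divfK // vq.
  rewrite -{1}(subnK (ltnW iN')) exprD invfM mulrA divfK ?qn0 //.
  apply: contraNneq (v'q (N - i)%N) => e; apply/eqP.
  have -> : v' = (v * v')/ v.
    by rewrite mulrAC mulfV ?mul1r //; apply: contra_eq_neq vv' => ->; rewrite mul0r eq_sym oner_eq0.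
  rewrite vv' mul1r; apply/eqP; rewrite subr_eq0; move/eqP: e; rewrite subr_eq0.
  by move=> /eqP e; rewrite -[q ^+ _]invrK -invfM -e invr1.
have Y1 := sgn w wq (w ^+ 2) _ w2q; have Y2 := sgn (w ^+ 2) w2q w _ wq.
have {}Y1 := Y1 (etrans (esym (exprS w 2)) w31).
have {}Y2 := Y2 (etrans (esym (exprSr w 2)) w31).
have K1 := @finite_kronecker F w q (N + N) _ q0 q1 Y1.
have K2 := @finite_kronecker F w q (N + N) _ q0 q1 Y2.
have Z : \prod_(0 <= j < N + N) (1 - w * (w ^+ 2 / q ^+ N) * q ^+ j) = 0.
  apply/eqP; rewrite prodf_seq_eq0; apply/hasP; exists N.
    by rewrite mem_index_iota /=; lia.
  by rewrite /= mulrA -exprS w31 mul1r mulVf // subrr.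
rewrite Z mul0r in K2.
pose c i := \prod_(0 <= j < i) ((w - q ^+ j.+1) / (1 - q ^+ j.+1)) *
            \prod_(0 <= j < N + N - i) ((1 - w * q ^+ j) / (1 - q ^+ j.+1)).
have cE i : c i = w ^+ i * U i * ((1 - w) * V (N + N - i)%N / (1 - w * q ^+ (N + N - i))).
  congr (_ * _).
    have -> : w ^+ i = \prod_(0 <= j < i) w by rewrite prodr_const_nat subn0.
    rewrite -big_split /=; apply: eq_bigr => j _; rewrite mulrA; congr (_ / _).
    by rewrite mulrBr mulr1 mulrA -exprS w31 mul1r.
  move: (N + N - i)%N => m; elim: m => [|m IH].
    by rewrite /V !big_geq // expr0 !mulr1 divff //; have := wq 0%N; rewrite expr0 mulr1.
  rewrite /V !big_nat_recr //= -/(V m) IH.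
  by have := wq m; have := wq m.+1; have := q1 m;
    move: (w * q ^+ m) (w * q ^+ m.+1) (q ^+ m.+1) => z1 z2 z3 h1 h2 h3;
    field; rewrite h1 h2 h3.
(* Only the expansion at Y = w q^-N contributes to the right-hand side. *)
have D : \sum_(0 <= i < (N + N).+1)
    c i * ((1 - w / q ^+ N * q ^+ i)^-1 - (1 - w ^+ 2 / q ^+ N * q ^+ i)^-1) =
    (\prod_(0 <= j < N + N) (1 - w * (w / q ^+ N) * q ^+ j)) /
      \prod_(0 <= j < (N + N).+1) (1 - w / q ^+ N * q ^+ j).
  rewrite -K1 -[RHS]subr0 -[X in _ = _ - X]K2 -sumrB.
  by apply: eq_bigr => i _; rewrite mulrBr.
pose pb := \prod_(0 <= m < N) (1 - w * q ^+ m.+1).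
pose pd := \prod_(0 <= m < N) (1 - w ^+ 2 * q ^+ m.+1).
pose pk := \prod_(0 <= m < N) (- w / q ^+ m.+1).
have pb0 : pb != 0 by rewrite prodf_seq_neq0; apply/allP => i _ /=.
have pd0 : pd != 0 by rewrite prodf_seq_neq0; apply/allP => i _ /=.
have pk0 : pk != 0.
  rewrite prodf_seq_neq0; apply/allP => i _ /=.
  by rewrite mulf_neq0 ?oppr_eq0 ?invr_neq0.
have qR v n : v / q ^+ N * q ^+ (N + n) = v * q ^+ n.
  by rewrite exprD mulrA divfK.
have qL v m : (m < N)%N -> v / q ^+ N * q ^+ (N - m.+1) = v / q ^+ m.+1.
  by move=> mN; rewrite -{1}(subnK mN) exprD invfM mulrA mulrAC divfK.
have w1 : 1 - w != 0 by have := wq 0%N; rewrite expr0 mulr1.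
have num : \prod_(0 <= j < N + N) (1 - w * (w / q ^+ N) * q ^+ j) =
    (1 - w ^+ 2) * pd / (1 - w ^+ 2 * q ^+ N) * (w ^+ N * pk * pb).
  rewrite big_split_middle /=; congr (_ * _).
    apply: (mulIf (w2q N)); rewrite divfK //.
    rewrite -[1 - w ^+ 2 in RHS]mulr1.
    transitivity (\prod_(0 <= n < N.+1) (1 - w ^+ 2 * q ^+ n)).
      rewrite big_nat_recr //=; congr (_ * _); apply: eq_bigr => n _.
      by rewrite mulrA -expr2 qR.
    by rewrite big_nat_recl //= expr0 !mulr1.
  have -> : w ^+ N = \prod_(0 <= j < N) w by rewrite prodr_const_nat subn0.
  rewrite -!big_split /=; apply: eq_big_nat => m /andP[_ mN].
  rewrite mulrA -expr2 qL //.
  have := qn0 m.+1; move: (q ^+ m.+1) => y y0.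
  by transitivity (w ^+ 3 - w ^+ 2 / y); [rewrite w31|field].
have den : \prod_(0 <= j < (N + N).+1) (1 - w / q ^+ N * q ^+ j) =
    (1 - w) * pb * (pk * pd).
  rewrite -addnS big_split_middle /=; congr (_ * _).
    rewrite big_nat_recl //= qR expr0 mulr1; congr (_ * _).
    by apply: eq_bigr => n _; rewrite qR.
  rewrite -big_split /=; apply: eq_big_nat => m /andP[_ mN]; rewrite qL //.
  have := qn0 m.+1; move: (q ^+ m.+1) => y y0.
  by transitivity (w ^+ 3 - w / y); [rewrite w31|field].
have RHSE : (\prod_(0 <= j < N + N) (1 - w * (w / q ^+ N) * q ^+ j)) /
      \prod_(0 <= j < (N + N).+1) (1 - w / q ^+ N * q ^+ j) =
      w ^+ N * (1 + w) / (1 - w ^+ 2 * q ^+ N).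
  rewrite num den; have := w2q N; move: (w ^+ 2 * q ^+ N) => z z1.
  by field; rewrite w1 z1 pb0 pk0 pd0.
have K3 : (1 - w) * (w - w ^+ 2) = - (3 * w ^+ 2).
  by transitivity (w * (w ^+ 2 + w + 1) - 3 * w ^+ 2); [ring|rewrite w3; ring].
have sub1 n : (1 - w * q ^+ n)^-1 - (1 - w ^+ 2 * q ^+ n)^-1 = (w - w ^+ 2) * g n.
  rewrite /g -gE; have := wq n; have := w2q n; move: (q ^+ n) => y h1 h2.
  by field; rewrite h1 h2.
have sub2 m : (1 - w / q ^+ m.+1)^-1 - (1 - w ^+ 2 / q ^+ m.+1)^-1 =
    (w - w ^+ 2) * g m.+1.
  rewrite /g -gE.
  have := wq m.+1; have := w2q m.+1; have := qn0 m.+1; move: (q ^+ m.+1) => y y0 h1 h2.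
  have -> : 1 - w / y = - w / y * (1 - w ^+ 2 * y).
    by transitivity (w ^+ 3 - w / y); [rewrite w31|field].
  have -> : 1 - w ^+ 2 / y = - w ^+ 2 / y * (1 - w * y).
    by transitivity (w ^+ 3 - w ^+ 2 / y); [rewrite w31|field].
  transitivity (w ^+ 3 * ((- w / y * (1 - w ^+ 2 * y))^-1 -
    (- w ^+ 2 / y * (1 - w * y))^-1)); first by rewrite w31 mul1r.
  by field; rewrite !oppr_eq0 ?expf_neq0 ?y0 ?w0 ?h1 ?h2.
have C0 : - (3 * w ^+ 2) * w ^+ N != 0.
  by rewrite mulf_neq0 ?oppr_eq0 ?mulf_neq0 // expf_neq0.
apply: (mulfI C0).
transitivity (\sum_(0 <= i < (N + N).+1)
    c i * ((1 - w / q ^+ N * q ^+ i)^-1 - (1 - w ^+ 2 / q ^+ N * q ^+ i)^-1)).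
  rewrite -addnS big_split_middle /= mulrDr !mulr_sumr -K3; congr (_ + _).
    apply: eq_bigr => n _; rewrite !qR sub1 cE subnDl exprD.
    by move: (w ^+ N) (w ^+ n) (_^-1) => a b d; ring.
  apply: eq_big_nat => m /andP[_ mN]; rewrite !qL // sub2 cE.
  have -> : (N + N - (N - m.+1) = N + m.+1)%N by lia.
  have -> : w ^+ N = w ^+ (N - m.+1) * w ^+ m.+1 by rewrite -exprD subnK.
  have : w ^+ m.+1 * (w ^+ 2) ^+ m.+1 = 1 by rewrite -exprMn -exprS w31 expr1n.
  move: (w ^+ m.+1) ((w ^+ 2) ^+ m.+1) (w ^+ (N - m.+1)) (_^-1) => a b d e ab.
  rewrite [in RHS](_ : d = d * (a * b)); last by rewrite ab mulr1.
  by ring.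
rewrite D RHSE; have := w2q N; move: (w ^+ 2 * q ^+ N) => z z1.
have -> : 1 + w = - w ^+ 2 by rewrite w2E; ring.
by field; rewrite z1 F3.
Qed.

(** The squared modulus as a real number. *)
Definition sqnormc (R : realType) (z : R[i]) : R := complex.Re z ^+ 2 + complex.Im z ^+ 2.

Lemma ReM (R : realType) (x y : R[i]) :
  complex.Re (x * y) = complex.Re x * complex.Re y - complex.Im x * complex.Im y.
Proof. by case: x; case: y. Qed.

Lemma ImM (R : realType) (x y : R[i]) :
  complex.Im (x * y) = complex.Re x * complex.Im y + complex.Im x * complex.Re y.
Proof. by case: x; case: y. Qed.

Lemma sqnormcM (R : realType) (x y : R[i]) :
  sqnormc (x * y) = sqnormc x * sqnormc y.
Proof. by rewrite /sqnormc ReM ImM; ring. Qed.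

Lemma sqnormc_prod (R : realType) (I : Type) (r : seq I) (f : I -> R[i]) :
  sqnormc (\prod_(i <- r) f i) = \prod_(i <- r) sqnormc (f i).
Proof.
apply: (big_morph (@sqnormc R)); first exact: sqnormcM.
by rewrite /sqnormc /= expr1n expr0n addr0.
Qed.

Lemma Re_le_sqnormc (R : realType) (z : R[i]) (P : R) : 0 <= P ->
  sqnormc z <= P ^+ 2 -> `|complex.Re z| <= P.
Proof.
move=> P0 h; rewrite -(@ler_pXn2r _ 2) ?nnegrE // -normrX ger0_norm ?sqr_ge0 //.
by apply: le_trans h; rewrite lerDl sqr_ge0.
Qed.

(** Convergence by real and imaginary parts, to which the limit theorems for
    real sequences apply. *)
Definition cvgC (R : realType) (z : nat -> R[i]) (l : R[i]) : Prop :=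
  (fun N => complex.Re (z N)) @ \oo --> complex.Re l /\
  (fun N => complex.Im (z N)) @ \oo --> complex.Im l.

Lemma cvgC_cst (R : realType) (l : R[i]) : cvgC (fun=> l) l.
Proof. by split; exact: cvg_cst. Qed.

Lemma cvgC_real (R : realType) (f : nat -> R) (l : R) :
  f @ \oo --> l -> cvgC (fun N => (f N)%:C) l%:C.
Proof. by move=> h; split => //=; exact: cvg_cst. Qed.

Lemma cvgCM (R : realType) (y z : nat -> R[i]) (k l : R[i]) :
  cvgC y k -> cvgC z l -> cvgC (fun N => y N * z N) (k * l).
Proof.
move=> [y1 y2] [z1 z2]; split.
  rewrite ReM; under eq_fun do rewrite ReM.
  by apply: cvgB; apply: cvgM.
rewrite ImM; under eq_fun do rewrite ImM.
by apply: cvgD; apply: cvgM.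
Qed.

Lemma cvgCB (R : realType) (y z : nat -> R[i]) (k l : R[i]) :
  cvgC y k -> cvgC z l -> cvgC (fun N => y N - z N) (k - l).
Proof.
by move=> [y1 y2] [z1 z2]; split; rewrite raddfB; under eq_fun do rewrite raddfB;
  apply: cvgB.
Qed.

Lemma cvgC_shiftn (R : realType) (n : nat) (z : nat -> R[i]) (l : R[i]) :
  cvgC (fun N => z (N + n)%N) l <-> cvgC z l.
Proof.
have e1 : ((fun N => complex.Re (z (N + n)%N)) @ \oo --> complex.Re l) =
    ((fun N => complex.Re (z N)) @ \oo --> complex.Re l).
  exact: (cvg_shiftn n (fun N => complex.Re (z N))).
have e2 : ((fun N => complex.Im (z (N + n)%N)) @ \oo --> complex.Im l) =
    ((fun N => complex.Im (z N)) @ \oo --> complex.Im l).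
  exact: (cvg_shiftn n (fun N => complex.Im (z N))).
by rewrite /cvgC e1 e2.
Qed.

Definition cube_root1 (R : realType) : R[i] := (- (1 / 2)) +i* (Num.sqrt 3 / 2).

Lemma cube_root1E (R : realType) : (cube_root1 R) ^+ 2 + cube_root1 R + 1 = 0.
Proof.
have s3 : Num.sqrt 3 ^+ 2 = 3 :> R by rewrite sqr_sqrtr.
move: s3; rewrite /cube_root1 expr2; move: (Num.sqrt 3) => s s3.
apply/eqP; rewrite eq_complex /=; apply/andP; split; apply/eqP.
  transitivity (3 / 4 - s * s / 4 : R); [by field|by rewrite s3; field].
by field.
Qed.

Section CubicB.
Variables (R : realType) (q : R).
Hypothesis q01 : 0 < q < 1.

Let w := cube_root1 R.
Let Q := q%:C.
Let U m := \prod_(0 <= j < m) ((1 - w ^+ 2 * Q ^+ j.+1) / (1 - Q ^+ j.+1)).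
Let V m := \prod_(0 <= j < m) ((1 - w * Q ^+ j.+1) / (1 - Q ^+ j.+1)).
Let P := euler (q ^+ 3) / euler q ^+ 3.
(* The squared moduli of both U m and V m; they increase to P. *)
Let Pn m := \prod_(0 <= j < m) ((1 + q ^+ j.+1 + q ^+ j.+1 ^+ 2) / (1 - q ^+ j.+1) ^+ 2).

Let q0 : 0 < q. Proof. by case/andP: q01. Qed.
Let q1 : q < 1. Proof. by case/andP: q01. Qed.

Let qn n : 0 < q ^+ n.+1 < 1.
Proof. by rewrite exprn_gt0 //= exprn_ilt1 // ltW. Qed.

Let QX n : Q ^+ n = (q ^+ n)%:C. Proof. by rewrite /Q rmorphXn. Qed.

Let w31 : w ^+ 3 = 1.
Proof.
have := cube_root1E R; rewrite -/w => h.
transitivity ((w - 1) * (w ^+ 2 + w + 1) + 1); first by ring.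
by rewrite h mulr0 add0r.
Qed.

Let w2E : w ^+ 2 = - w - 1.
Proof. by apply/eqP; rewrite -subr_eq0 -(cube_root1E R); apply/eqP; rewrite -/w; ring. Qed.

Let gE (y : R) : (1 - w * y%:C) * (1 - w ^+ 2 * y%:C) = (1 + y + y ^+ 2)%:C.
Proof.
rewrite !rmorphD rmorph1 rmorphXn /=.
transitivity (1 - (w ^+ 2 + w) * y%:C + w ^+ 3 * y%:C ^+ 2); first by ring.
by rewrite w31 w2E; ring.
Qed.

Let Q1E n : 1 - Q ^+ n = (1 - q ^+ n)%:C.
Proof. by rewrite rmorphB rmorph1 QX. Qed.

Let sqn_w (y : R) : sqnormc (1 - w * y%:C) = 1 + y + y ^+ 2.
Proof.
have s3 : Num.sqrt 3 ^+ 2 = 3 :> R by rewrite sqr_sqrtr.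
rewrite /sqnormc /w /cube_root1 /=; move: s3; move: (Num.sqrt 3) => s s3.
transitivity (1 + y + y ^+ 2 / 4 + s ^+ 2 * y ^+ 2 / 4); first by field.
by rewrite s3; field.
Qed.

Let sqn_w2 (y : R) : sqnormc (1 - w ^+ 2 * y%:C) = 1 + y + y ^+ 2.
Proof.
have s3 : Num.sqrt 3 ^+ 2 = 3 :> R by rewrite sqr_sqrtr.
rewrite w2E /sqnormc /w /cube_root1 /=; move: s3; move: (Num.sqrt 3) => s s3.
transitivity (1 + y + y ^+ 2 / 4 + s ^+ 2 * y ^+ 2 / 4); first by field.
by rewrite s3; field.
Qed.

Let sqn_real (y : R) : sqnormc y%:C = y ^+ 2.
Proof. by rewrite /sqnormc /= expr0n addr0. Qed.

Let Pn_cvg : Pn @ \oo --> P.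
Proof.
have q01' : 0 <= q < 1 by rewrite q1 ltW.
have q301 : 0 <= q ^+ 3 < 1 by rewrite exprn_ge0 ?exprn_ilt1 // ltW.
have h1 := cvg_euler q01'; have h3 := cvg_euler q301.
have e0 : euler q != 0 by rewrite gt_eqF // euler_gt0.
have : (fun N => (\prod_(0 <= n < N) (1 - (q ^+ 3) ^+ n.+1)) /
    (\prod_(0 <= n < N) (1 - q ^+ n.+1)) ^+ 3) @ \oo --> P.
  apply: cvgM => //; apply: cvgV; first exact: expf_neq0.
  by apply: (cvgM h1 (cvgM h1 h1)).
move=> h; apply: (eq_cvgn h) => N.
rewrite -prodrXl -prodf_div; apply: eq_bigr => i _.
rewrite [(q ^+ 3) ^+ _]exprAC; have /andP[_] := qn i; move: (q ^+ i.+1) => y y1.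
by field; rewrite subr_eq0 gt_eqF.
Qed.

Let P_ge m : Pn m <= P.
Proof.
have h : nondecreasing_seq Pn.
  apply/nondecreasing_seqP => n; rewrite {2}/Pn big_nat_recr //= -/(Pn n).
  have /andP[y0 y1] := qn n; rewrite ler_peMr //.
    rewrite /Pn; apply: prodr_ge0 => i _.
    have /andP[z0 z1] := qn i.
    by rewrite divr_ge0 ?sqr_ge0 // !addr_ge0 ?sqr_ge0 // ltW.
  move: (q ^+ n.+1) y0 y1 => y y0 y1.
  by rewrite ler_pdivlMr ?exprn_gt0 ?subr_gt0 //; nra.
rewrite -(cvg_lim _ Pn_cvg) //; apply: nondecreasing_cvgn_le => //.
by apply/cvg_ex; exists P; exact: Pn_cvg.
Qed.

Let P_ge0 : 0 <= P.
Proof. by apply: le_trans (P_ge 0); rewrite /Pn big_geq. Qed.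

Let sqnU m : sqnormc (U m) = Pn m.
Proof.
rewrite sqnormc_prod; apply: eq_bigr => i _.
by rewrite Q1E -fmorphV sqnormcM sqn_real QX sqn_w2 exprVn.
Qed.

Let sqnV m : sqnormc (V m) = Pn m.
Proof.
rewrite sqnormc_prod; apply: eq_bigr => i _.
by rewrite Q1E -fmorphV sqnormcM sqn_real QX sqn_w exprVn.
Qed.

Let UV m : U m * V m = (Pn m)%:C.
Proof.
rewrite /U /V /Pn rmorph_prod -big_split /=; apply: eq_bigr => i _.
rewrite Q1E QX mulrACA [X in X * _]mulrC gE -invfM -rmorphM -fmorphV -rmorphM.
by rewrite expr2.
Qed.

Let qc k : (fun N => q ^+ (N + k)) @ \oo --> (0 : R).
Proof.
apply: cvg_addn; apply: cvg_expr; rewrite ger0_norm //; exact: ltW.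
Qed.

Let lin_cvg v k : cvgC (fun N => 1 - v * Q ^+ (N + k)) 1.
Proof.
have h : cvgC (fun N => 1 - v * Q ^+ (N + k)) (1 - v * 0%:C).
  apply: cvgCB; first exact: cvgC_cst.
  apply: cvgCM; first exact: cvgC_cst.
  by under eq_fun do rewrite QX; apply: cvgC_real; exact: qc.
by rewrite rmorph0 mulr0 subr0 in h.
Qed.

Let inv_cvg k : cvgC (fun N => (1 - Q ^+ (N + k.+1))^-1) 1.
Proof.
under eq_fun do rewrite Q1E -fmorphV.
rewrite -[X in cvgC _ X](rmorph1 (real_complex R)).
apply: cvgC_real; rewrite -[X in _ --> X]invr1.
apply: cvgV; first exact: oner_neq0.
rewrite -[X in _ --> X](subr0 1); apply: cvgB; first exact: cvg_cst.
exact: qc.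
Qed.

Let invv_cvg v v' k :
  (forall y, (1 - v * y%:C) * (1 - v' * y%:C) = (1 + y + y ^+ 2)%:C) ->
  cvgC (fun N => (1 - v * Q ^+ (N + k))^-1) 1.
Proof.
move=> gv; have e N : (1 - v * Q ^+ (N + k))^-1 =
    (1 - v' * Q ^+ (N + k)) * ((1 + q ^+ (N + k) + q ^+ (N + k) ^+ 2)^-1)%:C.
  have g := gv (q ^+ (N + k)).
  have p : 1 + q ^+ (N + k) + q ^+ (N + k) ^+ 2 != 0.
    have h : 0 <= q ^+ (N + k) by rewrite exprn_ge0 // ltW.
    by rewrite gt_eqF // -addrA ltr_wpDr // ?addr_ge0 // sqr_ge0.
  have c0 : (1 + q ^+ (N + k) + q ^+ (N + k) ^+ 2)%:C != 0 :> R[i].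
    by rewrite (fmorph_eq0 (real_complex R)).
  move: c0; rewrite -g -QX mulf_eq0 negb_or => /andP[a0 b0].
  by rewrite (fmorphV (real_complex R)) /= -g -QX invfM mulrCA mulfV // mulr1.
rewrite (funext e) -[X in cvgC _ X]mulr1.
apply: cvgCM; first exact: lin_cvg.
rewrite -[X in cvgC _ X](rmorph1 (real_complex R)).
apply: cvgC_real; rewrite -[X in _ --> X]invr1.
apply: cvgV; first exact: oner_neq0.
rewrite -[X in _ --> X]addr0 -[X in _ --> X + _]addr0 -[X in _ --> _ + X](mulr0 0).
apply: cvgD; first by apply: cvgD; [exact: cvg_cst|exact: qc].
by apply: cvgM; exact: qc.
Qed.

Let invw_cvg k : cvgC (fun N => (1 - w * Q ^+ (N + k))^-1) 1.
Proof. by apply: (@invv_cvg w (w ^+ 2)). Qed.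

Let invw2_cvg k : cvgC (fun N => (1 - w ^+ 2 * Q ^+ (N + k))^-1) 1.
Proof. by apply: (@invv_cvg (w ^+ 2) w) => y; rewrite mulrC. Qed.

Let UV_cvg k : cvgC (fun N => U (N + k) * V N) P%:C.
Proof.
elim: k => [|k IH].
  have e N : U (N + 0)%N * V N = (Pn N)%:C by rewrite addn0 UV.
  by rewrite (funext e); apply: cvgC_real Pn_cvg.
have e N : U (N + k.+1)%N * V N = U (N + k)%N * V N *
    ((1 - w ^+ 2 * Q ^+ (N + k.+1)) * (1 - Q ^+ (N + k.+1))^-1).
  by rewrite addnS {1}/U big_nat_recr //= -/(U _) mulrAC.
rewrite (funext e) -[X in cvgC _ X]mulr1 -[X in cvgC _ (_ * X)]mulr1.
by apply: cvgCM => //; apply: cvgCM; [exact: lin_cvg|exact: inv_cvg].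
Qed.

Let VU_cvg k : cvgC (fun N => U N * V (N + k)) P%:C.
Proof.
elim: k => [|k IH].
  have e N : U N * V (N + 0)%N = (Pn N)%:C by rewrite addn0 UV.
  by rewrite (funext e); apply: cvgC_real Pn_cvg.
have e N : U N * V (N + k.+1)%N = U N * V (N + k)%N *
    ((1 - w * Q ^+ (N + k.+1)) * (1 - Q ^+ (N + k.+1))^-1).
  by rewrite addnS {1}/V big_nat_recr //= -/(V _) mulrA.
rewrite (funext e) -[X in cvgC _ X]mulr1 -[X in cvgC _ (_ * X)]mulr1.
by apply: cvgCM => //; apply: cvgCM; [exact: lin_cvg|exact: inv_cvg].
Qed.

Let z1 N n := U (N + n) * V (N - n) / (1 - w * Q ^+ (N - n)).
Let z2 N n := U (N - n) * V (N + n) / (1 - w * Q ^+ (N + n)).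

Let z1_cvg n : cvgC (z1 ^~ n) P%:C.
Proof.
apply/(cvgC_shiftn n); rewrite /z1.
under eq_fun do rewrite addnK -addnA -[X in _ * Q ^+ X]addn0.
by rewrite -[X in cvgC _ X]mulr1; apply: cvgCM; [exact: UV_cvg|exact: invw_cvg].
Qed.

Let z2_cvg n : cvgC (z2 ^~ n) P%:C.
Proof.
apply/(cvgC_shiftn n); rewrite /z2.
under eq_fun do rewrite addnK -addnA.
by rewrite -[X in cvgC _ X]mulr1; apply: cvgCM; [exact: VU_cvg|exact: invw_cvg].
Qed.

Let inv_le1 n : sqnormc (1 - w * Q ^+ n)^-1 <= 1.
Proof.
have e : sqnormc (1 - w * Q ^+ n)^-1 * sqnormc (1 - w * Q ^+ n) = 1.
  rewrite -sqnormcM mulVf; first by rewrite /sqnormc /= expr1n expr0n addr0.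
  apply/eqP => h; have := sqn_w (q ^+ n); rewrite -QX h.
  rewrite /sqnormc /= expr0n addr0 => /eqP; rewrite eq_sym gt_eqF //.
  have y0 : 0 <= q ^+ n by rewrite exprn_ge0 // ltW.
  by rewrite -addrA ltr_wpDr // addr_ge0 // sqr_ge0.
have s0 : 0 <= sqnormc (1 - w * Q ^+ n)^-1 by rewrite addr_ge0 // sqr_ge0.
rewrite -[leRHS]e ler_peMr // QX sqn_w -addrA lerDl.
have y0 : 0 <= q ^+ n by rewrite exprn_ge0 // ltW.
by rewrite addr_ge0 // sqr_ge0.
Qed.

Let wX n k : sqnormc ((w ^+ k) ^+ n) = 1.
Proof.
have w1 : sqnormc w = 1.
  have s3 : Num.sqrt 3 ^+ 2 = 3 :> R by rewrite sqr_sqrtr.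
  rewrite /sqnormc /w /cube_root1 /=; move: s3; move: (Num.sqrt 3) => s s3.
  transitivity (1 / 4 + s ^+ 2 / 4); [by field|by rewrite s3; field].
rewrite -exprM; elim: (k * n)%N => [|m IH]; last by rewrite exprS sqnormcM w1 IH mulr1.
by rewrite expr0 /sqnormc /= expr1n expr0n addr0.
Qed.

Let bound (n k a b c : nat) :
  `|complex.Re ((w ^+ k) ^+ n * (U a * V b / (1 - w * Q ^+ c)))| <= P.
Proof.
apply: Re_le_sqnormc P_ge0 _; rewrite !sqnormcM wX mul1r sqnU sqnV.
have Pn0 m : 0 <= Pn m by rewrite -sqnU addr_ge0 // sqr_ge0.
have s0 : 0 <= sqnormc (1 - w * Q ^+ c)^-1 by rewrite addr_ge0 // sqr_ge0.
rewrite -[leRHS]mulr1 expr2; apply: ler_pM; rewrite ?mulr_ge0 ?inv_le1 //.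
by apply: ler_pM; rewrite ?P_ge.
Qed.

Let g (n : nat) : R := q ^+ n / (1 + q ^+ n + q ^+ n ^+ 2).

Let den_ge1 n : 1 <= 1 + q ^+ n + q ^+ n ^+ 2.
Proof.
have y0 : 0 <= q ^+ n by rewrite exprn_ge0 // ltW.
by rewrite -addrA lerDl addr_ge0 // sqr_ge0.
Qed.

Let g_bound n : 0 <= g n <= q ^+ n.
Proof.
have y0 : 0 <= q ^+ n by rewrite exprn_ge0 // ltW.
have d0 : 0 < 1 + q ^+ n + q ^+ n ^+ 2 by apply: lt_le_trans (den_ge1 n).
by rewrite /g divr_ge0 ?(ltW d0) //= ler_pdivrMr // ler_peMr.
Qed.

Let gC n : Q ^+ n / (1 + Q ^+ n + Q ^+ n ^+ 2) = (g n)%:C.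
Proof. by rewrite /g fmorph_div !rmorphD rmorph1 !rmorphXn. Qed.

Let eps (n : nat) : R := 2 * res3 R 0 n - res3 R 1 n - res3 R 2 n.

Let epsE n : complex.Re (w ^+ n) + complex.Re ((w ^+ 2) ^+ n) = eps n.
Proof.
have wm : w ^+ n = w ^+ (n %% 3).
  by rewrite [in LHS](divn_eq n 3) exprD mulnC exprM w31 expr1n mul1r.
rewrite -exprM mulnC exprM wm /eps /res3.
have s3 : (Num.sqrt 3 / 2) * (Num.sqrt 3 / 2) = 3 / 4 :> R.
  by rewrite mulrACA -expr2 sqr_sqrtr //; field.
have := ltn_pmod n (isT : 0 < 3)%N.
case: (n %% 3)%N => [|[|[|]]] //= _; move: s3; move: (Num.sqrt 3 / 2) => x s3.
- by ring.
- by rewrite s3; field.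
- transitivity (1 / 4 - x * x + ((1 / 4 - x * x) ^+ 2 - x * x)); first by field.
  by rewrite s3; field.
Qed.

Let fin N : (0 < N)%N ->
  complex.Re (z1 N 0) / 3 +
  \sum_(0 <= n < N) (complex.Re (w ^+ n.+1 * z1 N n.+1) * g n.+1 +
                     complex.Re ((w ^+ 2) ^+ n.+1 * z2 N n.+1) * g n.+1)
  = complex.Re (3^-1%:C * (1 - w ^+ 2 * Q ^+ N)^-1).
Proof.
move=> N0.
have ReZ (x : R[i]) (r : R) : complex.Re (x * r%:C) = complex.Re x * r.
  by rewrite ReM /= mulr0 subr0.
have sq0 (x : R[i]) (r : R) : sqnormc x = r -> 0 < r -> x != 0.
  move=> xr; apply: contraTneq => x0; rewrite -xr x0 /sqnormc /= expr0n addr0 ltxx.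
  by [].
have d0 n : 0 < 1 + q ^+ n + q ^+ n ^+ 2 by apply: lt_le_trans (den_ge1 n).
have c3 : 3^-1%:C = 3^-1 :> R[i] by rewrite (fmorphV (real_complex R)) rmorph_nat.
have F3 : (3 : R[i]) != 0 by rewrite pnatr_eq0.
have Q0 : Q != 0 by rewrite (fmorph_eq0 (real_complex R)) gt_eqF.
have Q1 j : 1 - Q ^+ j.+1 != 0.
  rewrite Q1E (fmorph_eq0 (real_complex R)) subr_eq0 gt_eqF //.
  by case/andP: (qn j).
have wq j : 1 - w * Q ^+ j != 0.
  by apply: sq0 (d0 j); rewrite QX sqn_w.
have w2q j : 1 - w ^+ 2 * Q ^+ j != 0.
  by apply: sq0 (d0 j); rewrite QX sqn_w2.
have := finite_cubic_b (cube_root1E R) F3 Q0 Q1 wq w2q N0.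
rewrite -/w invfM -c3 => <-; rewrite big_nat_recl //= raddfD raddfD /= -addrA.
congr (_ + _).
  by rewrite gC (ReZ (w ^+ 0 * _)) expr0 mul1r; congr (_ * _); rewrite /g expr0 expr1n; field.
rewrite big_split /=; congr (_ + _); rewrite raddf_sum; apply: eq_bigr => n _.
  by rewrite gC; apply: esym; exact: ReZ.
by rewrite gC; apply: esym; exact: ReZ.
Qed.

(** The limit of the real part of [finite_cubic_b] at w = exp (2 pi i / 3).
    Its summands tend to P times those of the Lambert series of b, so P b
    becomes 1; the moduli of the coefficients are at most P. *)
Lemma cubic_b_euler : cubic_b q = euler q ^+ 3 / euler (q ^+ 3).
Proof.
have q01' : 0 <= q < 1 by rewrite q1 ltW.
pose u N n := complex.Re (w ^+ n.+1 * z1 N n.+1) * g n.+1 +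
                     complex.Re ((w ^+ 2) ^+ n.+1 * z2 N n.+1) * g n.+1.
have ReP (y : R[i]) : complex.Re (y * P%:C) = complex.Re y * P.
  by rewrite ReM /= mulr0 subr0.
have [cs lims] : cvgn (series (fun n => P * (eps n.+1 * g n.+1))) /\
    (fun N => \sum_(0 <= n < N) u N n) @ \oo -->
      limn (series (fun n => P * (eps n.+1 * g n.+1))).
  apply: (@tannery _ u _ (fun n => (2 * P * q) * q ^+ n)).
  - move=> N n _ /=; apply: (le_trans (ler_normD _ _)).
    rewrite [leRHS](_ : _ = P * q ^+ n.+1 + P * q ^+ n.+1); last by rewrite exprS; ring.
    have /andP[g0 g1] := g_bound n.+1.
    apply: lerD; rewrite normrM (ger0_norm g0); apply: ler_pM => //.
      by have := bound n.+1 1 (N + n.+1) (N - n.+1) (N - n.+1).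
    by have := bound n.+1 2 (N - n.+1) (N + n.+1) (N + n.+1).
  - by apply: cvgn_geom.
  - move=> n; rewrite -epsE mulrA mulrDr mulrDl ![P * complex.Re _]mulrC -!ReP.
    apply: cvgD; apply: cvgM; try exact: cvg_cst.
      by have [] := cvgCM (cvgC_cst (w ^+ n.+1)) (z1_cvg n.+1).
    by have [] := cvgCM (cvgC_cst ((w ^+ 2) ^+ n.+1)) (z2_cvg n.+1).
have l0 : (fun N => complex.Re (z1 N 0) / 3) @ \oo --> P / 3.
  by apply: cvgM; [have [] := z1_cvg 0|exact: cvg_cst].
have lr : (fun N => complex.Re (3^-1%:C * (1 - w ^+ 2 * Q ^+ N)^-1)) @ \oo --> (3^-1 : R).
  have [+ _] := cvgCM (cvgC_cst 3^-1%:C) (invw2_cvg 0).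
  rewrite mulr1 /=; under eq_fun do rewrite addn0.
  by [].
have E : P / 3 + limn (series (fun n => P * (eps n.+1 * g n.+1))) = 3^-1.
  have h : (fun N => complex.Re (z1 N 0) / 3 + \sum_(0 <= n < N) u N n) @ \oo -->
    P / 3 + limn (series (fun n => P * (eps n.+1 * g n.+1))) by exact: cvgD.
  have hS := h; rewrite -cvg_shiftS in hS.
  have lS := lr; rewrite -cvg_shiftS in lS.
  rewrite -(cvg_lim _ hS) // -[RHS](cvg_lim _ lS) //.
  by congr (limn _); apply/funext => N /=; rewrite fin.
have L i j := @lambert3_rows R q i j q01'.
pose S := 2 * (lambert3 q 0 1 - lambert3 q 0 2)
    - (lambert3 q 1 1 - lambert3 q 1 2) - (lambert3 q 2 1 - lambert3 q 2 2).
have hL : (fun N => P * (2 *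
    (series (fun m => res3 R 0 m.+1 * geom3 1 (q ^+ m.+1)) N
      - series (fun m => res3 R 0 m.+1 * geom3 2 (q ^+ m.+1)) N)
    - (series (fun m => res3 R 1 m.+1 * geom3 1 (q ^+ m.+1)) N
      - series (fun m => res3 R 1 m.+1 * geom3 2 (q ^+ m.+1)) N)
    - (series (fun m => res3 R 2 m.+1 * geom3 1 (q ^+ m.+1)) N
      - series (fun m => res3 R 2 m.+1 * geom3 2 (q ^+ m.+1)) N))) @ \oo --> P * S.
  apply: cvgM; first exact: cvg_cst.
  apply: cvgB; last by apply: cvgB; apply: L.
  apply: cvgB; last by apply: cvgB; apply: L.
  by apply: cvgM; [exact: cvg_cst|apply: cvgB; apply: L].
have E2 : limn (series (fun n => P * (eps n.+1 * g n.+1))) = P * S.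
  apply: cvg_lim => //; apply: (eq_cvgn hL) => N.
  rewrite /series /= -!sumrB mulr_sumr -!sumrB mulr_sumr; apply: eq_bigr => n _.
  rewrite /eps /g /geom3; congr (_ * _).
  have y0 : 0 <= q ^+ n.+1 by rewrite exprn_ge0 // ltW.
  have y1 : q ^+ n.+1 < 1 by case/andP: (qn n).
  have := den_ge1 n.+1; move: (q ^+ n.+1) y0 y1 (res3 _ _ _) (res3 _ _ _) (res3 _ _ _).
  move=> y y0 y1 a b c d1.
  have y3 : y ^+ 3 < 1 by rewrite exprn_ilt1.
  have d0 : 1 + y + y ^+ 2 != 0 by rewrite gt_eqF // (lt_le_trans ltr01).
  by field; rewrite d0 subr_eq0 gt_eqF.
have Pb : P * cubic_b q = 1.
  rewrite cubic_bE // -/S; rewrite E2 in E.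
  by transitivity (3 * (P / 3 + P * S)); [field|rewrite E; field].
have -> : euler q ^+ 3 / euler (q ^+ 3) = P^-1 by rewrite /P invf_div.
apply: (mulfI (x := P)); last by rewrite Pb mulfV //; apply: contra_eq_neq Pb => ->; rewrite mul0r eq_sym oner_eq0.
by apply: contra_eq_neq Pb => ->; rewrite mul0r eq_sym oner_eq0.
Qed.
End CubicB.

(** * Power series on the unit interval *)

Definition cvg_unit (R : realType) (c : nat -> R) : Prop :=
  forall K : R, 0 <= K < 1 -> cvgn (pseries c K).

Definition psum (R : realType) (c : nat -> R) (x : R) : R := limn (pseries c x).

Lemma natmul_geom_le (R : realType) (s : R) (k : nat) : 0 <= s < 1 ->
  k.+1%:R * s ^+ k <= (1 - s)^-1.
Proof.
move=> /andP[s0 s1]; rewrite -[leRHS]mul1r ler_pdivlMr ?subr_gt0 //.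
suff : k.+1%:R * s ^+ k * (1 - s) <= 1 - s ^+ k.+1.
  by move=> h; apply: le_trans h _; rewrite gerBl exprn_ge0.
elim: k => [|k IH]; first by rewrite expr0 mulr1 mul1r expr1.
have h1 : 0 <= s ^+ k by rewrite exprn_ge0.
have h2 : s ^+ k.+1 <= 1 by rewrite exprn_ile1 // ltW.
move: IH h1 h2; rewrite !exprS -(natr1 k.+1); move: (s ^+ k) k.+1%:R => z m; nra.
Qed.

(** Differentiation preserves the disc of convergence: between K and a larger
    K1' below 1, the factor n + 1 is absorbed by (K / K1')^n. *)
Lemma cvg_unit_diffs (R : realType) (c : nat -> R) :
  cvg_unit c -> cvg_unit (pseries_diffs c).
Proof.
move=> cc K /andP[K0 K1].
pose K1' := (K + 1) / 2; pose K2 := (K1' + 1) / 2.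
have KK1 : K < K1' by rewrite /K1'; lra.
have K1K2 : K1' < K2 by rewrite /K2 /K1'; lra.
have K21 : K2 < 1 by rewrite /K2 /K1'; lra.
have K10 : 0 < K1' by rewrite /K1'; lra.
have cn : cvgn (pseries (fun i => `|c i|) K1').
  apply: (@is_cvg_pseries_inside_norm _ _ K2).
    by apply: cc; rewrite K21 andbT; lra.
  by rewrite !ger0_norm //; lra.
have cn1 : cvgn (series (fun i => `|c i.+1| * K1' ^+ i.+1)).
  have h : cvgn (fun N => pseries (fun i => `|c i|) K1' N.+1 - `|c 0%N|).
    apply: is_cvgB; last exact: is_cvg_cst.
    apply/cvg_ex; exists (limn (pseries (fun i => `|c i|) K1')).
    by rewrite (cvg_shiftS (pseries (fun i => `|c i|) K1')).
  rewrite (_ : series _ = (fun N => pseries (fun i => `|c i|) K1' N.+1 - `|c 0%N|)) //.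
  apply/funext => N; rewrite [RHS]addrC.
  by rewrite /pseries /series /= big_nat_recl //= expr0 mulr1 addKr.
have M0 : 0 <= (1 - K / K1')^-1 / K1'.
  by rewrite divr_ge0 ?(ltW K10) // invr_ge0 subr_ge0 ler_pdivrMr // mul1r ltW.
apply: normed_cvg.
apply: (@series_le_cvg _ _ (fun i => ((1 - K / K1')^-1 / K1') * (`|c i.+1| * K1' ^+ i.+1))).
- by move=> n /=.
- by move=> n; rewrite mulr_ge0 // mulr_ge0 // exprn_ge0 // ltW.
- move=> n /=; rewrite /pseries_diffs !normrM normr_nat.
  rewrite [`|K ^+ n|]ger0_norm ?exprn_ge0 //.
  have s01 : 0 <= K / K1' < 1.
    by rewrite divr_ge0 ?(ltW K10) //= ltr_pdivrMr // mul1r.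
  have h := natmul_geom_le n s01.
  have -> : K ^+ n = (K / K1') ^+ n * K1' ^+ n.
    by rewrite -exprMn divfK // gt_eqF.
  rewrite [leLHS](_ : _ = n.+1%:R * (K / K1') ^+ n * (`|c n.+1| * K1' ^+ n)); last by ring.
  rewrite [leRHS](_ : _ = (1 - K / K1')^-1 * (`|c n.+1| * K1' ^+ n)).
    by rewrite ler_wpM2r // mulr_ge0 // exprn_ge0 // ltW.
  by rewrite exprS; field; rewrite subr_eq0 !gt_eqF.
- exact: is_cvg_seriesZ.
Qed.

Lemma is_derive_psum (R : realType) (c : nat -> R) (x : R) :
  cvg_unit c -> -1 < x < 1 ->
  is_derive x (1 : R) (psum c) (psum (pseries_diffs c) x).
Proof.
move=> cc /andP[x1 x2].
have nx : `|x| < 1 by rewrite ltr_norml x1.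
have nx0 : 0 <= `|x| by [].
pose K := (`|x| + 1) / 2.
have K01 : 0 <= K < 1 by rewrite /K; lra.
apply: (@pseries_snd_diffs _ c K).
- exact: cc.
- exact: (cvg_unit_diffs cc).
- exact: (cvg_unit_diffs (cvg_unit_diffs cc)).
- by rewrite [`|K|]ger0_norm; [rewrite /K; lra|case/andP: K01].
Qed.

Lemma continuous_psum (R : realType) (c : nat -> R) (x : R) :
  cvg_unit c -> -1 < x < 1 -> {for x, continuous (psum c)}.
Proof.
move=> cc x1; have [d _] := is_derive_psum cc x1.
by apply: differentiable_continuous; apply/derivable1_diffP.
Qed.

Lemma psum0 (R : realType) (c : nat -> R) : psum c 0 = c 0%N.
Proof.
apply: cvg_lim => //; rewrite -(cvg_shiftS (pseries c 0)).
rewrite (_ : (fun _ => _) = fun=> c 0%N); first exact: cvg_cst.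
apply/funext => N; rewrite /pseries /series /= big_nat_recl //= expr0 mulr1.
by rewrite big1 ?addr0 // => i _; rewrite expr0n mulr0.
Qed.

(** * The cubic identity *)

(** A function that reproduces itself along q -> q^3 up to a bounded factor
    and is O(q) vanishes: halving the implied constant on a fixed
    neighbourhood of 0 can be repeated for ever. *)
Lemma cubic_iteration_eq0 (R : realType) (H m : R -> R) (L l : R) :
  (forall q, 0 < q < 1 -> H q = m q * H (q ^+ 3)) ->
  H q / q @[q --> 0^'+] --> L -> m q @[q --> 0^'+] --> l ->
  forall q, 0 < q < 1 -> H q = 0.
Proof.
move=> HE HL ml.
have [M [M0 HM]] : exists M, 0 < M /\ \forall q \near 0^'+, `|m q| <= M.
  exists (`|l| + 1); split; first by rewrite ltr_pwDr.
  move/cvgrPdist_lt: ml => /(_ 1 ltr01); apply: filterS => q h.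
  rewrite -lerBlDl; apply: le_trans (lerB_dist _ _) _.
  by rewrite distrC ltW.
have [K [K0 HK]] : exists K, 0 < K /\ \forall q \near 0^'+, `|H q / q| <= K.
  exists (`|L| + 1); split; first by rewrite ltr_pwDr.
  move/cvgrPdist_lt: HL => /(_ 1 ltr01); apply: filterS => q h.
  rewrite -lerBlDl; apply: le_trans (lerB_dist _ _) _.
  by rewrite distrC ltW.
have [d [d0 d1 hM hK Md]] : exists d, [/\ 0 < d, d < 1,
    forall q, 0 < q < d -> `|m q| <= M,
    forall q, 0 < q < d -> `|H q| <= K * q & M * d ^+ 2 <= 1 / 2].
  have : \forall d \near 0^'+, M * d ^+ 2 <= 1 / 2.
    have h : M * (d * d) @[d --> (0 : R)^'+] --> M * (0 * 0).
      apply: cvgM; first exact: cvg_cst.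
      by apply: cvgM; apply: cvg_at_right_filter; exact: cvg_id.
    have e2 : (0 : R) < 1 / 2 by rewrite divr_gt0.
    rewrite !mulr0 in h.
    move/cvgrPdist_lt: h => /(_ _ e2); apply: filterS => y.
    rewrite sub0r normrN expr2 => h1.
    by apply: ltW; apply: le_lt_trans h1; exact: ler_norm.
  move=> [e3 /= e30 h3]; have [e1 /= e10 h1] := HM; have [e2 /= e20 h2] := HK.
  pose d := Num.min (Num.min e1 e2) (Num.min e3 1) / 2.
  have d0 : 0 < d by rewrite divr_gt0 // !lt_min e10 e20 e30 ltr01.
  have dm : d < Num.min (Num.min e1 e2) (Num.min e3 1).
    by rewrite /d ltr_pdivrMr // ltr_pMr ?ltr1n // !lt_min e10 e20 e30 ltr01.
  move: dm; rewrite !lt_min => /andP[/andP[de1 de2] /andP[de3 dlt1]].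
  have nd q e : 0 < q < d -> d < e -> `|0 - q| < e.
    by move=> /andP[q0 qd] de; rewrite sub0r normrN gtr0_norm // (lt_trans qd).
  exists d; split => //.
  - by move=> q qd; apply: h1; [exact: nd de1|case/andP: qd].
  - move=> q qd; have /andP[q0 _] := qd.
    have := h2 q (nd q e2 qd de2) q0.
    by rewrite normrM normfV (gtr0_norm q0) ler_pdivrMr.
  - by apply: h3 => //; rewrite /= sub0r normrN gtr0_norm.
have small k : forall q, 0 < q < d -> `|H q| <= K / 2 ^+ k * q.
  elim: k => [|k IH] q qd; first by rewrite expr0 divr1; exact: hK.
  have /andP[q0 qltd] := qd.
  have q1 : q < 1 by apply: lt_trans d1.
  rewrite HE ?q0 // normrM.
  have q3 : 0 < q ^+ 3 < d.
    rewrite exprn_gt0 //=; apply: le_lt_trans qltd.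
    by rewrite exprS ler_piMr ?(ltW q0) // exprn_ile1 // ltW.
  have h1 := hM q qd; have h2 := IH _ q3.
  have Kk : 0 <= K / 2 ^+ k by rewrite divr_ge0 ?exprn_ge0 // ltW.
  apply: (@le_trans _ _ (M * (K / 2 ^+ k * q ^+ 3))); first exact: ler_pM.
  have -> : K / 2 ^+ k.+1 * q = (K / 2 ^+ k * q) * (1 / 2).
    by rewrite exprS; field; rewrite expf_neq0.
  have -> : M * (K / 2 ^+ k * q ^+ 3) = (K / 2 ^+ k * q) * (M * q ^+ 2) by ring.
  apply: ler_wpM2l; first by rewrite mulr_ge0 // ltW.
  apply: le_trans Md; apply: ler_wpM2l; first exact: ltW.
  by rewrite lerXn2r // ?nnegrE ltW.
have zero q : 0 < q < d -> H q = 0.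
  move=> qd; have /andP[q0 _] := qd.
  apply/eqP; rewrite -normr_le0; apply/ler_addgt0Pl => e e0; rewrite addr0.
  have c : (fun k => K * q * (1 / 2) ^+ k) @ \oo --> (K * q * 0 : R).
    apply: cvgM; first exact: cvg_cst.
    by apply: cvg_expr; rewrite ger0_norm; lra.
  rewrite mulr0 in c.
  have [k _ hk] := (cvgrPdist_lt _ _).1 c e e0.
  have := hk k (leqnn k); rewrite sub0r normrN => /ltW h.
  apply: le_trans (small k q qd) _; apply: le_trans h.
  apply: le_trans (ler_norm _).
  by rewrite expr_div_n expr1n mul1r mulrAC.
have down k : forall q, 0 < q < 1 -> q ^+ (3 ^ k) < d -> H q = 0.
  elim: k => [|k IH] q q01 qk; have /andP[q0 q1] := q01.
    by apply: zero; rewrite q0 -[q]expr1.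
  rewrite HE // IH ?mulr0 //; last by rewrite -exprM -expnS.
  by rewrite exprn_gt0 // exprn_ilt1 // ltW.
move=> q q01; have /andP[q0 q1] := q01.
have c : (fun k => q ^+ k) @ \oo --> (0 : R).
  by apply: cvg_expr; rewrite gtr0_norm.
have [k _ hk] := (cvgrPdist_lt _ _).1 c d d0.
apply: (down k) => //.
have := hk (3 ^ k)%N; rewrite /= sub0r normrN gtr0_norm ?exprn_gt0 //; apply.
by apply: ltnW; apply: ltn_expl.
Qed.

Lemma cvg_unit_shift (R : realType) (c : nat -> R) :
  cvg_unit c -> cvg_unit (fun n => c n.+1).
Proof.
move=> cc K /andP[K0 K1].
pose K' := (K + 1) / 2.
have K'0 : 0 < K' by rewrite /K'; lra.
have K'1 : K' < 1 by rewrite /K'; lra.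
apply: (@is_cvg_pseries_inside _ _ K'); last first.
  by rewrite !ger0_norm ?(ltW K'0) //; rewrite /K'; lra.
have h : pseries c K' @ \oo --> psum c K' by apply: cc; rewrite K'1 ltW.
rewrite -cvg_shiftS in h.
apply/cvg_ex; exists ((psum c K' - c 0%N) / K').
have h2 : (fun N => (pseries c K' N.+1 - c 0%N) / K') @ \oo --> (psum c K' - c 0%N) / K'.
  by apply: cvgM; [apply: cvgB => //; exact: cvg_cst|exact: cvg_cst].
apply: (eq_cvgn h2) => N.
rewrite /pseries /series /= big_nat_recl //= expr0 mulr1 addrC addKr mulr_suml.
by apply: eq_bigr => i _; rewrite exprS; field; rewrite gt_eqF.
Qed.

Lemma psum_shift (R : realType) (c : nat -> R) (x : R) : cvg_unit c -> 0 <= x < 1 ->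
  psum c x = c 0%N + x * psum (fun n => c n.+1) x.
Proof.
move=> cc x01; have h := cvg_unit_shift cc x01.
have h2 : (fun N => c 0%N + x * pseries (fun n => c n.+1) x N) @ \oo -->
    c 0%N + x * psum (fun n => c n.+1) x.
  by apply: cvgD; [exact: cvg_cst|apply: cvgM => //; exact: cvg_cst].
apply: cvg_lim => //.
rewrite -(cvg_shiftS (pseries c x)); apply: (eq_cvgn h2) => N.
rewrite /pseries /series /= big_nat_recl //= expr0 mulr1 mulr_sumr; congr (_ + _).
by apply: eq_bigr => i _; rewrite exprS; ring.
Qed.

Lemma cvg_at0_id (R : realType) : (q : R) @[q --> 0^'+] --> (0 : R).
Proof. by apply: cvg_at_right_filter; exact: cvg_id. Qed.

Lemma cvg_at0X (R : realType) (n : nat) : (q : R) ^+ n.+1 @[q --> 0^'+] --> (0 : R).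
Proof.
elim: n => [|n IH]; first exact: cvg_at0_id.
have h : q * q ^+ n.+1 @[q --> (0 : R)^'+] --> (0 * 0 : R).
  by apply: cvgM => //; exact: cvg_at0_id.
by rewrite mulr0 in h; under eq_fun do rewrite exprS.
Qed.

Lemma cvg_at0_psum (R : realType) (c : nat -> R) : cvg_unit c ->
  psum c q @[q --> 0^'+] --> c 0%N.
Proof.
move=> cc; rewrite -psum0; apply: cvg_at_right_filter.
by apply: (continuous_psum cc); rewrite ltr01 oppr_lt0 ltr01.
Qed.

Lemma cvg_at0_psumX (R : realType) (c : nat -> R) (n : nat) : cvg_unit c ->
  psum c (q ^+ n.+1) @[q --> 0^'+] --> c 0%N.
Proof.
move=> cc; rewrite -psum0.
apply: (cvg_comp (fun q : R => q ^+ n.+1) (psum c)); first exact: cvg_at0X.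
by apply: (continuous_psum cc); rewrite ltr01 oppr_lt0 ltr01.
Qed.

Lemma near01 (R : realType) (P : R -> Prop) :
  (forall q, 0 < q < 1 -> P q) -> \forall q \near (0 : R)^'+, P q.
Proof.
move=> h; exists 1 => //= q /=; rewrite /ball /= sub0r normrN => q1 q0.
by apply: h; rewrite q0 /=; apply: le_lt_trans q1; exact: ler_norm.
Qed.

Lemma eq_cvg_at0 (R : realType) (f g : R -> R) (l : R) :
  g q @[q --> 0^'+] --> l -> (forall q, 0 < q < 1 -> f q = g q) ->
  f q @[q --> 0^'+] --> l.
Proof.
move=> h e; apply: cvg_trans h; apply: near_eq_cvg.
by apply: near01 => q q01; rewrite e.
Qed.

Lemma cvg_unit_acoef (R : realType) : cvg_unit (@acoef R).
Proof. by move=> K K01; case: (cvg_pseries_acoef K01). Qed.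

Lemma acoef0 (R : realType) : @acoef R 0 = 1.
Proof. by rewrite /acoef /dcoef big_geq // mulr0 addr0. Qed.

Lemma acoef1 (R : realType) : @acoef R 1 = 6.
Proof. by rewrite /acoef /dcoef !big_nat1 /= /res3 /=; ring. Qed.

Section CubicIdentity.
Variable R : realType.

Local Notation a := (@cubic_a R).
Local Notation b := (@cubic_b R).
Local Notation C := (@cubic_C R).

Lemma expr01 (q : R) (n : nat) : 0 < q < 1 -> 0 < q ^+ n.+1 < 1.
Proof. by move=> /andP[q0 q1]; rewrite exprn_gt0 //= exprn_ilt1 // ltW. Qed.

Lemma cubic_C_gt0 (q : R) : 0 < q < 1 -> 0 < C q.
Proof.
move=> q01; rewrite cubic_C_euler //.
have e n : 0 < euler (q ^+ n.+1).
  by apply: euler_gt0; have /andP[/ltW -> ->] := expr01 n q01.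
have /andP[q0 _] := q01.
by rewrite divr_gt0 // mulr_gt0 ?exprn_gt0 // mulr_gt0.
Qed.

Lemma cubic_b_gt0 (q : R) : 0 < q < 1 -> 0 < b q.
Proof.
move=> q01; rewrite cubic_b_euler //.
have e n : 0 < euler (q ^+ n.+1).
  by apply: euler_gt0; have /andP[/ltW -> ->] := expr01 n q01.
by rewrite divr_gt0 // exprn_gt0 //; have := e 0%N; rewrite expr1.
Qed.

Lemma cubic_a3_gt0 (q : R) : 0 < q < 1 -> 0 < a (q ^+ 3).
Proof.
move=> q01; have h1 := cubic_C_gt0 q01; have h2 := cubic_b_gt0 q01.
have -> : a (q ^+ 3) = b q + C q by rewrite /cubic_b /cubic_C; field.
exact: addr_gt0.
Qed.

Lemma cubic_a_gt0 (q : R) : 0 < q < 1 -> 0 < a q.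
Proof.
move=> q01; have h1 := cubic_C_gt0 q01; have h2 := cubic_a3_gt0 q01.
have -> : a q = a (q ^+ 3) + 2 * C q by rewrite /cubic_C; field.
by rewrite addr_gt0 // mulr_gt0.
Qed.

(** In terms of Euler products both sides are 27 q^3 E(q^9)^9 / E(q^3)^3. *)
Lemma cubic_C_cube (q : R) : 0 < q < 1 ->
  9 * C (q ^+ 3) * b (q ^+ 9) ^+ 3 / b (q ^+ 3) = C q ^+ 3.
Proof.
move=> q01.
have e n : 0 < euler (q ^+ n.+1).
  by apply: euler_gt0; have /andP[/ltW -> ->] := expr01 n q01.
rewrite !cubic_C_euler ?cubic_b_euler ?expr01 // -!exprM.
have := e 2%N; have := e 8%N; have := e 26%N; have /andP[q0 _] := q01.
move: (euler _) (euler _) (euler _) => x y z x0 y0 z0.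
rewrite invfM invrK !exprMn !exprVn.
have x30 : x ^+ 3 != 0 by rewrite expf_neq0 // gt_eqF.
have z30 : z ^+ 3 != 0 by rewrite expf_neq0 // gt_eqF.
move: (q ^+ 3) (y ^+ 3 ^+ 3) (x ^+ 3) (z ^+ 3) x30 z30 => k l m n m0 n0.
by field; rewrite m0 n0 gt_eqF.
Qed.

Lemma cvg_at0_C : C q / q @[q --> 0^'+] --> (3 : R).
Proof.
have cc := @cvg_unit_acoef R; have cs := cvg_unit_shift cc.
have h : (psum (fun n => @acoef R n.+1) q - q ^+ 2 * psum (fun n => @acoef R n.+1) (q ^+ 3)) / 2
    @[q --> 0^'+] --> ((acoef R 1 - 0 * acoef R 1) / 2 : R).
  apply: cvgM; last exact: cvg_cst.
  apply: cvgB; first exact: cvg_at0_psum.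
  by apply: cvgM; [exact: cvg_at0X|exact: cvg_at0_psumX].
rewrite acoef1 mul0r subr0 in h.
rewrite (_ : (3 : R) = 6 / 2); last by field.
apply: (eq_cvg_at0 h) => q q01; have /andP[q0 q1] := q01.
rewrite /cubic_C /cubic_a -/(psum _ _) -/(psum _ _) !(psum_shift cc) //.
  by rewrite acoef0; field; rewrite gt_eqF.
- by have /andP[/ltW -> ->] := expr01 2 q01.
- by rewrite ltW.
Qed.

Lemma cvg_at0_a : a q @[q --> 0^'+] --> (1 : R).
Proof. by rewrite -(acoef0 R); apply: cvg_at0_psum; exact: cvg_unit_acoef. Qed.

Lemma cvg_at0_aX n : a (q ^+ n.+1) @[q --> 0^'+] --> (1 : R).
Proof. by rewrite -(acoef0 R); apply: cvg_at0_psumX; exact: cvg_unit_acoef. Qed.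

Lemma cvg_at0_b : b q @[q --> 0^'+] --> (1 : R).
Proof.
have h : (3 * a (q ^+ 3) - a q) / 2 @[q --> 0^'+] --> ((3 * 1 - 1) / 2 : R).
  apply: cvgM; last exact: cvg_cst.
  apply: cvgB; last exact: cvg_at0_a.
  by apply: cvgM; [exact: cvg_cst|exact: cvg_at0_aX].
by rewrite (_ : (1 : R) = (3 * 1 - 1) / 2) //; field.
Qed.

Lemma cvg_at0_b3 : b (q ^+ 3) @[q --> 0^'+] --> (1 : R).
Proof.
have h : (3 * a (q ^+ 9) - a (q ^+ 3)) / 2 @[q --> 0^'+] --> ((3 * 1 - 1) / 2 : R).
  apply: cvgM; last exact: cvg_cst.
  apply: cvgB; last exact: cvg_at0_aX.
  by apply: cvgM; [exact: cvg_cst|exact: cvg_at0_aX].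
rewrite (_ : (1 : R) = (3 * 1 - 1) / 2); last by field.
by apply: (eq_cvg_at0 h) => q _; rewrite /cubic_b -exprM.
Qed.

(** The Borweins' cubic analogue of Jacobi's identity.  By [cubic_C_cube] the
    product for c(q)^3 is gam, and the defect G = a^3 - b^3 - gam satisfies
    G(q) = 9 (C(q) / b(q)) G(q^3). *)
Lemma cubic_identity (q : R) : 0 < q < 1 ->
  a (q ^+ 3) ^+ 3 = b (q ^+ 3) ^+ 3 + C q ^+ 3.
Proof.
move=> q01.
pose gam q := 9 * C q * b (q ^+ 3) ^+ 3 / b q.
pose G q := a q ^+ 3 - b q ^+ 3 - gam q.
suff h : G (q ^+ 3) = 0.
  move: h; rewrite /G /gam -exprM cubic_C_cube // => /eqP.
  by rewrite subr_eq0 subr_eq addrC => /eqP.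
apply: (@cubic_iteration_eq0 R G (fun q => 9 * C q / b q)
  (3 * 3 * (1 * 1 + 1 * 1 + 1 * 1) - 9 * 3 * (1 * (1 * 1)) / 1) (9 * 3 * 0 / 1));
  last exact: expr01.
- move=> {}q {}q01.
  rewrite /G /gam -exprM (cubic_C_cube q01).
  have -> : a q = a (q ^+ 3) + 2 * C q by rewrite /cubic_C; field.
  have b0 := cubic_b_gt0 q01.
  have Ea : a (q ^+ 3) = b q + C q by rewrite /cubic_b /cubic_C; field.
  rewrite Ea; move: (b q) (C q) (b (q ^+ 3)) b0 => x y z x0.
  by field; rewrite gt_eqF.
- have hCq := cvg_at0_C; have ha := cvg_at0_a; have hb := cvg_at0_b.
  have hb3 := cvg_at0_b3.
  have h : 3 * (C q / q) * (a q * a q + a q * b q + b q * b q)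
      - 9 * (C q / q) * (b (q ^+ 3) * (b (q ^+ 3) * b (q ^+ 3))) / b q
      @[q --> 0^'+] --> (3 * 3 * (1 * 1 + 1 * 1 + 1 * 1) - 9 * 3 * (1 * (1 * 1)) / 1 : R).
    apply: cvgB.
      apply: cvgM; first by apply: cvgM => //; exact: cvg_cst.
      by apply: cvgD; [apply: cvgD; apply: cvgM|apply: cvgM].
    apply: cvgM; last by apply: cvgV => //; exact: oner_neq0.
    by apply: cvgM; [apply: cvgM => //; exact: cvg_cst|apply: cvgM => //; apply: cvgM].
  apply: (eq_cvg_at0 h) => r r01; have /andP[r0 _] := r01.
  rewrite /G /gam; have b0 := cubic_b_gt0 r01.
  have -> : a r = b r + 3 * C r by rewrite /cubic_b /cubic_C; field.
  move: (b r) (C r) (b (r ^+ 3)) b0 => x y z x0.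
  by field; rewrite !gt_eqF.
- have hCq := cvg_at0_C; have hb := cvg_at0_b.
  have h : 9 * (C q / q) * q / b q @[q --> 0^'+] --> (9 * 3 * 0 / 1 : R).
    apply: cvgM; last by apply: cvgV => //; exact: oner_neq0.
    apply: cvgM; last exact: cvg_at0_id.
    by apply: cvgM => //; exact: cvg_cst.
  apply: (eq_cvg_at0 h) => r r01; have /andP[r0 _] := r01.
  by rewrite mulrA mulfVK // gt_eqF.
Qed.

(** The modulus x = 1 - b^3 / a^3 of the cubic theory, written as a function
    of s; by the cubic identity it is also c^3 / a^3, so that
    x(q^3) = s(q)^3. *)
Definition cubic_s (q : R) : R := C q / a (q ^+ 3).
Definition cubic_x (q : R) : R := 1 - ((1 - cubic_s q) / (1 + 2 * cubic_s q)) ^+ 3.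

Lemma cubic_s_itv (q : R) : 0 < q < 1 -> 0 < cubic_s q < 1.
Proof.
move=> q01; have h1 := cubic_C_gt0 q01; have h2 := cubic_b_gt0 q01.
have h3 := cubic_a3_gt0 q01.
rewrite /cubic_s divr_gt0 //= ltr_pdivrMr // mul1r.
by rewrite (_ : a (q ^+ 3) = b q + C q) ?ltrDr // /cubic_b /cubic_C; field.
Qed.

Lemma cubic_bs (q : R) : 0 < q < 1 ->
  a q = a (q ^+ 3) * (1 + 2 * cubic_s q) /\ b q = a (q ^+ 3) * (1 - cubic_s q).
Proof.
move=> q01; have h3 := cubic_a3_gt0 q01.
by rewrite /cubic_s /cubic_C /cubic_b; split; field; rewrite gt_eqF.
Qed.

Lemma cubic_x_b (q : R) : 0 < q < 1 -> cubic_x q = 1 - (b q / a q) ^+ 3.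
Proof.
move=> q01; have h3 := cubic_a3_gt0 q01; have /andP[s0 s1] := cubic_s_itv q01.
have [-> ->] := cubic_bs q01; rewrite /cubic_x; congr (1 - _ ^+ _).
have s2 : 1 + 2 * cubic_s q != 0 by rewrite gt_eqF // addr_gt0 // mulr_gt0.
by field; rewrite s2 gt_eqF.
Qed.

Lemma cubic_x3 (q : R) : 0 < q < 1 -> cubic_x (q ^+ 3) = cubic_s q ^+ 3.
Proof.
move=> q01; rewrite cubic_x_b ?expr01 // /cubic_s (expr_div_n (b _)) (expr_div_n (C q)).
have h3 := cubic_a3_gt0 q01; have := cubic_identity q01.
have : a (q ^+ 3) ^+ 3 != 0 by rewrite expf_neq0 // gt_eqF.
move: (a _ ^+ 3) (b _ ^+ 3) (C q ^+ 3) => x y z x0 e.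
by rewrite e in x0 *; field.
Qed.
End CubicIdentity.

(** * The differential equations *)

(** [hasD f q d] says that the operator D = q d/dq maps f to d at q. *)
Definition hasD (R : realType) (f : R -> R) (q d : R) : Prop :=
  is_derive q (1 : R) f (d / q).

Section HasD.
Variable R : realType.
Implicit Types (f g : R -> R) (q d e : R).

Lemma hasD_eq f q d e : hasD f q d -> d = e -> hasD f q e.
Proof. by move=> h <-. Qed.

Lemma hasD_unique f q d e : q != 0 -> hasD f q d -> hasD f q e -> d = e.
Proof.
move=> q0 [_ h1] [_ h2]; rewrite h1 in h2.
by rewrite -[d](divfK q0) h2 divfK.
Qed.

Lemma hasD_cst k q : hasD (fun=> k) q 0.
Proof. by rewrite /hasD mul0r; exact: is_derive_cst. Qed.

Lemma hasD_id q : q != 0 -> hasD id q q.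
Proof. by move=> q0; rewrite /hasD divff //; exact: is_derive_id. Qed.

Lemma hasDD f g q d e : hasD f q d -> hasD g q e -> hasD (fun x => f x + g x) q (d + e).
Proof. by move=> h1 h2; rewrite /hasD mulrDl; exact: is_deriveD. Qed.

Lemma hasDB f g q d e : hasD f q d -> hasD g q e -> hasD (fun x => f x - g x) q (d - e).
Proof. by move=> h1 h2; rewrite /hasD mulrBl; exact: is_deriveB. Qed.

Lemma hasDM f g q d e : hasD f q d -> hasD g q e ->
  hasD (fun x => f x * g x) q (d * g q + f q * e).
Proof.
move=> h1 h2; apply: (is_derive_eq (is_deriveM h1 h2)).
by rewrite /GRing.scale /=; ring.
Qed.

Lemma hasDZ f q d k : hasD f q d -> hasD (fun x => k * f x) q (k * d).
Proof.
move=> h; apply: hasD_eq (hasDM (hasD_cst k q) h) _.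
by rewrite mul0r add0r.
Qed.

Lemma hasDX f q d n : hasD f q d -> hasD (fun x => f x ^+ n) q (n%:R * f q ^+ n.-1 * d).
Proof.
move=> h; have -> : (fun x => f x ^+ n) = f ^+ n by rewrite exprfctE.
apply: (is_derive_eq (is_deriveX n h)).
by rewrite /GRing.scale /= mulrA.
Qed.

Lemma hasDV f q d : f q != 0 -> hasD f q d -> hasD (fun x => (f x)^-1) q (- d / f q ^+ 2).
Proof.
move=> f0 h; apply: is_derive_eq; first exact: (is_deriveV f0 h).
by rewrite /GRing.scale /=; ring.
Qed.

Lemma hasD_div f g q d e : g q != 0 -> hasD f q d -> hasD g q e ->
  hasD (fun x => f x / g x) q ((d * g q - f q * e) / g q ^+ 2).
Proof.
move=> g0 h1 h2; apply: hasD_eq (hasDM h1 (hasDV g0 h2)) _.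
by field.
Qed.

Lemma hasD_comp f g q d e : is_derive (g q) (1 : R) f d -> hasD g q e ->
  hasD (fun x => f (g x)) q (d * e).
Proof.
move=> h1 h2; apply: is_derive_eq; first exact: (is_derive1_comp h1 h2).
by rewrite mulrA.
Qed.

Lemma hasD_cube f q d : q != 0 -> hasD f (q ^+ 3) d ->
  hasD (fun x => f (x ^+ 3)) q (3 * d).
Proof.
move=> q0 h; have hX : hasD (fun x : R => x ^+ 3) q (3%:R * q ^+ 2 * q).
  exact: (hasDX 3 (hasD_id q0)).
apply: (hasD_eq (@hasD_comp f (fun x => x ^+ 3) q _ _ h hX)).
by field.
Qed.

Lemma hasD_near f g q d : 0 < q < 1 -> (forall x, 0 < x < 1 -> f x = g x) ->
  hasD f q d -> hasD g q d.
Proof.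
move=> q01 fg; apply: near_eq_is_derive.
have /near_in_itvoo : q \in `]0, 1[ by rewrite in_itv.
by apply: filterS => x; rewrite in_itv /=; exact: fg.
Qed.

Lemma hasD_psum c q : cvg_unit c -> 0 < q < 1 ->
  hasD (psum c) q (q * psum (pseries_diffs c) q).
Proof.
move=> cc /andP[q0 q1]; rewrite /hasD mulrAC divff ?gt_eqF // mul1r.
apply: is_derive_psum => //; rewrite q1 andbT.
by apply: lt_trans q0; rewrite oppr_lt0.
Qed.

Lemma hasD0_lim f l : (forall q, 0 < q < 1 -> hasD f q 0) ->
  f q @[q --> 0^'+] --> l -> forall q, 0 < q < 1 -> f q = l.
Proof.
move=> f0 fl q /andP[q0 q1].
have cst x : 0 < x < q -> f x = f q.
  move=> /andP[x0 xq].
  have der y : y \in `]x, q[ -> is_derive y (1 : R) f 0.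
    rewrite in_itv /= => /andP[xy yq].
    have := f0 y; rewrite /hasD mul0r; apply.
    by rewrite (lt_trans x0 xy) (lt_trans yq q1).
  have cont : {within `[x, q], continuous f}.
    apply: derivable_within_continuous => y; rewrite in_itv /= => /andP[xy yq].
    have y01 : 0 < y < 1 by rewrite (lt_le_trans x0 xy) (le_lt_trans yq q1).
    by have [] := f0 y y01.
  have [c _ /eqP] := MVT xq der cont.
  by rewrite mul0r subr_eq0 => /eqP.
have h : f x @[x --> 0^'+] --> f q.
  apply: cvg_near_cst.
  exists q => //= x; rewrite /ball /= sub0r normrN => xq x0.
  by rewrite cst // x0 (le_lt_trans (ler_norm _) xq).
rewrite -[LHS](cvg_lim _ h) //; exact: cvg_lim.
Qed.

(** Along the sequence q^(3^k), which tends to 0, the function is constant. *)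
Lemma cubic_invariant f l : (forall q, 0 < q < 1 -> f q = f (q ^+ 3)) ->
  f q @[q --> 0^'+] --> l -> forall q, 0 < q < 1 -> f q = l.
Proof.
move=> fi fl q q01; have /andP[q0 q1] := q01.
have inv k : f (q ^+ (3 ^ k)) = f q.
  elim: k => [|k IH]; first by rewrite expn0 expr1.
  rewrite -IH [RHS]fi; first by rewrite -exprM -expnSr.
  by rewrite exprn_gt0 // exprn_ilt1 ?ltW // expn_eq0.
have c0 : (fun k => q ^+ (3 ^ k)) @ \oo --> (0 : R).
  apply: (@squeeze_cvgr _ _ _ _ (fun=> 0) (fun k => q ^+ k)).
  - apply: nearW => k; rewrite exprn_ge0 ?(ltW q0) //=.
    by apply: ler_wiXn2l; rewrite ?(ltW q0) ?(ltW q1) // ltnW // ltn_expl.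
  - exact: cvg_cst.
  - by apply: cvg_expr; rewrite gtr0_norm.
have h := (cvg_at_rightP f 0 l).1 fl _ (conj (fun k => exprn_gt0 (3 ^ k) q0) c0).
have h2 : (fun=> f q) @ \oo --> l by apply: (eq_cvgn h) => k; rewrite inv.
by rewrite -(cvg_lim _ h2) // lim_cst.
Qed.
End HasD.

Ltac cvg_arith := repeat first
  [by [] | exact: cvg_cst | apply: cvgB | apply: cvgD | apply: cvgM].

Section CubicODE.
Variable R : realType.

Local Notation a := (@cubic_a R).
Local Notation s := (@cubic_s R).
Local Notation X := (@cubic_x R).

Let c1 := pseries_diffs (@acoef R).
Let c2 := pseries_diffs c1.
Let cc0 : cvg_unit (@acoef R) := @cvg_unit_acoef R.
Let cc1 : cvg_unit c1 := cvg_unit_diffs cc0.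
Let cc2 : cvg_unit c2 := cvg_unit_diffs cc1.

Let Da (q : R) : R := q * psum c1 q.
Let D2a (q : R) : R := q * psum c1 q + q * (q * psum c2 q).

Let aD q : 0 < q < 1 -> hasD a q (Da q).
Proof. by move=> q01; exact: hasD_psum. Qed.

Let DaD q : 0 < q < 1 -> hasD Da q (D2a q).
Proof.
move=> q01; have /andP[q0 _] := q01.
have q0' : q != 0 by rewrite gt_eqF.
exact: (hasDM (hasD_id q0') (hasD_psum cc1 q01)).
Qed.

Let a3D q : 0 < q < 1 -> hasD (fun q => a (q ^+ 3)) q (3 * Da (q ^+ 3)).
Proof.
move=> q01; have /andP[q0 _] := q01.
by apply: hasD_cube; [rewrite gt_eqF|apply: aD; exact: expr01].
Qed.

Let Ds (q : R) : R := ((Da q - 3 * Da (q ^+ 3)) / 2 * a (q ^+ 3)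
   - cubic_C q * (3 * Da (q ^+ 3))) / a (q ^+ 3) ^+ 2.

Let sD0 q : 0 < q < 1 -> hasD s q (Ds q).
Proof.
move=> q01; apply: hasD_div; last exact: a3D.
  by rewrite gt_eqF // cubic_a3_gt0.
apply: (@hasD_eq _ _ _ (2^-1 * (Da q - 3 * Da (q ^+ 3)))); last by rewrite mulrC.
have -> : @cubic_C R = (fun q => 2^-1 * (a q - a (q ^+ 3))).
  by apply/funext => x; rewrite /cubic_C mulrC.
by apply: hasDZ; apply: hasDB; [exact: aD|exact: a3D].
Qed.

Let s0 q : 0 < q < 1 -> 0 < s q. Proof. by move=> /cubic_s_itv /andP[]. Qed.
Let s1 q : 0 < q < 1 -> s q < 1. Proof. by move=> /cubic_s_itv /andP[]. Qed.
Let s2 q : 0 < q < 1 -> 1 + 2 * s q != 0.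
Proof. by move=> /s0 h; rewrite gt_eqF // addr_gt0 // mulr_gt0. Qed.
Let s3 q : 0 < q < 1 -> 1 - s q ^+ 3 != 0.
Proof.
move=> q01; rewrite subr_eq0 gt_eqF // exprn_ilt1 //; last exact: s1.
by rewrite ltW // s0.
Qed.

Let xD0 q : 0 < q < 1 -> hasD X q (9 * (1 - s q) ^+ 2 / (1 + 2 * s q) ^+ 4 * Ds q).
Proof.
move=> q01; have s20 := s2 q01.
have h1 : hasD (fun x => 1 - s x) q (0 - Ds q) by apply: hasDB; [exact: hasD_cst|exact: sD0].
have h2 : hasD (fun x => 1 + 2 * s x) q (0 + 2 * Ds q).
  by apply: hasDD; [exact: hasD_cst|apply: hasDZ; exact: sD0].
have h3 := hasDB (hasD_cst 1 q) (hasDX 3 (@hasD_div _ _ (fun x => 1 + 2 * s x) q _ _ s20 h1 h2)).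
apply: (hasD_eq h3).
by rewrite /=; field.
Qed.

Let cvg_s : s q / q @[q --> 0^'+] --> (3 : R).
Proof.
have h : cubic_C q / q / a (q ^+ 3) @[q --> 0^'+] --> (3 / 1 : R).
  apply: cvgM; first exact: cvg_at0_C.
  by apply: cvgV; [exact: oner_neq0|exact: cvg_at0_aX].
rewrite divr1 in h; apply: (eq_cvg_at0 h) => q q01.
by rewrite /cubic_s mulrAC.
Qed.

Let cvg_s0 : s q @[q --> 0^'+] --> (0 : R).
Proof.
have h : s q / q * q @[q --> 0^'+] --> (3 * 0 : R) by apply: cvgM => //; exact: cvg_at0_id.
rewrite mulr0 in h; apply: (eq_cvg_at0 h) => q /andP[q0 _].
by rewrite divfK // gt_eqF.
Qed.

Let cvg_Da : Da q / q @[q --> 0^'+] --> (6 : R).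
Proof.
have h := cvg_at0_psum cc1; rewrite /c1 {2}/pseries_diffs acoef1 mul1r in h.
apply: (eq_cvg_at0 h) => q /andP[q0 _].
by rewrite /Da mulrAC divff ?mul1r // gt_eqF.
Qed.

Let cvg_Da0 : Da q @[q --> 0^'+] --> (0 : R).
Proof.
have h : Da q / q * q @[q --> 0^'+] --> (6 * 0 : R) by apply: cvgM => //; exact: cvg_at0_id.
rewrite mulr0 in h; apply: (eq_cvg_at0 h) => q /andP[q0 _].
by rewrite divfK // gt_eqF.
Qed.

(** The quotient rho of D s by the claimed value is invariant under q -> q^3:
    this follows on applying D to x(q^3) = s(q)^3, where x(q^3) is also a
    rational function of s(q^3).  Near 0 both D s and s are 3 q + O(q^2), so
    rho tends to 1. *)
Lemma hasD_cubic_s (q : R) : 0 < q < 1 ->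
  hasD s q (s q * (1 - s q ^+ 3) * a (q ^+ 3) ^+ 2).
Proof.
pose rho q := Ds q / (s q * (1 - s q ^+ 3) * a (q ^+ 3) ^+ 2).
suff rho1 r : 0 < r < 1 -> rho r = 1.
  move=> q01; apply: hasD_eq (sD0 q01) _.
  have A0 : s q * (1 - s q ^+ 3) * a (q ^+ 3) ^+ 2 != 0.
    apply: mulf_neq0; last by rewrite expf_neq0 // gt_eqF // cubic_a3_gt0.
    by apply: mulf_neq0; [rewrite gt_eqF // s0|exact: s3].
  by apply: (mulIf (invr_neq0 A0)); rewrite divff //; exact: rho1.
apply: cubic_invariant => {q r} => [q q01|].
  have /andP[q0 q1] := q01; have q301 := expr01 2 q01.
  have q0' : q != 0 by rewrite gt_eqF.
  have h1 := hasD_cube q0' (xD0 q301).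
  have h2 : hasD (fun x => X (x ^+ 3)) q (3 * s q ^+ 2 * Ds q).
    apply: hasD_near (hasDX 3 (sD0 q01)) => // x x01.
    by rewrite cubic_x3.
  have := hasD_unique q0' h1 h2.
  have h3 : s q ^+ 3 = X (q ^+ 3) by rewrite cubic_x3.
  have [ha _] := cubic_bs q301.
  have a0 := cubic_a3_gt0 q301.
  have A0 : s q ^+ 3 * (1 - s q ^+ 3) != 0.
    by rewrite mulf_neq0 ?s3 // expf_neq0 // gt_eqF // s0.
  have A3 := s3 q301.
  rewrite /rho ha.
  have -> : Ds q / (s q * (1 - s q ^+ 3) * (a (q ^+ 3 ^+ 3) * (1 + 2 * s (q ^+ 3))) ^+ 2)
    = (3 * s q ^+ 2 * Ds q) / (3 * (s q ^+ 3 * (1 - s q ^+ 3)) * (a (q ^+ 3 ^+ 3) * (1 + 2 * s (q ^+ 3))) ^+ 2).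
    have := s0 q01; have := s3 q01; have := s2 q301.
    move: (a _) a0 (s _) (s _) (Ds _) => y y0 z t D z0 t3 t0.
    by field; rewrite z0 t3 !gt_eqF.
  move=> <-; move: A0; rewrite h3 /cubic_x.
  have := s0 q301; have := s1 q301; have := s2 q301; move: A3.
  move: (a _) a0 (s _) (Ds _) => y y0 z D z3 z2 z1 z0 A0.
  have E : (1 - ((1 - z) / (1 + 2 * z)) ^+ 3) * (1 - (1 - ((1 - z) / (1 + 2 * z)) ^+ 3))
    = 9 * z * (1 - z ^+ 3) * (1 - z) ^+ 2 / (1 + 2 * z) ^+ 6 by field.
  rewrite E; field.
  by rewrite z3 z2 !gt_eqF // subr_gt0.
have h : ((Da q / q - 3 * (q ^+ 2 * psum c1 (q ^+ 3))) / 2 * a (q ^+ 3)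
    - cubic_C q / q * q * (3 * (q ^+ 2 * psum c1 (q ^+ 3))))
    / (a (q ^+ 3) * a (q ^+ 3)) / (s q / q * (1 - s q * (s q * s q)) * (a (q ^+ 3) * a (q ^+ 3)))
    @[q --> 0^'+] -->
    (((6 - 3 * (0 * 6)) / 2 * 1 - 3 * 0 * (3 * (0 * 6))) / (1 * 1) /
      (3 * (1 - 0 * (0 * 0)) * (1 * 1)) : R).
  have hc : psum c1 (q ^+ 3) @[q --> 0^'+] --> (6 : R).
    by have := cvg_at0_psumX 2 cc1; rewrite /c1 {2}/pseries_diffs acoef1 mul1r.
  have ha := @cvg_at0_aX R 2.
  have hq := @cvg_at0X R 1.
  have hC := @cvg_at0_C R; have h0 := @cvg_at0_id R.
  apply: cvgM; last by apply: cvgV; [rewrite !mulr0 subr0 !mulr1 pnatr_eq0|cvg_arith].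
  apply: cvgM; last by apply: cvgV; [rewrite mulr1 oner_neq0|cvg_arith].
  by cvg_arith.
have e1 : ((6 - 3 * (0 * 6)) / 2 * 1 - 3 * 0 * (3 * (0 * 6))) / (1 * 1) /
      (3 * (1 - 0 * (0 * 0)) * (1 * 1)) = 1 :> R by field.
rewrite e1 in h.
apply: (eq_cvg_at0 h) => q q01; have /andP[q0 q1] := q01.
have D3 : Da (q ^+ 3) = q ^+ 3 * psum c1 (q ^+ 3) by [].
rewrite /rho /Ds D3.
have := s0 q01; have := s3 q01; have := cubic_a3_gt0 q01.
move: (a _) (s _) (Da _) (psum _ _) (cubic_C _) => y t D p C y0 t3 t0.
by field; rewrite t3 !gt_eqF.
Qed.

(** The chain rule and [hasD_cubic_s], x being a rational function of s. *)
Lemma hasD_cubic_x (q : R) : 0 < q < 1 ->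
  hasD X q (X q * (1 - X q) * a q ^+ 2).
Proof.
move=> q01; have q0' : q != 0 by case/andP: q01 => q0 _; rewrite gt_eqF.
have e := hasD_unique q0' (sD0 q01) (hasD_cubic_s q01).
apply: hasD_eq (xD0 q01) _; rewrite e /cubic_x.
have [-> _] := cubic_bs q01; have := s2 q01; move: (s q) (a _) => z y z2.
by field.
Qed.

(* V is the derivative of a with respect to log (x / (1 - x)). *)
Let V (q : R) : R := Da q / a q ^+ 2.
Let DV (q : R) : R := D2a q / a q ^+ 2 - 2 * Da q ^+ 2 / a q ^+ 3.

Let an0 q : 0 < q < 1 -> a q != 0.
Proof. by move=> q01; rewrite gt_eqF // cubic_a_gt0. Qed.

Let VD0 q : 0 < q < 1 -> hasD V q (DV q).
Proof.
move=> q01; have a0 := an0 q01; have a20 : a q ^+ 2 != 0 by rewrite expf_neq0.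
have h := @hasD_div _ _ (fun x => a x ^+ 2) q _ _ a20 (DaD q01) (hasDX 2 (aD q01)).
by apply: (hasD_eq h); rewrite /DV /=; field.
Qed.

Let V_step q : 0 < q < 1 ->
  V q = 3 * V (q ^+ 3) / (1 + 2 * s q)
        + 2 * a (q ^+ 3) * (s q * (1 - s q ^+ 3)) / (1 + 2 * s q) ^+ 2.
Proof.
move=> q01; have q0' : q != 0 by case/andP: q01 => q0 _; rewrite gt_eqF.
have h2 : hasD (fun x => 1 + 2 * s x) q (0 + 2 * (s q * (1 - s q ^+ 3) * a (q ^+ 3) ^+ 2)).
  by apply: hasDD; [exact: hasD_cst|apply: hasDZ; exact: hasD_cubic_s].
have h3 := hasDM (a3D q01) h2.
have h4 : hasD a q (3 * Da (q ^+ 3) * (1 + 2 * s q) +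
     a (q ^+ 3) * (0 + 2 * (s q * (1 - s q ^+ 3) * a (q ^+ 3) ^+ 2))).
  by apply: hasD_near h3 => // x x01; have [-> _] := cubic_bs x01.
have e := hasD_unique q0' (aD q01) h4.
rewrite /V e; have [-> _] := cubic_bs q01.
have := s2 q01; have := an0 (expr01 2 q01).
move: (s q) (a _) (Da _) => z y D y0 z2.
by field; rewrite y0 z2.
Qed.

(* The defect of the second-order equation.  Applying D to [V_step] shows that
   E(q) = 9 / (1 + 2 s(q)) E(q^3), and E = O(q), so E vanishes. *)
Let E (q : R) : R := DV q - 2 / 9 * X q * (1 - X q) * a q ^+ 3.

Let E_step q : 0 < q < 1 -> E q = 9 / (1 + 2 * s q) * E (q ^+ 3).
Proof.
move=> q01; have q0' : q != 0 by case/andP: q01 => q0 _; rewrite gt_eqF.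
have q301 := expr01 2 q01.
have z2 := s2 q01; have y0 := an0 q301.
pose S := s q * (1 - s q ^+ 3) * a (q ^+ 3) ^+ 2.
have hs : hasD s q S := hasD_cubic_s q01.
have h2 : hasD (fun x => 1 + 2 * s x) q (0 + 2 * S).
  by apply: hasDD; [exact: hasD_cst|exact: hasDZ].
have hV3 : hasD (fun x => 3 * V (x ^+ 3)) q (3 * (3 * DV (q ^+ 3))).
  by apply: hasDZ; apply: hasD_cube => //; exact: VD0.
have h4 := @hasD_div _ _ (fun x => 1 + 2 * s x) q _ _ z2 hV3 h2.
have h5 : hasD (fun x => 2 * a (x ^+ 3) * (s x * (1 - s x ^+ 3))) q
    (2 * (3 * Da (q ^+ 3)) * (s q * (1 - s q ^+ 3)) +
     2 * a (q ^+ 3) * (S * (1 - s q ^+ 3) + s q * (0 - 3%:R * s q ^+ 2 * S))).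
  apply: hasDM; first by apply: hasDZ; exact: a3D.
  by apply: hasDM => //; apply: hasDB; [exact: hasD_cst|exact: (hasDX 3)].
have z22 : (1 + 2 * s q) ^+ 2 != 0 by rewrite expf_neq0.
have h6 := @hasD_div _ _ (fun x => (1 + 2 * s x) ^+ 2) q _ _ z22 h5 (hasDX 2 h2).
have h7 := hasD_near q01 (fun x x01 => esym (V_step x01)) (hasDD h4 h6).
have e := hasD_unique q0' (VD0 q01) h7.
rewrite /E e (cubic_x3 q01); have [-> _] := cubic_bs q01.
rewrite /cubic_x /V /S /=.
move: (s q) (a (q ^+ 3)) (Da _) (DV _) z2 y0 => z y D D' z2 y0.
by field; rewrite y0 z2.
Qed.

Let E0 q : 0 < q < 1 -> E q = 0.
Proof.
have ha := @cvg_at0_a R; have hs := cvg_s0; have hsq := cvg_s.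
have hc : psum c2 q @[q --> 0^'+] --> c2 0 by exact: cvg_at0_psum.
have h0 := @cvg_at0_id R; have hD := cvg_Da; have hD0 := cvg_Da0.
have h3 : a q * a q * a q @[q --> 0^'+] --> (1 * 1 * 1 : R) by cvg_arith.
have h4 : (1 + 2 * s q) * (1 + 2 * s q) * (1 + 2 * s q) @[q --> 0^'+] -->
  ((1 + 2 * 0) * (1 + 2 * 0) * (1 + 2 * 0) : R) by cvg_arith.
have n1 : 1 * 1 * 1 != 0 :> R by rewrite !mulr1 oner_neq0.
have n2 : 1 * 1 != 0 :> R by rewrite !mulr1 oner_neq0.
have n4 : (1 + 2 * 0) * (1 + 2 * 0) * (1 + 2 * 0) != 0 :> R.
  by rewrite !mulr0 addr0 !mulr1 oner_neq0.
have n3 : 1 + 2 * 0 != 0 :> R by rewrite mulr0 addr0 oner_neq0.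
have i2 : (a q * a q)^-1 @[q --> 0^'+] --> ((1 * 1)^-1 : R).
  by apply: cvgV => //; cvg_arith.
have i3 : (a q * a q * a q)^-1 @[q --> 0^'+] --> ((1 * 1 * 1)^-1 : R) by apply: cvgV.
have i4 : ((1 + 2 * s q) * (1 + 2 * s q) * (1 + 2 * s q))^-1 @[q --> 0^'+] -->
  (((1 + 2 * 0) * (1 + 2 * 0) * (1 + 2 * 0))^-1 : R) by apply: cvgV.
have i1 : (1 + 2 * s q)^-1 @[q --> 0^'+] --> ((1 + 2 * 0)^-1 : R).
  by apply: cvgV => //; cvg_arith.
pose f q := (Da q / q + q * psum c2 q) * (a q * a q)^-1
  - 2 * (Da q / q * Da q) * (a q * a q * a q)^-1
  - 2 / 9 * (9 * (s q / q) * (1 + s q + s q * s q)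
      * ((1 + 2 * s q) * (1 + 2 * s q) * (1 + 2 * s q))^-1)
    * (1 - 9 * s q * (1 + s q + s q * s q)
      * ((1 + 2 * s q) * (1 + 2 * s q) * (1 + 2 * s q))^-1) * (a q * a q * a q).
have hf : exists l : R, f q @[q --> 0^'+] --> l.
  pose k : R := ((1 + 2 * 0) * (1 + 2 * 0) * (1 + 2 * 0))^-1.
  exists ((6 + 0 * c2 0) * (1 * 1)^-1 - 2 * (6 * 0) * (1 * 1 * 1)^-1
    - 2 / 9 * (9 * 3 * (1 + 0 + 0 * 0) * k) * (1 - 9 * 0 * (1 + 0 + 0 * 0) * k)
      * (1 * 1 * 1)); rewrite /f.
  apply: cvgB; first (apply: cvgB).
  - by apply: cvgM; [apply: cvgD; [exact: hD|apply: cvgM; [exact: h0|exact: hc]]|exact: i2].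
  - by apply: cvgM; [apply: cvgM; [exact: cvg_cst|apply: cvgM; [exact: hD|exact: hD0]]|exact: i3].
  apply: cvgM; last exact: h3.
  have hq : 1 + s q + s q * s q @[q --> 0^'+] --> (1 + 0 + 0 * 0 : R) by cvg_arith.
  apply: cvgM.
    apply: cvgM; first exact: cvg_cst.
    apply: cvgM; last exact: i4.
    by apply: cvgM; [apply: cvgM; [exact: cvg_cst|exact: hsq]|exact: hq].
  apply: cvgB; first exact: cvg_cst.
  apply: cvgM; last exact: i4.
  by apply: cvgM; [apply: cvgM; [exact: cvg_cst|exact: hs]|exact: hq].
have [l {}hf] := hf.
have hm : 9 / (1 + 2 * s q) @[q --> 0^'+] --> (9 / (1 + 2 * 0) : R).
  by apply: cvgM; [exact: cvg_cst|exact: i1].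
apply: (@cubic_iteration_eq0 R E (fun q => 9 / (1 + 2 * s q)) l (9 / (1 + 2 * 0))).
- exact: E_step.
- apply: (eq_cvg_at0 hf) => {}q q01.
  rewrite /E /f /DV /D2a -/(Da q) /cubic_x.
  have := an0 q01; have := s2 q01; have q0' : q != 0 by case/andP: q01 => q0 _; rewrite gt_eqF.
  move: (s q) (a q) (Da q) (psum c2 q) => z y D p z2 y0.
  by field; rewrite z2 q0' y0.
- exact: hm.
Qed.

(** In the variable x the function a solves the hypergeometric equation:
    with D = x (1 - x) a^2 d/dx and v = D a / a^2 it is the equation
    D v = (2/9) x (1 - x) a^3. *)
Lemma cubic_a_ode : exists v : R -> R,
  [/\ forall q, 0 < q < 1 -> hasD a q (v q * a q ^+ 2),
      forall q, 0 < q < 1 -> hasD v q (2 / 9 * X q * (1 - X q) * a q ^+ 3)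
    & v q @[q --> 0^'+] --> (0 : R)].
Proof.
exists V; split => [q q01|q q01|].
- by apply: hasD_eq (aD q01) _; rewrite /V divfK // expf_neq0 // an0.
- apply: hasD_eq (VD0 q01) _; apply/eqP; rewrite -subr_eq0; apply/eqP.
  exact: E0.
- have h : Da q / (a q * a q) @[q --> 0^'+] --> (0 / (1 * 1) : R).
    apply: cvgM; first exact: cvg_Da0.
    apply: cvgV; first by rewrite mulr1 oner_neq0.
    by apply: cvgM; exact: cvg_at0_a.
  rewrite mul0r in h; apply: (eq_cvg_at0 h) => q _.
  by rewrite /V expr2.
Qed.

Lemma cvg_at0_x : X q @[q --> 0^'+] --> (0 : R).
Proof.
have hs := cvg_s0.
have i1 : (1 + 2 * s q)^-1 @[q --> 0^'+] --> ((1 + 2 * 0)^-1 : R).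
  by apply: cvgV; [rewrite mulr0 addr0 oner_neq0|cvg_arith].
have h : 1 - (1 - s q) / (1 + 2 * s q) * ((1 - s q) / (1 + 2 * s q) *
    ((1 - s q) / (1 + 2 * s q))) @[q --> 0^'+] -->
  (1 - (1 - 0) / (1 + 2 * 0) * ((1 - 0) / (1 + 2 * 0) * ((1 - 0) / (1 + 2 * 0))) : R).
  by cvg_arith.
have e0 : 1 - (1 - 0) / (1 + 2 * 0) * ((1 - 0) / (1 + 2 * 0) *
  ((1 - 0) / (1 + 2 * 0))) = 0 :> R by field.
by rewrite e0 in h; apply: (eq_cvg_at0 h).
Qed.
End CubicODE.

(** * The hypergeometric function *)

(** The coefficients of F = 2F1(1/3, 2/3; 1; x). *)
Definition hcoef (R : realType) (k : nat) : R :=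
  pochhammer (1 / 3) k * pochhammer (2 / 3) k / k`!%:R ^+ 2.

Lemma pochhammerS (R : realType) (x : R) (k : nat) :
  pochhammer x k.+1 = pochhammer x k * (x + k%:R).
Proof. by rewrite /pochhammer big_nat_recr. Qed.

Lemma pochhammer_gt0 (R : realType) (x : R) (k : nat) : 0 < x -> 0 < pochhammer x k.
Proof.
move=> x0; elim: k => [|k IH]; first by rewrite /pochhammer big_geq.
by rewrite pochhammerS mulr_gt0 // ltr_pwDl.
Qed.

Lemma fact_neq0 (R : realType) (k : nat) : k`!%:R != 0 :> R.
Proof. by rewrite pnatr_eq0 -lt0n fact_gt0. Qed.

Lemma hcoefS (R : realType) (k : nat) :
  k.+1%:R ^+ 2 * hcoef R k.+1 = (k%:R + 1 / 3) * (k%:R + 2 / 3) * hcoef R k.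
Proof.
rewrite /hcoef !pochhammerS factS natrM.
have := fact_neq0 R k; have : k.+1%:R != 0 :> R by rewrite pnatr_eq0.
move: (pochhammer _ _) (pochhammer _ _) (k`!%:R) (k.+1%:R) (k%:R) => x y z m n m0 z0.
by field; rewrite m0 z0.
Qed.

Lemma hcoef_gt0 (R : realType) (k : nat) : 0 < hcoef R k.
Proof.
by rewrite divr_gt0 ?mulr_gt0 ?pochhammer_gt0 ?divr_gt0.
Qed.

Lemma hcoef_le1 (R : realType) (k : nat) : hcoef R k <= 1.
Proof.
elim: k => [|k IH].
  by rewrite /hcoef /pochhammer !big_geq // fact0 expr1n divr1 mulr1.
have k0 : 0 < k.+1%:R ^+ 2 :> R by rewrite exprn_gt0.
rewrite -(ler_pM2l k0) hcoefS mulr1.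
have := hcoef_gt0 R k; move: IH; have : 0 <= k%:R :> R by [].
rewrite -(natr1 k); move: (k%:R) (hcoef R k) => n f n0 f1 f0.
have : (n + 1 / 3) * (n + 2 / 3) * f <= (n + 1 / 3) * (n + 2 / 3) * 1.
  by apply: ler_wpM2l => //; apply: mulr_ge0; lra.
by move=> h; apply: (le_trans h); rewrite mulr1 expr2; nra.
Qed.

Lemma cvg_unit_hcoef (R : realType) : cvg_unit (hcoef R).
Proof.
move=> K K01; have /andP[K0 _] := K01.
apply: (@series_le_cvg _ _ (fun n => 1 * K ^+ n)).
- by move=> n; rewrite mulr_ge0 ?exprn_ge0 // ltW // hcoef_gt0.
- by move=> n; rewrite mul1r exprn_ge0.
- by move=> n; rewrite ler_wpM2r ?exprn_ge0 // hcoef_le1.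
- exact: cvgn_geom.
Qed.

(** The coefficients of the primitive of (2/9) F that vanishes at 0. *)
Definition ucoef (R : realType) (k : nat) : R :=
  if k is k'.+1 then 2 / 9 * hcoef R k' / k%:R else 0.

Lemma pseries_diffs_ucoef (R : realType) :
  pseries_diffs (@ucoef R) = fun k => 2 / 9 * hcoef R k.
Proof.
apply/funext => k; rewrite /pseries_diffs /ucoef.
by rewrite mulrC divfK // pnatr_eq0.
Qed.

Lemma cvg_unit_ucoef (R : realType) : cvg_unit (@ucoef R).
Proof.
move=> K K01; have /andP[K0 _] := K01.
have u0 n : 0 <= @ucoef R n <= 1.
  case: n => [|n]; first by rewrite lexx ler01.
  rewrite /ucoef; have h0 := hcoef_gt0 R n; have h1 := hcoef_le1 R n.
  have a0 : 0 <= 2 / 9 * hcoef R n by apply: mulr_ge0; lra.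
  rewrite divr_ge0 //=; move: a0 h0 h1; move: (hcoef R n) => f a0 h0 h1.
  by rewrite ler_pdivrMr // mul1r; apply: (@le_trans _ _ 1); [lra|rewrite ler1n].
apply: (@series_le_cvg _ _ (fun n => 1 * K ^+ n)).
- by move=> n; rewrite mulr_ge0 ?exprn_ge0 //; case/andP: (u0 n).
- by move=> n; rewrite mul1r exprn_ge0.
- by move=> n; rewrite ler_wpM2r ?exprn_ge0 //; case/andP: (u0 n).
- exact: cvgn_geom.
Qed.

(** The hypergeometric equation in the form (x (1 - x) F')' = (2/9) F. *)
Lemma psum_ucoef (R : realType) (x : R) : 0 <= x < 1 ->
  psum (@ucoef R) x = x * (1 - x) * psum (pseries_diffs (hcoef R)) x.
Proof.
move=> x01.
have cd := cvg_unit_diffs (@cvg_unit_hcoef R) x01.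
set d := pseries_diffs (hcoef R).
have h1 : pseries d x @ \oo --> psum d x by exact: cd.
have h2 : (fun N => pseries d x N.+1) @ \oo --> psum d x by rewrite (cvg_shiftS (pseries d x)).
have h : (fun N => x * pseries d x N.+1 - x ^+ 2 * pseries d x N) @ \oo -->
    x * psum d x - x ^+ 2 * psum d x.
  by apply: cvgB; apply: cvgM => //; exact: cvg_cst.
have -> : x * (1 - x) * psum d x = x * psum d x - x ^+ 2 * psum d x by ring.
apply: cvg_lim => //; rewrite -(cvg_shiftn 2 (pseries (@ucoef R) x)).
apply: (eq_cvgn h) => N; rewrite /= addn2.
have PS (c : nat -> R) M : pseries c x M.+1 = pseries c x M + c M * x ^+ M.
  by rewrite /pseries /series /= big_nat_recr.
have P0 (c : nat -> R) : pseries c x 0 = 0 by rewrite /pseries /series /= big_geq.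
elim: N => [|N IH].
  rewrite !PS !P0 expr0 expr1 /d /pseries_diffs.
  have h0 : hcoef R 0 = 1.
    by rewrite /hcoef /pochhammer !big_geq // fact0 expr1n divr1 mulr1.
  have := hcoefS R 0; rewrite h0 expr1n mul1r => ->.
  by rewrite /ucoef h0; field.
have PN : pseries d x N = pseries d x N.+1 - d N * x ^+ N by rewrite PS addrK.
rewrite [LHS]PS IH (PS d N.+1) PN; move: (pseries d x N.+1) => p.
suff e : @ucoef R N.+2 * x ^+ N.+2 = x * (d N.+1 * x ^+ N.+1) - x ^+ 2 * (d N * x ^+ N).
  by rewrite e; ring.
rewrite /ucoef /d /pseries_diffs.
have e := hcoefS R N.+1; have m0 : N.+2%:R != 0 :> R by rewrite pnatr_eq0.
have -> : N.+2%:R * hcoef R N.+2 = (N.+1%:R + 1 / 3) * (N.+1%:R + 2 / 3) * hcoef R N.+1 / N.+2%:R.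
  by rewrite -e expr2; field.
rewrite !exprS -(natr1 N.+1) in m0 *; move: (hcoef _ _) (N.+1%:R) (x ^+ N) m0 => f n y m0.
by field.
Qed.

Lemma is_derive_ucoef (R : realType) (x : R) : 0 <= x < 1 ->
  is_derive x (1 : R) (psum (@ucoef R)) (2 / 9 * psum (hcoef R) x).
Proof.
move=> x01; have /andP[x0 x1] := x01.
have h : is_derive x (1 : R) (psum (@ucoef R)) (psum (pseries_diffs (@ucoef R)) x).
  apply: is_derive_psum; first exact: cvg_unit_ucoef.
  by rewrite x1 andbT; apply: lt_le_trans x0; rewrite oppr_lt0.
apply: (is_derive_eq h); rewrite pseries_diffs_ucoef.
have c : pseries (hcoef R) x @ \oo --> psum (hcoef R) x by exact: cvg_unit_hcoef.
have c2 : (fun N => 2 / 9 * pseries (hcoef R) x N) @ \oo --> 2 / 9 * psum (hcoef R) x.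
  by apply: cvgM => //; exact: cvg_cst.
apply: cvg_lim => //; apply: (eq_cvgn c2) => N.
rewrite /pseries /series /= mulr_sumr; apply: eq_bigr => i _.
by apply: esym; exact: mulrA.
Qed.

Lemma cubic_x_itv (R : realType) (q : R) : 0 < q < 1 -> 0 < cubic_x q < 1.
Proof.
move=> q01; have /andP[s0 s1] := cubic_s_itv q01.
have s2 : 0 < 1 + 2 * cubic_s q by rewrite addr_gt0 // mulr_gt0.
have t0 : 0 < (1 - cubic_s q) / (1 + 2 * cubic_s q) by rewrite divr_gt0 // subr_gt0.
have t1 : (1 - cubic_s q) / (1 + 2 * cubic_s q) < 1 by rewrite ltr_pdivrMr //; lra.
rewrite /cubic_x; apply/andP; split.
  by rewrite subr_gt0 exprn_ilt1 // ltW.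
by rewrite ltrBlDr ltrDl exprn_gt0.
Qed.

(** Both sides solve the hypergeometric equation and are regular at 0, so
    their Wronskian vanishes and their quotient is constant. *)
Theorem cubic_a_hypergeometric (R : realType) (q : R) : 0 < q < 1 ->
  cubic_a q = psum (hcoef R) (cubic_x q).
Proof.
have [v [av vd v0]] := @cubic_a_ode R.
pose F1 := psum (pseries_diffs (hcoef R)).
have an0 (r : R) : 0 < r < 1 -> cubic_a r != 0 by move=> r01; rewrite gt_eqF // cubic_a_gt0.
have ND r : 0 < r < 1 -> hasD (fun q => psum (hcoef R) (cubic_x q)) r
    (psum (@ucoef R) (cubic_x r) * cubic_a r ^+ 2).
  move=> r01; have /andP[x0 x1] := cubic_x_itv r01.
  have h : is_derive (cubic_x r) (1 : R) (psum (hcoef R)) (F1 (cubic_x r)).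
    apply: is_derive_psum; first exact: cvg_unit_hcoef.
    by rewrite x1 andbT; apply: lt_trans x0; rewrite oppr_lt0.
  apply: (hasD_eq (hasD_comp h (hasD_cubic_x r01))).
  by rewrite psum_ucoef ?x1 ?(ltW x0) // /F1; ring.
have UD r : 0 < r < 1 -> hasD (fun q => psum (@ucoef R) (cubic_x q)) r
    (2 / 9 * psum (hcoef R) (cubic_x r) * (cubic_x r * (1 - cubic_x r) * cubic_a r ^+ 2)).
  move=> r01; have /andP[x0 x1] := cubic_x_itv r01.
  apply: hasD_comp; last exact: hasD_cubic_x.
  by apply: is_derive_ucoef; rewrite x1 ltW.
have cx (c : nat -> R) : cvg_unit c -> psum c (cubic_x q) @[q --> 0^'+] --> c 0.
  move=> cc; rewrite -psum0; apply: (cvg_comp (@cubic_x R) (psum c)); first exact: cvg_at0_x.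
  by apply: (continuous_psum cc); rewrite ltr01 oppr_lt0 ltr01.
have h0 : hcoef R 0 = 1.
  by rewrite /hcoef /pochhammer !big_geq // fact0 expr1n divr1 mulr1.
have cF := cx _ (@cvg_unit_hcoef R); have cU := cx _ (@cvg_unit_ucoef R).
have ca := @cvg_at0_a R.
have W0 r : 0 < r < 1 ->
    psum (hcoef R) (cubic_x r) * v r - cubic_a r * psum (@ucoef R) (cubic_x r) = 0.
  apply: (@hasD0_lim _ (fun r => psum (hcoef R) (cubic_x r) * v r
    - cubic_a r * psum (@ucoef R) (cubic_x r))) => {}r; last first.
    have h : psum (hcoef R) (cubic_x r) * v r - cubic_a r * psum (@ucoef R) (cubic_x r)
        @[r --> 0^'+] --> (hcoef R 0 * 0 - 1 * @ucoef R 0 : R) by cvg_arith.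
    have e : hcoef R 0 * 0 - 1 * @ucoef R 0 = 0 by rewrite mulr0 mul1r /ucoef subr0.
    by rewrite e in h; exact: h.
  move=> r01.
  apply: (hasD_eq (hasDB (hasDM (ND r r01) (vd r r01)) (hasDM (av r r01) (UD r r01)))).
  by ring.
have quot r : 0 < r < 1 -> psum (hcoef R) (cubic_x r) / cubic_a r = 1.
  apply: (@hasD0_lim _ (fun r => psum (hcoef R) (cubic_x r) / cubic_a r)) => {}r; last first.
    have h : psum (hcoef R) (cubic_x r) / cubic_a r @[r --> 0^'+] --> (hcoef R 0 / 1 : R).
      by apply: cvgM => //; apply: cvgV => //; exact: oner_neq0.
    by rewrite h0 divr1 in h; exact: h.
  move=> r01; have a0 := an0 r r01.
  apply: (hasD_eq (hasD_div a0 (ND r r01) (av r r01))).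
  rewrite (_ : _ - _ = - (cubic_a r ^+ 2 * (psum (hcoef R) (cubic_x r) * v r
    - cubic_a r * psum (@ucoef R) (cubic_x r)))); last by ring.
  by rewrite W0 // mulr0 oppr0 mul0r.
by move=> q01; rewrite -[RHS](divfK (an0 q q01)) quot // mul1r.
Qed.

(** * Improper integrals *)

Section ImproperIntegrals.
Variable R : realType.
Local Notation mu := (@lebesgue_measure R).

(** Monotone convergence; it extends the integration theorems for segments to
    open and unbounded intervals. *)
Lemma cvg_integral_exhaust (D : set R) (al be : nat -> R) (f : R -> R) :
  nonincreasing_seq al -> nondecreasing_seq be ->
  (forall x, D x <-> exists n, al n <= x <= be n) ->
  measurable D -> measurable_fun D f -> (forall x, D x -> 0 <= f x) ->
  ((\int[mu]_(x in `[al n, be n]) (f x)%:E) @[n --> \oo] -->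
   \int[mu]_(x in D) (f x)%:E)%E.
Proof.
move=> nal nbe DE mD mf f0.
have -> : D = \bigcup_n (`[al n, be n]%classic).
  apply/seteqP; split => x.
    by move=> /DE[n xn]; exists n => //=; rewrite in_itv.
  by move=> [n _] /=; rewrite in_itv /= => xn; apply/DE; exists n.
have sub n : `[al n, be n]%classic `<=` D.
  by move=> x /=; rewrite in_itv /= => xn; apply/DE; exists n.
apply: ge0_nondecreasing_set_cvg_integral.
- move=> m n mn; rewrite subsetEset; apply: subset_itv; rewrite bnd_simp.
    exact: nal.
  exact: nbe.
- by move=> i; exact: measurable_itv.
- by move=> i; apply/measurable_EFinP; apply: measurable_funS mf.
- by move=> i x /sub Dx; rewrite lee_fin f0.
Qed.

Lemma inv_seq_noninc (c : nat) : nonincreasing_seq (fun n => ((n + c.+1)%:R^-1 : R)).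
Proof.
move=> m n mn; rewrite lef_pV2 ?posrE ?ltr0n ?addnS // ler_nat.
by rewrite ltnS leq_add2r.
Qed.

Lemma inv_seq_small (c : nat) (e : R) : 0 < e -> exists n, ((n + c.+1)%:R^-1 : R) <= e.
Proof.
move=> e0; have [N _ HN] := near_infty_natSinv_lt (PosNum e0).
exists N; rewrite addnS; apply: ltW; apply: le_lt_trans (HN N (leqnn N)) => /=.
by rewrite lef_pV2 ?posrE ?ltr0n // ler_nat ltnS leq_addr.
Qed.

Lemma nat_seq_large (x : R) : exists n, x <= n.+1%:R.
Proof.
exists (Num.bound `|x|); apply: le_trans (ler_norm x) _; apply: ltW.
apply: lt_trans (archi_boundP (normr_ge0 x)) _.
by rewrite ltr_nat.
Qed.

Lemma near_gt0_eq (f h : R -> R) (x : R) : 0 < x -> (forall y : R, 0 < y -> f y = h y) ->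
  {for x, continuous h} -> {for x, continuous f}.
Proof.
move=> x0 fh ch; rewrite /prop_for /continuous_at (fh x x0).
apply: cvg_trans ch; apply: near_eq_cvg.
have : \forall y \near x, 0 < y by exact: lt_nbhsr.
by apply: filterS => y y0; rewrite fh.
Qed.

(** Change of variables by a decreasing bijection from the half-line onto the
    unit interval: substitution on the segments [1 / (n + 1), n + 1] and
    exhaustion on both sides. *)
Lemma integral_subst_unit (F g G : R -> R) :
  (forall y : R, 0 < y -> is_derive y (1 : R) F (- g y)) ->
  (forall y : R, 0 < y -> {for y, continuous g}) ->
  (forall y : R, 0 < y -> 0 <= g y) ->
  (forall y z : R, 0 < y -> y < z -> F z < F y) ->
  (forall y : R, 0 < y -> 0 < F y < 1) ->
  (forall e : R, 0 < e -> exists y : R, 0 < y /\ F y <= e) ->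
  (forall e : R, e < 1 -> exists y : R, 0 < y /\ e <= F y) ->
  (forall x : R, 0 < x < 1 -> {for x, continuous G}) ->
  (forall x : R, 0 < x < 1 -> 0 <= G x) ->
  (\int[mu]_(x in `]0%R, 1%R[) (G x)%:E =
   \int[mu]_(y in `]0%R, +oo[) (G (F y) * g y)%:E)%E.
Proof.
move=> dF cg g0 decF F01 F0 F1 cG G0.
pose al (n : nat) : R := (n + 1)%:R^-1; pose be (n : nat) : R := n.+1%:R.
have al0 n : 0 < al n by rewrite invr_gt0 ltr0n addn1.
have be0 n : 0 < be n by rewrite ltr0n.
have alb n : al n <= be n.
  rewrite /al addn1 /be; apply: (@le_trans _ _ 1); last by rewrite ler1n.
  by rewrite invf_le1 ?ltr0n // ler1n.
have nal : nonincreasing_seq al by exact: inv_seq_noninc.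
have nbe : nondecreasing_seq be by move=> m n mn; rewrite ler_nat.
have decF' y z : 0 < y -> y <= z -> F z <= F y.
  by move=> y0; rewrite le_eqVlt => /orP[/eqP-> //|yz]; apply/ltW/decF.
have F1E (y : R) : 0 < y -> derive1 F y = - g y.
  by move=> y0; rewrite derive1E; have [_ ->] := dF y y0.
have cF1 (y : R) : 0 < y -> {for y, continuous (derive1 F)}.
  by move=> y0; apply: (near_gt0_eq y0 F1E); apply: continuousN; exact: cg.
have cF (y : R) : 0 < y -> {for y, continuous F}.
  move=> y0; apply: differentiable_continuous; apply/derivable1_diffP.
  by have [] := dF y y0.
have step n : (\int[mu]_(x in `[F (be n), F (al n)]) (G x)%:E =
    \int[mu]_(y in `[al n, be n]) (G (F y) * g y)%:E)%E.
  have pos y : al n <= y -> 0 < y by apply: lt_le_trans.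
  rewrite integration_by_substitution_decreasing //.
  - apply: eq_integral => y; rewrite inE /= in_itv /= => /andP[/pos y0 _].
    by rewrite !fctE F1E // opprK.
  - move=> y z; rewrite !in_itv /= => _ /andP[/pos z0 _] yz.
    exact: decF.
  - move=> y; rewrite in_itv /= => /andP[/ltW/pos y0 _]; exact: cF1.
  - by apply/cvg_ex; exists (derive1 F (al n)); apply: cvg_at_right_filter; exact: cF1.
  - by apply/cvg_ex; exists (derive1 F (be n)); apply: cvg_at_left_filter; exact: cF1.
  - split.
    + move=> y; rewrite in_itv /= => /andP[/ltW/pos y0 _].
      by have [] := dF y y0.
    + by apply: cvg_at_right_filter; exact: cF.
    + by apply: cvg_at_left_filter; exact: cF.
  - apply: continuous_in_subspaceT => x; rewrite inE /= in_itv /= => /andP[x1 x2].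
    apply: cG; have /andP[h1 _] := F01 _ (be0 n); have /andP[_ h2] := F01 _ (al0 n).
    by rewrite (lt_le_trans h1 x1) (le_lt_trans x2 h2).
have l1 : ((\int[mu]_(x in `[F (be n), F (al n)]) (G x)%:E) @[n --> \oo] -->
    \int[mu]_(x in `]0%R, 1%R[) (G x)%:E)%E.
  apply: cvg_integral_exhaust.
  - by move=> m n mn; apply: decF' => //; exact: nbe.
  - by move=> m n mn; apply: decF' => //; exact: nal.
  - move=> x; rewrite /= in_itv /=; split.
      move=> /andP[x0 x1].
      have [y [y0 yx]] := F0 x x0; have [z [z0 zx]] := F1 x x1.
      have [n1 h1] := nat_seq_large y; have [n2 h2] := inv_seq_small 0 z0.
      exists (maxn n1 n2); apply/andP; split.
        apply: le_trans yx; apply: decF' => //; apply: le_trans h1 _.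
        by apply: (nbe n1); rewrite leq_maxl.
      apply: (le_trans zx); apply: decF' => //; apply: le_trans h2.
      by apply: (nal n2); rewrite leq_maxr.
    move=> [n /andP[h1 h2]].
    have /andP[h3 _] := F01 _ (be0 n); have /andP[_ h4] := F01 _ (al0 n).
    by rewrite (lt_le_trans h3 h1) (le_lt_trans h2 h4).
  - exact: measurable_itv.
  - apply: open_continuous_measurable_fun; first exact: interval_open.
    by move=> x; rewrite inE /= in_itv /=; exact: cG.
  - by move=> x; rewrite /= in_itv /=; exact: G0.
have l2 : ((\int[mu]_(y in `[al n, be n]) (G (F y) * g y)%:E) @[n --> \oo] -->
    \int[mu]_(y in `]0%R, +oo[) (G (F y) * g y)%:E)%E.
  apply: cvg_integral_exhaust => //.
  - move=> x; rewrite /= in_itv /= andbT; split.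
      move=> x0; have [n1 h1] := nat_seq_large x; have [n2 h2] := inv_seq_small 0 x0.
      exists (maxn n1 n2); apply/andP; split.
        by apply: le_trans h2; apply: (nal n2); rewrite leq_maxr.
      by apply: le_trans h1 _; apply: (nbe n1); rewrite leq_maxl.
    by move=> [n /andP[h1 _]]; apply: lt_le_trans h1.
  - apply: open_continuous_measurable_fun; first exact: interval_open.
    move=> x; rewrite inE /= in_itv /= andbT => x0.
    apply: continuousM; last exact: cg.
    apply: continuous_comp; first exact: cF.
    by apply: cG; exact: F01.
  - move=> x; rewrite /= in_itv /= andbT => x0; rewrite mulr_ge0 ?g0 // G0 //.
    exact: F01.
rewrite -(cvg_lim _ l1) // -(cvg_lim _ l2) //.
by congr (limn _); apply/funext => n; exact: step.
Qed.
End ImproperIntegrals.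

(** * Moments of the beta integral *)

Section BetaMoments.
Variables (R : realType) (r : R).
Hypothesis r01 : 0 < r < 1.
Local Notation mu := (@lebesgue_measure R).

(** The density of the beta integral B(s, 1 - r). *)
Definition beta_density (s x : R) : R := x `^ (s - 1) * (1 - x) `^ (- r).

Let r0 : 0 < r. Proof. by case/andP: r01. Qed.
Let r1 : r < 1. Proof. by case/andP: r01. Qed.

Lemma is_derive_powR_onem (s x : R) : x < 1 ->
  is_derive x (1 : R) (fun x : R => (1 - x) `^ s) (- (s * (1 - x) `^ (s - 1))).
Proof.
move=> x1; have x1' : 0 < 1 - x by rewrite subr_gt0.
have h : is_derive x (1 : R) (fun x : R => 1 - x) (0 - 1).
  by apply: is_deriveB.
have h2 := is_derive1_powR s x1'.
apply: (is_derive_eq (@is_derive1_comp _ (fun y : R => y `^ s) (fun x : R => 1 - x) x _ _ h2 h)).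
by rewrite sub0r mulrN1.
Qed.

Lemma continuous_powR_pos (s x : R) : 0 < x -> {for x, continuous (fun x : R => x `^ s)}.
Proof.
move=> x0; apply: differentiable_continuous; apply/derivable1_diffP.
by have [] := is_derive1_powR s x0.
Qed.

Lemma continuous_powR_onem (s x : R) : x < 1 -> {for x, continuous (fun x : R => (1 - x) `^ s)}.
Proof.
move=> x1; apply: differentiable_continuous; apply/derivable1_diffP.
by have [] := is_derive_powR_onem s x1.
Qed.

Lemma continuous_beta_density (s x : R) : 0 < x < 1 -> {for x, continuous (beta_density s)}.
Proof.
move=> /andP[x0 x1]; apply: continuousM; first exact: continuous_powR_pos.
exact: continuous_powR_onem.
Qed.

Lemma beta_density_ge0 (s x : R) : 0 <= beta_density s x.
Proof. by rewrite mulr_ge0 ?powR_ge0. Qed.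

(* The segments [al n, be n] exhaust the unit interval; the shift by 3 keeps
   them inside it and of positive length. *)
Let al (n : nat) : R := (n + 3)%:R^-1.
Let be (n : nat) : R := 1 - al n.

Let al_itv n : 0 < al n < 1 / 2.
Proof.
have n0 : 0 < (n + 3)%:R :> R by rewrite ltr0n addnS.
by rewrite invr_gt0 n0 /= mul1r ltf_pV2 ?posrE // ltr_nat; lia.
Qed.

Let albe n : al n < be n.
Proof. by have /andP[h1 h2] := al_itv n; rewrite /be; lra. Qed.

Let al_cvg : al @ \oo --> (0 : R).
Proof.
apply/cvgrPdist_lt => e e0.
have [N h] := @inv_seq_small R 2 _ (divr_gt0 e0 (ltr0n R 2)).
exists N => // n /= Nn; rewrite sub0r normrN gtr0_norm; last by case/andP: (al_itv n).
apply: (@le_lt_trans _ _ (e / 2)); last by lra.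
by apply: le_trans h; apply: (@inv_seq_noninc R 2).
Qed.

Let I_exhaust (f : R -> R) : (forall x : R, 0 < x < 1 -> {for x, continuous f}) ->
  (forall x : R, 0 < x < 1 -> 0 <= f x) ->
  ((\int[mu]_(x in `[al n, be n]) (f x)%:E) @[n --> \oo] -->
   \int[mu]_(x in `]0%R, 1%R[) (f x)%:E)%E.
Proof.
move=> cf f0; have nal : nonincreasing_seq al by exact: (@inv_seq_noninc R 2).
apply: cvg_integral_exhaust => //.
- by move=> m n mn; rewrite lerB // nal.
- move=> x; rewrite /= in_itv /=; split.
    move=> /andP[x0 x1]; have x1' : 0 < 1 - x by rewrite subr_gt0.
    have [n1 h1] := @inv_seq_small R 2 _ x0; have [n2 h2] := @inv_seq_small R 2 _ x1'.
    exists (maxn n1 n2); apply/andP; split.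
      by apply: le_trans h1; apply: (nal n1); rewrite leq_maxl.
    have h3 : al (maxn n1 n2) <= 1 - x.
      by apply: le_trans h2; apply: (nal n2); rewrite leq_maxr.
    by move: h3; rewrite /be; lra.
  move=> [n /andP[h1 h2]]; have /andP[h3 _] := al_itv n.
  by move: h1 h2; rewrite /be; lra.
- apply: open_continuous_measurable_fun; first exact: interval_open.
  by move=> x; rewrite inE /= in_itv /=; exact: cf.
Qed.

Let within_I (n : nat) (f : R -> R) : (forall x : R, 0 < x < 1 -> {for x, continuous f}) ->
  {within `[al n, be n], continuous f}.
Proof.
move=> cf; apply: continuous_in_subspaceT => x; rewrite inE /= in_itv /= => /andP[h1 h2].
have /andP[h3 _] := al_itv n; apply: cf.
by move: h1 h2; rewrite /be; lra.
Qed.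

Let integrable_I (n : nat) (f : R -> R) : (forall x : R, 0 < x < 1 -> {for x, continuous f}) ->
  mu.-integrable `[al n, be n] (EFin \o f).
Proof.
by move=> cf; apply: continuous_compact_integrable; [exact: segment_compact|exact: within_I].
Qed.

Let ftc_I (n : nat) (f G : R -> R) : (forall x : R, 0 < x < 1 -> {for x, continuous f}) ->
  (forall x : R, 0 < x < 1 -> is_derive x (1 : R) G (f x)) ->
  \int[mu]_(x in `[al n, be n]) f x = G (be n) - G (al n).
Proof.
move=> cf dG; have /andP[h3 h4] := al_itv n.
have cG (x : R) : 0 < x < 1 -> {for x, continuous G}.
  move=> x01; apply: differentiable_continuous; apply/derivable1_diffP.
  by have [] := dG x x01.
rewrite /Rintegral (@continuous_FTC2 R f G _ _ (albe n) (within_I cf)) //.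
- split.
  + move=> x; rewrite in_itv /= => /andP[h1 h2].
    have x01 : 0 < x < 1 by move: h1 h2; rewrite /be; lra.
    by have [] := dG x x01.
  + by apply: cvg_at_right_filter; apply: cG; lra.
  + by apply: cvg_at_left_filter; apply: cG; rewrite /be; lra.
- move=> x; rewrite in_itv /= => /andP[h1 h2].
  have x01 : 0 < x < 1 by move: h1 h2; rewrite /be; lra.
  by rewrite derive1E; have [_ ->] := dG x x01.
Qed.

Definition beta_moment (s : R) : \bar R := (\int[mu]_(x in `]0%R, 1%R[) (beta_density s x)%:E)%E.

Lemma beta_moment_ge0 s : (0 <= beta_moment s)%E.
Proof. by apply: integral_ge0 => x _; rewrite lee_fin beta_density_ge0. Qed.

Let m (n : nat) (s : R) : R := \int[mu]_(x in `[al n, be n]) beta_density s x.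

Let mE n s : (m n s)%:E = (\int[mu]_(x in `[al n, be n]) (beta_density s x)%:E)%E.
Proof.
rewrite /m /Rintegral fineK //; apply: integrable_fin_num; first exact: measurable_itv.
by apply: integrable_I; exact: continuous_beta_density.
Qed.

Let powR_inv_le2 (x s : R) : 1 / 2 <= x < 1 -> 0 < s < 1 -> x `^ (- s) <= 2.
Proof.
move=> /andP[x0 x1] /andP[s0 s1]; have x0' : 0 < x by lra.
have h : x <= x `^ s by apply: ger1_powR; rewrite ?x0' ?(ltW x1) ?(ltW s1).
have p0 : 0 < x `^ s by apply: lt_le_trans h.
rewrite powRN -[leRHS]invrK lef_pV2 ?posrE ?invr_gt0 //.
by apply: le_trans h; rewrite -[_^-1]mul1r.
Qed.

Let beta_density_le (s x : R) : r <= s -> 0 < x < 1 ->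
  beta_density s x <= 2 * x `^ (r - 1) + 2 * (1 - x) `^ (- r).
Proof.
move=> rs /andP[x0 x1].
have h1 : x `^ (s - 1) <= x `^ (r - 1).
  by apply: ger_powR; rewrite ?x0 ?(ltW x1) // lerB.
have p1 := powR_ge0 x (r - 1); have p2 := powR_ge0 (1 - x) (- r).
apply: (@le_trans _ _ (x `^ (r - 1) * (1 - x) `^ (- r))).
  exact: ler_wpM2r.
have [xh|xh] := lerP x (1 / 2).
  have h2 : (1 - x) `^ (- r) <= 2 by apply: powR_inv_le2 => //; lra.
  by move: p1 p2 h2; move: (x `^ _) (_ `^ (- r)) => a b; nra.
have h2 : x `^ (r - 1) <= 2.
  by rewrite -opprB; apply: powR_inv_le2; move: r01 => /andP[? ?]; lra.
by move: p1 p2 h2; move: (x `^ _) (_ `^ (- r)) => a b; nra.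
Qed.

(* A primitive of the bound in [beta_density_le] is bounded on the unit
   interval, uniformly in n. *)
Let m_le n s : r <= s -> m n s <= 2 / r + 2 / (1 - r).
Proof.
move=> rs.
have cm (x : R) : 0 < x < 1 ->
    {for x, continuous (fun x : R => 2 * x `^ (r - 1) + 2 * (1 - x) `^ (- r))}.
  move=> /andP[x0 x1]; apply: continuousD; apply: continuousM; try exact: cst_continuous.
    exact: continuous_powR_pos.
  exact: continuous_powR_onem.
have nr : 1 - r != 0 by rewrite subr_eq0 gt_eqF.
have nr0 : r != 0 by rewrite gt_eqF.
pose H (x : R) : R := 2 / r * x `^ r - 2 / (1 - r) * (1 - x) `^ (1 - r).
have dH (x : R) : 0 < x < 1 ->
    is_derive x (1 : R) H (2 * x `^ (r - 1) + 2 * (1 - x) `^ (- r)).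
  move=> /andP[x0 x1].
  have h1 := is_deriveZ (2 / r) (is_derive1_powR r x0).
  have h2 := is_deriveZ (2 / (1 - r)) (is_derive_powR_onem (1 - r) x1).
  apply: (is_derive_eq (is_deriveB h1 h2)); rewrite /GRing.scale /=.
  rewrite (_ : 1 - r - 1 = - r); last by ring.
  by field; rewrite nr nr0.
apply: (@le_trans _ _ (H (be n) - H (al n))).
  rewrite -(ftc_I n cm dH); apply: le_Rintegral => //.
  - by apply: integrable_I; exact: continuous_beta_density.
  - exact: integrable_I.
  - move=> x; rewrite /= in_itv /= => /andP[h1 h2]; apply: beta_density_le => //.
    by have /andP[h3 _] := al_itv n; move: h1 h2; rewrite /be; lra.
have /andP[a0 a2] := al_itv n.
have pw (x s' : R) : 0 < x < 1 -> 0 < s' -> 0 <= x `^ s' <= 1.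
  move=> /andP[x0 x1] s0; rewrite powR_ge0 /= -(powRr0 x).
  by apply: ger_powR; rewrite ?x0 ?(ltW x1) // ltW.
have b01 : 0 < be n < 1 by rewrite /be; lra.
have a01 : 0 < al n < 1 by lra.
have b01' : 0 < 1 - be n < 1 by rewrite /be; lra.
have a01' : 0 < 1 - al n < 1 by lra.
have r1' : 0 < 1 - r by rewrite subr_gt0.
have := pw _ _ b01 r0; have := pw _ _ a01 r0; have := pw _ _ b01' r1'; have := pw _ _ a01' r1'.
rewrite /H; have : 0 < 2 / r by rewrite divr_gt0.
have : 0 < 2 / (1 - r) by rewrite divr_gt0.
move: (2 / r) (2 / (1 - r)) (_ `^ _) (_ `^ _) (_ `^ _) (_ `^ _) => c d x y z t.
by move=> c0 d0 /andP[x0 x1] /andP[y0 y1] /andP[z0 z1] /andP[t0 t1]; nra.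
Qed.

Let m_cvg s : ((m n s)%:E @[n --> \oo] --> beta_moment s)%E.
Proof.
under eq_fun do rewrite mE.
apply: I_exhaust; first exact: continuous_beta_density.
by move=> x _; exact: beta_density_ge0.
Qed.

Lemma beta_moment_fin (s : R) : r <= s -> beta_moment s \is a fin_num.
Proof.
move=> rs; rewrite ge0_fin_numE ?beta_moment_ge0 //.
apply: (@le_lt_trans _ _ ((2 / r + 2 / (1 - r))%:E)); last by rewrite ltry.
rewrite -(cvg_lim _ (@m_cvg s)) //.
apply: lime_le; first by apply/cvg_ex; exists (beta_moment s); exact: m_cvg.
by apply: nearW => n; rewrite lee_fin m_le.
Qed.

Let m_cvgR s : r <= s -> m ^~ s @ \oo --> fine (beta_moment s).
Proof.
move=> rs; have h := @m_cvg s; rewrite -(fineK (beta_moment_fin rs)) in h.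
exact: (fine_cvg h).
Qed.

(** Integration of the derivative of x^s (1 - x)^(1 - r), which vanishes at
    both ends. *)
Lemma beta_moment_step (s : R) : r <= s ->
  s * fine (beta_moment s) = (s + 1 - r) * fine (beta_moment (s + 1)).
Proof.
move=> rs; have s0 : 0 < s by apply: lt_le_trans rs.
have rs1 : r <= s + 1 by rewrite (le_trans rs) // lerDl.
pose H (x : R) : R := x `^ s * (1 - x) `^ (1 - r).
pose h (x : R) : R := s * beta_density s x - (s + 1 - r) * beta_density (s + 1) x.
have ch (x : R) : 0 < x < 1 -> {for x, continuous h}.
  move=> x01; apply: continuousB; apply: continuousM; try exact: cst_continuous.
    exact: continuous_beta_density.
  exact: continuous_beta_density.
have dH (x : R) : 0 < x < 1 -> is_derive x (1 : R) H (h x).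
  move=> /andP[x0 x1]; have x1' : 0 < 1 - x by rewrite subr_gt0.
  have d := is_deriveM (is_derive1_powR s x0) (is_derive_powR_onem (1 - r) x1).
  apply: (is_derive_eq d); rewrite /GRing.scale /= /h /beta_density.
  rewrite (_ : 1 - r - 1 = - r); last by ring.
  rewrite (_ : s + 1 - 1 = s); last by ring.
  have -> : x `^ s = x * x `^ (s - 1) by rewrite mulr_powRB1 // ltW.
  have -> : (1 - x) `^ (1 - r) = (1 - x) * (1 - x) `^ (- r).
    rewrite -[- r in RHS](_ : 1 - r - 1 = - r); last by ring.
    by rewrite mulr_powRB1 ?subr_gt0 // ltW.
  by move: (x `^ _) (_ `^ (- r)) => a b; ring.
have E n : s * m n s - (s + 1 - r) * m n (s + 1) = H (be n) - H (al n).
  rewrite -(ftc_I n ch dH) RintegralB //; last 2 first.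
  - apply: (@integrable_I n (fun x : R => s * beta_density s x)) => x x01.
    by apply: continuousM; [exact: cst_continuous|exact: continuous_beta_density].
  - apply: (@integrable_I n (fun x : R => (s + 1 - r) * beta_density (s + 1) x)) => x x01.
    by apply: continuousM; [exact: cst_continuous|exact: continuous_beta_density].
  by rewrite !RintegralZl //; apply: integrable_I; exact: continuous_beta_density.
have l1 : (fun n => s * m n s - (s + 1 - r) * m n (s + 1)) @ \oo -->
    s * fine (beta_moment s) - (s + 1 - r) * fine (beta_moment (s + 1)).
  by apply: cvgB; apply: cvgM; try exact: cvg_cst; apply: m_cvgR.
have alP : al @ \oo --> (0 : R)^'+.
  move=> A [e /= e0 hA].
  have [N _ HN] := (cvgrPdist_lt _ _).1 al_cvg e e0.
  exists N => // n /= Nn; apply: hA; last by have /andP[] := al_itv n.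
  exact: HN.
have r1' : 0 < 1 - r by rewrite subr_gt0.
have p1 : (fun n => al n `^ s) @ \oo --> (0 : R).
  by apply: (cvg_comp al (fun x : R => x `^ s)) alP _; exact: powR_cvg0.
have p2 : (fun n => al n `^ (1 - r)) @ \oo --> (0 : R).
  by apply: (cvg_comp al (fun x : R => x `^ (1 - r))) alP _; exact: powR_cvg0.
have pw (x s' : R) : 0 < x < 1 -> 0 < s' -> 0 <= x `^ s' <= 1.
  move=> /andP[x0 x1] s0'; rewrite powR_ge0 /= -(powRr0 x).
  by apply: ger_powR; rewrite ?x0 ?(ltW x1) // ltW.
have l2 : (fun n => H (be n) - H (al n)) @ \oo --> (0 - 0 : R).
  apply: cvgB.
    apply: (@squeeze_cvgr _ _ _ _ (fun=> 0) (fun n => al n `^ (1 - r))) => //; last exact: cvg_cst.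
    apply: nearW => n; have /andP[a0 a2] := al_itv n.
    rewrite /H (_ : 1 - be n = al n); last by rewrite /be; ring.
    have b01 : 0 < be n < 1 by rewrite /be; lra.
    have /andP[q1 q2] := pw _ _ b01 s0.
    by rewrite mulr_ge0 ?powR_ge0 //= ler_piMl ?powR_ge0.
  apply: (@squeeze_cvgr _ _ _ _ (fun=> 0) (fun n => al n `^ s)) => //; last exact: cvg_cst.
  apply: nearW => n; have /andP[a0 a2] := al_itv n.
  have a01 : 0 < 1 - al n < 1 by lra.
  have /andP[q1 q2] := pw _ _ a01 r1'.
  by rewrite /H mulr_ge0 ?powR_ge0 //= ler_piMr ?powR_ge0.
apply/eqP; rewrite -subr_eq0 -(cvg_lim _ l1) //.
by rewrite (funext E) (cvg_lim _ l2) // subr0.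
Qed.
End BetaMoments.

(** * The beta integral of the hypergeometric function *)

Section HypergeometricIntegral.
Variables (R : realType) (r : R).
Hypothesis r01 : 0 < r < 1.
Local Notation mu := (@lebesgue_measure R).

Let r0 : 0 < r. Proof. by case/andP: r01. Qed.
Let r1 : r < 1. Proof. by case/andP: r01. Qed.

Definition hypterm (k : nat) : R := hcoef R k * (pochhammer r k / k`!%:R).

Let t_gt0 k : 0 < hypterm k.
Proof.
by rewrite mulr_gt0 ?hcoef_gt0 // divr_gt0 ?pochhammer_gt0.
Qed.

Let tS k : k.+1%:R ^+ 3 * hypterm k.+1 =
  (k%:R + 1 / 3) * (k%:R + 2 / 3) * (k%:R + r) * hypterm k.
Proof.
rewrite /hypterm pochhammerS factS natrM.
transitivity (k.+1%:R ^+ 2 * hcoef R k.+1 * (pochhammer r k / k`!%:R * (r + k%:R))).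
  have := fact_neq0 R k; have : k.+1%:R != 0 :> R by rewrite pnatr_eq0.
  move: (hcoef R k.+1) (pochhammer _ _) (k`!%:R) (k.+1%:R) (k%:R) => x y z m n m0 z0.
  by field; rewrite m0 z0.
by rewrite hcoefS; ring.
Qed.

(** Raabe's test: with t_k the terms of the 3F2 series, (1 - r) / 2 t_k is
    eventually at most the decrement of k t_k, and these decrements have
    bounded sums. *)
Lemma is_cvg_hypterm : cvgn (series hypterm).
Proof.
have [K hK] : exists K : nat, 4 <= (1 - r) * K%:R /\ 1 <= K%:R :> R.
  have [n hn] := nat_seq_large (4 / (1 - r)).
  exists n.+1; rewrite ler1n; split=> //.
  by rewrite mulrC -ler_pdivrMr // subr_gt0.
have {hK} [hK hK1] := hK.
(* From K on, the leading term (1 - r) k^2 / 2 of the difference exceeds the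
   terms of lower order. *)
have dec k : (K <= k)%N -> (1 - r) / 2 * hypterm k <= k%:R * hypterm k - k.+1%:R * hypterm k.+1.
  move=> Kk; have tk := t_gt0 k; have e := tS k.
  have k1 : 0 < k.+1%:R ^+ 2 :> R by rewrite exprn_gt0.
  rewrite -(ler_pM2l k1) mulrBr [X in _ <= _ - X]mulrA -exprSr e.
  have hk : 4 <= (1 - r) * k%:R.
    apply: le_trans hK _; rewrite ler_wpM2l ?subr_ge0 ?(ltW r1) // ler_nat.
    exact: Kk.
  have hk1 : 1 <= k%:R :> R by rewrite (le_trans hK1) // ler_nat.
  rewrite -(natr1 k) [_ * ((1 - r) / 2 * _)]mulrA [_ * (k%:R * _)]mulrA -mulrBl.
  rewrite ler_pM2r //; move: r0 r1 hk hk1; move: (k%:R) => n h0 h1 hk hk1.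
  have : 0 <= (n * ((1 - r) * n - 4)) by rewrite mulr_ge0; lra.
  by nra.
have d0 : 0 < (1 - r) / 2 by rewrite divr_gt0 // subr_gt0.
have bnd n : (1 - r) / 2 * \sum_(K <= k < K + n) hypterm k <= K%:R * hypterm K - (K + n)%:R * hypterm (K + n).
  elim: n => [|n IH]; first by rewrite addn0 big_geq // mulr0 subrr.
  rewrite addnS big_nat_recr ?leq_addr //= mulrDr.
  have h := dec (K + n)%N (leq_addr _ _).
  by move: IH h; move: (\sum_(_ <= _ < _) _) => S; lra.
apply: nondecreasing_is_cvgn.
  by apply/nondecreasing_seqP => n; rewrite /series /= big_nat_recr //= lerDl ltW.
exists (\sum_(0 <= k < K) hypterm k + K%:R * hypterm K / ((1 - r) / 2)) => _ [n _ <-].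
have ndS : nondecreasing_seq (series hypterm).
  by apply/nondecreasing_seqP => j; rewrite /series /= big_nat_recr //= lerDl ltW.
apply: (le_trans (ndS n (K + n)%N (leq_addl _ _))).
rewrite /series /= (big_cat_nat (n := K)) ?leq_addr //= lerD2l.
rewrite ler_pdivlMr // mulrC; apply: le_trans (bnd n) _.
by rewrite gerBl mulr_ge0 // ltW.
Qed.

Let B : R := fine (beta_moment r r).

Lemma beta_momentE k : beta_moment r (r + k%:R) = (pochhammer r k / k`!%:R * B)%:E.
Proof.
have rk : r <= r + k%:R by rewrite lerDl.
rewrite -(fineK (beta_moment_fin r01 rk)); congr (_%:E).
elim: k {rk} => [|k IH].
  by rewrite addr0 /pochhammer big_geq // fact0 divr1 mul1r.
have rk : r <= r + k%:R by rewrite lerDl.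
have := beta_moment_step r01 rk.
rewrite IH (_ : r + k%:R + 1 = r + k.+1%:R); last by rewrite -addrA natr1.
have -> : r + k.+1%:R - r = k.+1%:R by ring.
rewrite pochhammerS factS natrM => e.
have k0 : k.+1%:R != 0 :> R by rewrite pnatr_eq0.
apply: (mulfI k0); rewrite -e; have := fact_neq0 R k.
by move: (k.+1%:R) k0 (k`!%:R) => m m0 z z0; field; rewrite m0 z0.
Qed.

(** Euler's integral for 3F2, by termwise integration: the k-th moment of the
    beta density supplies the factor (r)_k / k!. *)
Lemma integral_hypergeometric :
  (\int[mu]_(x in `]0%R, 1%R[) (beta_density r r x * psum (hcoef R) x)%:E =
   (B * limn (series hypterm))%:E)%E.
Proof.
pose f (k : nat) (x : R) : R := hcoef R k * beta_density r (r + k%:R) x.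
have mf k : measurable_fun (`]0%R, 1%R[%classic : set R) (f k).
  apply: open_continuous_measurable_fun; first exact: interval_open.
  move=> x; rewrite inE /= in_itv /= => x01.
  apply: (@continuousM R _ (fun=> hcoef R k) (beta_density r (r + k%:R))).
    exact: cst_continuous.
  exact: continuous_beta_density.
have f0 k x : 0 <= f k x.
  by rewrite mulr_ge0 ?beta_density_ge0 // ltW // hcoef_gt0.
have E x : 0 < x < 1 -> ((beta_density r r x * psum (hcoef R) x)%:E =
    \sum_(k <oo) (f k x)%:E)%E.
  move=> /andP[x0 x1].
  have c : pseries (hcoef R) x @ \oo --> psum (hcoef R) x.
    by apply: cvg_unit_hcoef; rewrite x1 ltW.
  have c2 : series (f ^~ x) @ \oo --> beta_density r r x * psum (hcoef R) x.
    have h : (fun N => beta_density r r x * pseries (hcoef R) x N) @ \oo -->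
        beta_density r r x * psum (hcoef R) x by apply: cvgM => //; exact: cvg_cst.
    apply: (eq_cvgn h) => N; rewrite /pseries /series /= mulr_sumr.
    apply: eq_bigr => k _; rewrite /f /beta_density.
    have -> : x `^ (r + k%:R - 1) = x `^ (r - 1) * x ^+ k.
      have e : r + k%:R - 1 = (r - 1) + k%:R by ring.
      have nx : (r - 1 + k%:R == 0) ==> (x != 0) by rewrite (gt_eqF x0) implybT.
      by rewrite e (powRD nx) powR_mulrn // ltW.
    by move: (hcoef R k) => z; ring.
  rewrite -(cvg_lim _ c2) // -EFin_lim; last by apply/cvg_ex; eexists; exact: c2.
  by congr (limn _); apply/funext => N /=; rewrite /series /= sumEFin.
transitivity (\int[mu]_(x in `]0%R, 1%R[) (\sum_(k <oo) (f k x)%:E))%E.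
  by apply: eq_integral => x; rewrite inE /= in_itv /=; exact: E.
rewrite integral_nneseries //; last 2 first.
- by move=> k; apply/measurable_EFinP; exact: mf.
- by move=> k x _; rewrite lee_fin.
have Ek k : (\int[mu]_(x in `]0%R, 1%R[) (f k x)%:E)%E = (B * hypterm k)%:E.
  under eq_integral do rewrite EFinM.
  rewrite ge0_integralZl_EFin //; last 3 first.
  - by move=> x _; rewrite lee_fin beta_density_ge0.
  - apply/measurable_EFinP; apply: open_continuous_measurable_fun; first exact: interval_open.
    by move=> x; rewrite inE /= in_itv /= => x01; exact: continuous_beta_density.
  - by rewrite ltW // hcoef_gt0.
  rewrite -/(beta_moment r (r + k%:R)) beta_momentE -EFinM; congr (_%:E).
  by rewrite /hypterm; move: (hcoef R k) => z; ring.
under eq_eseriesr do rewrite Ek.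
have c : series (fun k => B * hypterm k) @ \oo --> B * limn (series hypterm).
  have h : (fun N => B * series hypterm N) @ \oo --> B * limn (series hypterm).
    by apply: cvgM; [exact: cvg_cst|exact: is_cvg_hypterm].
  by apply: (eq_cvgn h) => N; rewrite /series /= mulr_sumr.
rewrite -(cvg_lim _ c) // -EFin_lim; last by apply/cvg_ex; eexists; exact: c.
by congr (limn _); apply/funext => N /=; rewrite /series /= sumEFin.
Qed.
End HypergeometricIntegral.

(** * The period integral *)

(** The quotient E(q^3) / E(q) is the product of the 1 + q^n + q^(2 n), hence
    at least 1 plus the sum of the q^n. *)
Lemma euler_cube_ge (R : realType) (q : R) (N : nat) : 0 < q < 1 ->
  (1 + N%:R * q ^+ N) * euler q <= euler (q ^+ 3).
Proof.
move=> q01; have /andP[q0 q1] := q01.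
have q01' : 0 <= q < 1 by rewrite q1 ltW.
have q301 : 0 <= q ^+ 3 < 1 by rewrite exprn_ge0 ?exprn_ilt1 // ltW.
have h1 := cvg_euler q01'; have h3 := cvg_euler q301.
pose P M := \prod_(0 <= n < M) (1 + q ^+ n.+1 + q ^+ n.+1 ^+ 2).
have y0 n : 0 < q ^+ n by rewrite exprn_gt0.
have P1 M : 1 + \sum_(0 <= n < M) q ^+ n.+1 <= P M.
  elim: M => [|M IH]; first by rewrite /P !big_geq // addr0.
  rewrite /P !big_nat_recr //= -/(P M).
  have S0 : 0 <= \sum_(0 <= n < M) q ^+ n.+1 by rewrite sumr_ge0 // => n _; rewrite ltW.
  move: IH S0 (y0 M.+1); move: (\sum_(_ <= _ < _) _) (P M) (q ^+ M.+1) => S p y; nra.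
have PN M : (N <= M)%N -> 1 + N%:R * q ^+ N <= P M.
  move=> NM; apply: le_trans (P1 M); rewrite lerD2l.
  apply: (@le_trans _ _ (\sum_(0 <= n < N) q ^+ n.+1)).
    rewrite mulr_natl -[X in _ *+ X]subn0 -sumr_const_nat !big_nat.
    by apply: ler_sum => n /andP[_ nN]; apply: ler_wiXn2l => //; exact: ltW.
  rewrite [leRHS](big_cat_nat (n := N)) //= lerDl sumr_ge0 // => n _.
  by rewrite ltW.
have lim1 : (fun M => (1 + N%:R * q ^+ N) * \prod_(0 <= n < M) (1 - q ^+ n.+1)) @ \oo -->
    (1 + N%:R * q ^+ N) * euler q by apply: cvgM => //; exact: cvg_cst.
rewrite -(cvg_lim _ lim1) // -(cvg_lim _ h3) //.
apply: ler_lim; [by apply/cvg_ex; eexists; exact: lim1|by apply/cvg_ex; eexists; exact: h3|].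
exists N => // M /= NM.
rewrite (_ : \prod_(0 <= n < M) (1 - (q ^+ 3) ^+ n.+1) = P M * \prod_(0 <= n < M) (1 - q ^+ n.+1)).
  apply: ler_wpM2r; last exact: PN.
  by apply: prodr_ge0 => n _; rewrite subr_ge0 exprn_ile1 // ltW.
rewrite /P -big_split /=; apply: eq_bigr => n _.
by rewrite [(q ^+ 3) ^+ _]exprAC; move: (q ^+ n.+1) => y; ring.
Qed.

(** At q = t^3 the quotient b(q) / C(t) is (E(q) / E(q^3))^4 / (3 t), which is
    small near q = 1 by [euler_cube_ge]; hence so is b(q) / a(q). *)
Lemma cubic_x_large (R : realType) (e : R) : e < 1 -> exists q : R, 0 < q < 1 /\ e <= cubic_x q.
Proof.
move=> e1; have [e0|e0] := ltP e 0.
  have h : 0 < (1 / 2 : R) < 1 by lra.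
  exists (1 / 2); split => //; have /andP[x0 _] := cubic_x_itv h.
  by apply/ltW; apply: lt_trans x0.
have e1' : 0 < 1 - e by rewrite subr_gt0.
have [n hn] := nat_seq_large (2 / (1 - e)).
(* This t is close enough to 1 for q^N = t^(3 N) to be at least 1 / 2, by
   Bernoulli's inequality. *)
pose N := n.+1; pose t : R := 1 - (6 * N%:R)^-1.
have N0 : 0 < N%:R :> R by rewrite ltr0n.
have N1 : 1 <= N%:R :> R by rewrite ler1n.
have h0 : 0 < (6 * N%:R)^-1 :> R by rewrite invr_gt0 mulr_gt0.
have h1 : (6 * N%:R)^-1 <= 1 / 6 :> R.
  by rewrite -[leRHS]invrK lef_pV2 ?posrE ?invr_gt0 ?mulr_gt0 // invf_div divr1 ler_peMr.
have t01 : 0 < t < 1 by rewrite /t; lra.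
have q01 := expr01 2 t01; have q301 := expr01 8 t01.
exists (t ^+ 3); split => //.
have bern m : 1 - m%:R * (6 * N%:R)^-1 <= t ^+ m.
  elim: m => [|m IH]; first by rewrite mul0r subr0 expr0.
  have /andP[t0 t1] := t01.
  rewrite exprS; apply: le_trans (ler_wpM2l (ltW t0) IH).
  rewrite -(natr1 m) /t; have : 0 <= m%:R :> R by [].
  by move: ((6 * N%:R)^-1) h0 (m%:R) => h h0' k k0; nra.
have tN : 1 / 2 <= t ^+ (3 * N).
  apply: le_trans (bern (3 * N)%N); rewrite natrM.
  by rewrite (_ : _ * _ / _ = 1 / 2); [lra|field; rewrite gt_eqF].
have t13 : 1 / 3 <= t by rewrite /t; lra.
have e3 : 0 < euler (t ^+ 3) by apply: euler_gt0; have /andP[/ltW -> ->] := q01.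
have e9 : 0 < euler (t ^+ 9) by apply: euler_gt0; have /andP[/ltW -> ->] := q301.
have rho := euler_cube_ge N q01; rewrite -!exprM in rho.
have rho2 : (1 - e)^-1 * euler (t ^+ 3) <= euler (t ^+ 9).
  apply: le_trans rho; rewrite ler_wpM2r ?(ltW e3) //.
  have h : (1 - e)^-1 <= N%:R / 2.
    by rewrite ler_pdivlMr // mulrC; exact: hn.
  apply: le_trans h _.
  have : N%:R * (1 / 2) <= N%:R * t ^+ (3 * N) by rewrite ler_wpM2l // ltW.
  by rewrite /N; move: (t ^+ _) (n.+1%:R) => z k; lra.
have C0 := cubic_C_gt0 t01; have b0 := cubic_b_gt0 q01; have a0 := cubic_a3_gt0 t01.
have aC : cubic_C t <= cubic_a (t ^+ 3).
  have := cubic_b_gt0 t01; rewrite /cubic_C /cubic_b; lra.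
have d4 : euler (t ^+ 3) ^+ 4 <= (1 - e) * euler (t ^+ 9) ^+ 4.
  have h2 : euler (t ^+ 3) <= (1 - e) * euler (t ^+ 9).
    by rewrite -ler_pdivrMl.
  have h3 : euler (t ^+ 3) <= euler (t ^+ 9).
    by apply: le_trans h2 _; rewrite ler_piMl ?(ltW e9) //; lra.
  rewrite !(exprS _ 3) (mulrA (1 - e)); apply: ler_pM; rewrite ?exprn_ge0 ?(ltW e3) //.
  by rewrite lerXn2r ?nnegrE ?(ltW e3) ?(ltW e9).
have bC : cubic_b (t ^+ 3) <= (1 - e) * cubic_C t.
  rewrite cubic_b_euler // cubic_C_euler // -!exprM ler_pdivrMr //.
  have -> : (1 - e) * (3 * t * euler (t ^+ 9) ^+ 3 / euler (t ^+ 3)) * euler (t ^+ 9) =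
    3 * t * ((1 - e) * euler (t ^+ 9) ^+ 4) / euler (t ^+ 3) by ring.
  rewrite ler_pdivlMr // -exprSr; apply: le_trans d4 _.
  rewrite ler_peMl //; last by lra.
  by rewrite mulr_ge0 ?exprn_ge0 // ltW.
rewrite (cubic_x_b q01).
have r0 : 0 < cubic_b (t ^+ 3) / cubic_a (t ^+ 3) by rewrite divr_gt0.
have r1 : cubic_b (t ^+ 3) / cubic_a (t ^+ 3) <= 1 - e.
  rewrite ler_pdivrMr //; apply: le_trans bC _; rewrite ler_wpM2l //; exact: ltW.
have : (cubic_b (t ^+ 3) / cubic_a (t ^+ 3)) ^+ 3 <= 1 - e; last by lra.
apply: (le_trans _ r1); rewrite exprS ler_piMr ?(ltW r0) // exprn_ile1 ?(ltW r0) //.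
by apply: (le_trans r1); lra.
Qed.

Section PeriodIntegral.
Variables (R : realType) (r u : R).
Hypotheses (r01 : 0 < r < 1) (u0 : 0 < u).
Local Notation mu := (@lebesgue_measure R).

Definition nome_real (v : R) : R := expR (- (2 * pi * v)).

Lemma nome_real_itv (v : R) : 0 < v -> 0 < nome_real v < 1.
Proof.
by move=> v0; rewrite expR_gt0 expR_lt1 oppr_lt0 !mulr_gt0 // pi_gt0.
Qed.

Lemma nome_real_surj (q : R) : 0 < q < 1 -> exists y, 0 < y /\ nome_real (u * y) = q.
Proof.
move=> /andP[q0 q1].
have pu : 0 < 2 * pi * u by rewrite !mulr_gt0 // pi_gt0.
exists (- ln q / (2 * pi * u)); split.
  by rewrite divr_gt0 // oppr_gt0 ln_lt0 // q0.
rewrite /nome_real -[RHS]lnK ?posrE //; congr expR.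
have := pi_gt0 R; move: (@pi R) pu => p pu p0.
by field; rewrite !gt_eqF.
Qed.

Let k0 : 0 < 2 * pi * u. Proof. by rewrite !mulr_gt0 // pi_gt0. Qed.
(* The substitution x = F y, where g is minus the derivative of F, and the
   integrand G of [integral_hypergeometric]. *)
Let F (y : R) : R := cubic_x (nome_real (u * y)).
Let g (y : R) : R := 2 * pi * u * (F y * (1 - F y) * cubic_a (nome_real (u * y)) ^+ 2).
Let G (x : R) : R := beta_density r r x * psum (hcoef R) x.

Let q01 (y : R) : 0 < y -> 0 < nome_real (u * y) < 1.
Proof. by move=> y0; rewrite nome_real_itv // mulr_gt0. Qed.

Let dq (y : R) : is_derive y (1 : R) (fun y : R => nome_real (u * y))
  (- (2 * pi * u) * nome_real (u * y)).
Proof.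
have h : is_derive y (1 : R) (fun y : R => - (2 * pi * u) * y) (- (2 * pi * u)).
  by apply: is_derive_eq; rewrite /GRing.scale /= mulr1.
have e : (fun y : R => nome_real (u * y)) = expR \o (fun y : R => - (2 * pi * u) * y).
  by apply/funext => x; rewrite /nome_real /=; congr expR; ring.
rewrite e; apply: (is_derive_eq (is_derive1_comp (is_derive_expR _) h)).
by rewrite mulrC; congr (_ * expR _); ring.
Qed.

Let dF (y : R) : 0 < y -> is_derive y (1 : R) F (- g y).
Proof.
move=> y0; have h := hasD_cubic_x (q01 y0); have /andP[qy _] := q01 y0.
apply: (is_derive_eq (@is_derive1_comp _ (@cubic_x R) (fun y => nome_real (u * y)) _ _ _ h (dq y))).
by rewrite /g /F; move: qy; move: (nome_real _) => q qy; field; rewrite gt_eqF.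
Qed.

Let ca (y : R) : 0 < y -> {for y, continuous (fun y : R => cubic_a (nome_real (u * y)))}.
Proof.
move=> y0; have /andP[qy0 qy1] := q01 y0.
apply: (@continuous_comp _ _ _ (fun y : R => nome_real (u * y)) (@cubic_a R)).
  by apply: differentiable_continuous; apply/derivable1_diffP; have [] := dq y.
apply: (continuous_psum (@cvg_unit_acoef R)); rewrite qy1 andbT.
by apply: lt_trans qy0; rewrite oppr_lt0.
Qed.

Let cF (y : R) : 0 < y -> {for y, continuous F}.
Proof.
move=> y0; apply: differentiable_continuous; apply/derivable1_diffP.
by have [] := dF y0.
Qed.

Let cg (y : R) : 0 < y -> {for y, continuous g}.
Proof.
move=> y0; apply: continuousM; first exact: cst_continuous.
apply: continuousM.
  by apply: continuousM; [exact: cF|apply: continuousB; [exact: cst_continuous|exact: cF]].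
exact: (continuousM (ca y0) (ca y0)).
Qed.

Let F01 (y : R) : 0 < y -> 0 < F y < 1.
Proof. by move=> y0; apply: cubic_x_itv; exact: q01. Qed.

Let g_gt0 (y : R) : 0 < y -> 0 < g y.
Proof.
move=> y0; have /andP[h1 h2] := F01 y0.
have a0 := cubic_a_gt0 (q01 y0).
rewrite /g; apply: mulr_gt0 => //; apply: mulr_gt0; last by rewrite exprn_gt0.
by apply: mulr_gt0 => //; rewrite subr_gt0.
Qed.

Let decF (y z : R) : 0 < y -> y < z -> F z < F y.
Proof.
move=> y0 yz.
have dd x : x \in `]y, z[ -> is_derive x (1 : R) F (- g x).
  by rewrite in_itv /= => /andP[yx _]; apply: dF; apply: lt_trans yx.
have cc : {within `[y, z], continuous F}.
  apply: derivable_within_continuous => x; rewrite in_itv /= => /andP[yx _].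
  by have [] := dF (lt_le_trans y0 yx).
have [c + e] := MVT yz dd cc; rewrite in_itv /= => /andP[yc _].
rewrite -subr_lt0 e mulNr oppr_lt0 mulr_gt0 ?subr_gt0 // g_gt0 //.
exact: lt_trans yc.
Qed.

Let cG (x : R) : 0 < x < 1 -> {for x, continuous G}.
Proof.
move=> x01; have /andP[x0 x1] := x01.
apply: continuousM; first exact: continuous_beta_density.
apply: (continuous_psum (@cvg_unit_hcoef R)); rewrite x1 andbT.
by apply: lt_trans x0; rewrite oppr_lt0.
Qed.

Let G0 (x : R) : 0 < x < 1 -> 0 <= G x.
Proof.
move=> /andP[x0 x1]; rewrite mulr_ge0 ?beta_density_ge0 //.
have c : pseries (hcoef R) x @ \oo --> psum (hcoef R) x.
  by apply: cvg_unit_hcoef; rewrite x1 ltW.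
rewrite -(cvg_lim _ c) //; apply: limr_ge; first by apply/cvg_ex; eexists; exact: c.
apply: nearW => N; apply: sumr_ge0 => i _.
by rewrite mulr_ge0 ?exprn_ge0 // ltW // hcoef_gt0.
Qed.

Lemma modular_integral :
  (\int[mu]_(y in `]0%R, +oo[) (G (F y) * g y)%:E =
   (fine (beta_moment r r) * limn (series (hypterm r)))%:E)%E.
Proof.
rewrite -(integral_hypergeometric r01); apply: esym.
apply: (integral_subst_unit dF cg) => //.
- by move=> y y0; rewrite ltW // g_gt0.
- move=> e e0; have /cvgrPdist_lt/(_ e e0)[d /= d0 hd] := @cvg_at0_x R.
  pose q := Num.min d 1 / 2.
  have m0 : 0 < Num.min d 1 by rewrite lt_min d0 ltr01.
  have qm : q < Num.min d 1 by rewrite /q ltr_pdivrMr // ltr_pMr // ltr1n.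
  have q0 : 0 < q by rewrite divr_gt0.
  move: qm; rewrite lt_min => /andP[qd q1].
  have [|y [y0 yq]] := @nome_real_surj q; first by rewrite q0.
  exists y; split => //; rewrite /F yq; apply: ltW.
  have := hd q; rewrite /ball /= !sub0r !normrN (gtr0_norm q0) => /(_ qd q0).
  by apply: le_lt_trans; exact: ler_norm.
- move=> e e1; have [q [q01' eq]] := cubic_x_large e1.
  have [y [y0 yq]] := nome_real_surj q01'.
  by exists y; split => //; rewrite /F yq.
Qed.

Let cGFg (y : R) : 0 < y -> {for y, continuous (fun y : R => G (F y) * g y)}.
Proof.
move=> y0; apply: continuousM; last exact: cg.
apply: (@continuous_comp _ _ _ F G); first exact: cF.
by apply: cG; exact: F01.
Qed.

Lemma modular_integrable :
  mu.-integrable (`]0%R, +oo[%classic : set R) (fun y => (G (F y) * g y)%:E).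
Proof.
apply/integrableP; split.
  apply/measurable_EFinP; apply: open_continuous_measurable_fun; first exact: interval_open.
  by move=> x; rewrite inE /= in_itv /= andbT; exact: cGFg.
rewrite (_ : (\int[mu]_(y in _) _)%E = (\int[mu]_(y in `]0%R, +oo[) (G (F y) * g y)%:E)%E).
  by rewrite modular_integral ltry.
apply: eq_integral => y; rewrite inE /= in_itv /= andbT => y0.
by rewrite ger0_norm // mulr_ge0 ?G0 ?F01 // ltW // g_gt0.
Qed.

(** By [cubic_a_hypergeometric] the hypergeometric factor of the integrand is
    one more power of a. *)
Lemma modular_integrand (y : R) : 0 < y ->
  G (F y) * g y = 2 * pi * u * (F y `^ r * (1 - F y) `^ (1 - r)
                                * cubic_a (nome_real (u * y)) ^+ 3).
Proof.
move=> y0; have /andP[F0 F1] := F01 y0.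
rewrite /G /g -cubic_a_hypergeometric ?q01 // /beta_density -/(F y).
have -> : F y `^ r = F y * F y `^ (r - 1) by rewrite mulr_powRB1 ?ltW //; case/andP: r01.
have -> : (1 - F y) `^ (1 - r) = (1 - F y) * (1 - F y) `^ (- r).
  rewrite -[- r in RHS](_ : 1 - r - 1 = - r); last by ring.
  by rewrite mulr_powRB1 ?subr_gt0 //; [rewrite subr_ge0 ltW|case/andP: r01].
by move: (F y) (_ `^ (r - 1)) (_ `^ (- r)) (cubic_a _) => x z w t; ring.
Qed.
End PeriodIntegral.

(** * Eta quotients on the imaginary axis *)

Section EtaReal.
Variable R : realType.
Implicit Types v : R.

(** The values of eta on the imaginary axis. *)
Definition reta v : R := expR (- (2 * pi * v) / 24) * euler (nome_real v).

Lemma nome_realX n v : nome_real v ^+ n = nome_real (n%:R * v).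
Proof. by rewrite /nome_real -expRM_natl; congr expR; ring. Qed.

Lemma reta_gt0 v : 0 < v -> 0 < reta v.
Proof.
move=> v0; have /andP[q0 q1] := nome_real_itv v0.
by rewrite mulr_gt0 ?expR_gt0 // euler_gt0 // q1 ltW.
Qed.

Lemma cubic_C_eta v : 0 < v -> cubic_C (nome_real (v / 3)) = 3 * (reta (3 * v) ^+ 3 / reta v).
Proof.
move=> v0; have t01 : 0 < nome_real (v / 3) < 1 by rewrite nome_real_itv // divr_gt0.
rewrite cubic_C_euler // !nome_realX.
have -> : 9%:R * (v / 3) = 3 * v by field.
have -> : 3%:R * (v / 3) = v by field.
have := reta_gt0 v0; rewrite /reta.
have -> : nome_real (v / 3) = expR (- (2 * pi * (3 * v)) / 24) ^+ 3 / expR (- (2 * pi * v) / 24).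
  by rewrite -expRM_natl -expRN -expRD; congr expR; field.
have := expR_gt0 (- (2 * pi * v) / 24).
move: (expR _) (expR _) (euler _) (euler _) => x y z w x0.
rewrite pmulr_rgt0 // => w0.
by field; rewrite !gt_eqF.
Qed.

Lemma cubic_b_eta v : 0 < v -> cubic_b (nome_real v) = reta v ^+ 3 / reta (3 * v).
Proof.
move=> v0; rewrite cubic_b_euler ?nome_real_itv // nome_realX.
have v30 : 0 < 3 * v by rewrite mulr_gt0.
have := reta_gt0 v30; rewrite /reta.
have -> : expR (- (2 * pi * (3 * v)) / 24) = expR (- (2 * pi * v) / 24) ^+ 3.
  by rewrite -expRM_natl; congr expR; field.
have := expR_gt0 (- (2 * pi * v) / 24).
move: (expR _) (euler _) (euler _) => x y z x0.
rewrite pmulr_rgt0 ?exprn_gt0 // => z0.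
by field; rewrite !gt_eqF.
Qed.

(** The function K_3(r, 1) of the imaginary axis. *)
Definition eta_quotient (r v : R) : R :=
  reta v `^ (9 - 12 * r) * reta (3 * v) `^ (12 * r - 3).

Let powR_cubic (r c a x y : R) : 0 < c -> 0 < a -> 0 < x -> 0 < y ->
  ((c * (y ^+ 3 / x) / a) ^+ 3) `^ r * ((x ^+ 3 / y / a) ^+ 3) `^ (1 - r) * a ^+ 3
  = c `^ (3 * r) * (x `^ (9 - 12 * r) * y `^ (12 * r - 3)).
Proof.
have E (z : R) : 0 < z -> exists t, z = expR t by move=> z0; exists (ln z); rewrite lnK.
have X (z : R) (n : nat) : expR z ^+ n = expR (n%:R * z) by rewrite expRM_natl.
move=> /E[z ->] /E[b ->] /E[w ->] /E[t ->].
by rewrite -!expRN !X -!expRD !X -!expRM -!expRD; congr expR; ring.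
Qed.

(** The substitution x = c^3 / a^3 and 1 - x = b^3 / a^3, with b and c written
    as eta quotients; the powers of a cancel. *)
Lemma cubic_eta_quotient (r v : R) : 0 < v ->
  cubic_x (nome_real v) `^ r * (1 - cubic_x (nome_real v)) `^ (1 - r) * cubic_a (nome_real v) ^+ 3
  = 3 `^ (3 * r) * eta_quotient r v.
Proof.
move=> v0; have q01 := nome_real_itv v0.
have t01 : 0 < nome_real (v / 3) < 1 by rewrite nome_real_itv // divr_gt0.
have a0 := cubic_a_gt0 q01; have e1 := reta_gt0 v0.
have e3 : 0 < reta (3 * v) by rewrite reta_gt0 // mulr_gt0.
have tq : nome_real (v / 3) ^+ 3 = nome_real v by rewrite nome_realX; congr nome_real; field.
have -> : 1 - cubic_x (nome_real v) = (reta v ^+ 3 / reta (3 * v) / cubic_a (nome_real v)) ^+ 3.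
  by rewrite (cubic_x_b q01) cubic_b_eta // opprB addrC subrK.
have -> : cubic_x (nome_real v) =
    (3 * (reta (3 * v) ^+ 3 / reta v) / cubic_a (nome_real v)) ^+ 3.
  by rewrite -tq cubic_x3 // /cubic_s tq cubic_C_eta.
exact: powR_cubic.
Qed.

End EtaReal.

Section EtaPeriod.
Variables (R : realType) (r u : R).
Hypotheses (r01 : 0 < r < 1) (u0 : 0 < u).
Local Notation mu := (@lebesgue_measure R).

Let c : R := 2 * pi * u * 3 `^ (3 * r).

Let c0 : 0 < c.
Proof. by rewrite !mulr_gt0 ?pi_gt0 ?powR_gt0. Qed.

Let quotE y : y \in (`]0%R, +oo[%classic : set R) ->
  beta_density r r (cubic_x (nome_real (u * y))) *
    psum (hcoef R) (cubic_x (nome_real (u * y))) *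
   (2 * pi * u * (cubic_x (nome_real (u * y)) * (1 - cubic_x (nome_real (u * y))) *
       cubic_a (nome_real (u * y)) ^+ 2)) = c * eta_quotient r (u * y).
Proof.
rewrite inE /= in_itv /= andbT => y0.
by rewrite modular_integrand // cubic_eta_quotient ?mulr_gt0 // mulrA.
Qed.

Lemma eta_quotient_integrable :
  mu.-integrable (`]0%R, +oo[%classic : set R) (fun y => (eta_quotient r (u * y))%:E).
Proof.
have := @integrableZl _ _ _ mu _ (measurable_itv _) c^-1 _ (modular_integrable r01 u0).
apply: eq_integrable => // y y0; rewrite -EFinM quotE // mulrA mulVf ?gt_eqF //.
by rewrite mul1r.
Qed.

Lemma eta_quotient_period :
  \int[mu]_(y in `]0%R, +oo[%classic) eta_quotient r (u * y) =
  c^-1 * (Beta r (1 - r) * limn (series (hypterm r))).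
Proof.
have -> : \int[mu]_(y in `]0%R, +oo[%classic) eta_quotient r (u * y) =
    c^-1 * \int[mu]_(y in `]0%R, +oo[%classic) (c * eta_quotient r (u * y)).
  by rewrite RintegralZl ?eta_quotient_integrable // mulrA mulVf ?gt_eqF // mul1r.
congr (_ * _); rewrite /Rintegral.
have -> : (\int[mu]_(y in `]0%R, +oo[%classic) (c * eta_quotient r (u * y))%:E)%E =
    (fine (beta_moment r r) * limn (series (hypterm r)))%:E.
  by rewrite -(modular_integral r01 u0); apply: eq_integral => y y0; rewrite -quotE.
rewrite /=; congr (_ * _); rewrite /Beta /Rintegral; congr fine.
by apply: eq_integral => x _; rewrite /beta_density; congr (_ * _ `^ _)%:E; ring.
Qed.
End EtaPeriod.

(** * The functions K_3(r, 1) on the imaginary axis *)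

Section ImaginaryAxis.
Variable R : realType.
Implicit Types v : R.

Lemma nome_imag (s : rat) v : nome s ('i%C * v%:C) = (nome_real (ratr s * v))%:C.
Proof.
rewrite /nome.
have -> : ratr s = (ratr s)%:C :> R[i] by rewrite fmorph_rat.
have -> : 2 * pi%:C * 'i%C * (ratr s)%:C * ('i%C * v%:C) = (- (2 * pi * (ratr s * v)))%:C :> R[i].
  rewrite (_ : _ * ('i%C * _) = 'i%C ^+ 2 * (2 * pi%:C * (ratr s)%:C * v%:C)); last by ring.
  rewrite sqr_i (_ : 2 = (2 : R)%:C); last by rewrite rmorph_nat.
  by rewrite -!rmorphM mulN1r -rmorphN /= !mulrA.
by rewrite /expC /nome_real /= cos0 sin0 mulr1 mulr0.
Qed.

Lemma cvg_real_complex (u : nat -> R) (l : R) : u @ \oo --> l ->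
  ((fun n => (u n)%:C) : nat -> R[i]^o) @ \oo --> (l%:C : R[i]^o).
Proof.
move=> ul; apply/cvgrPdist_lt => e e0.
have [e1 eE] : exists e1 : R, e = e1%:C.
  by apply/complex_realP; apply: gtr0_real.
rewrite eE ltcR in e0 *.
move/cvgrPdist_lt: ul => /(_ _ e0); apply: filterS => n /= h.
by rewrite -rmorphB normc_def /= expr0n addr0 sqrtr_sqr ltcR.
Qed.

Lemma eta_imag v : 0 < v -> Defs.eta ('i%C * v%:C) = (reta v)%:C.
Proof.
move=> v0; rewrite /Defs.eta /reta [RHS]rmorphM; congr (_ * _).
  rewrite nome_imag /nome_real; congr (expR _)%:C.
  by rewrite fmorph_div rmorph1 rmorph_nat; field.
apply: (@cvg_lim (R[i]^o)); first exact: norm_hausdorff.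
rewrite [X in X @ \oo](_ : _ =
    (fun N => (\prod_(0 <= n < N) (1 - nome_real v ^+ n.+1))%:C) :> (nat -> R[i]^o)).
  apply/cvg_real_complex/cvg_euler.
  by have /andP[/ltW -> ->] := nome_real_itv v0.
apply/funext => N; rewrite rmorph_prod big_add1 /=.
apply: eq_bigr => n _; rewrite nome_imag rmorph1 mul1r.
by rewrite rmorphB rmorph1 rmorphXn.
Qed.

(** As 12 r is an integer, the integral powers in K_3 are real powers. *)
Lemma K3_imag (r : rat) (k : int) v : 12 * r = k%:~R -> 0 < v ->
  K3 r ('i%C * v%:C) = (eta_quotient (ratr r) v)%:C.
Proof.
move=> rk v0; have v30 : 0 < 3 * v by rewrite mulr_gt0.
have rk' : 12 * ratr r = k%:~R :> R.
  by rewrite -(ratr_int R k) -rk rmorphM rmorph_nat.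
have k1 : Num.floor (9 - 12 * r) = 9 - k by rewrite rk -(intrB _ 9) intrKfloor.
have k2 : Num.floor (12 * r - 3) = k - 3 by rewrite rk -(intrB _ _ 3) intrKfloor.
rewrite /K3 k1 k2 eta_imag //.
have -> : 3 * ('i%C * v%:C) = 'i%C * (3 * v)%:C.
  by rewrite rmorphM rmorph_nat; ring.
rewrite eta_imag // /eta_quotient rk'.
rewrite -(intrB _ 9) -(intrB _ k 3) !powR_intmul ?ltW ?reta_gt0 //.
by rewrite [RHS]rmorphM /= !fmorphXz.
Qed.

End ImaginaryAxis.

(** * L-values as combinations of periods *)

Section Lvalues.
Variable R : realType.
Local Notation mu := (@lebesgue_measure R).
Local Notation axis := (`]0%R, +oo[%classic : set R).

Lemma Cintegral_sum (I : eqType) (s : seq I) (c : I -> R[i]) (k : I -> R -> R) :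
  {in s, forall i, mu.-integrable axis (EFin \o k i)} ->
  Cintegral axis (fun y => \sum_(i <- s) c i * (k i y)%:C) =
  \sum_(i <- s) c i * (\int[mu]_(y in axis) k i y)%:C.
Proof.
have linear (d : I -> R) : {in s, forall i, mu.-integrable axis (EFin \o k i)} ->
    mu.-integrable axis (EFin \o (fun y => \sum_(i <- s) d i * k i y)) /\
    \int[mu]_(y in axis) (\sum_(i <- s) d i * k i y) =
    \sum_(i <- s) d i * \int[mu]_(y in axis) k i y.
  elim: s => [|i s IH] hs.
    split; last by rewrite big_nil; under eq_Rintegral do rewrite big_nil; rewrite Rintegral_cst // mul0r.
    apply: eq_integrable (@integrable0 _ _ _ mu axis) => // y _ /=.
    by rewrite big_nil.
  have [|h1 h2] := IH; first by move=> j js; apply: hs; rewrite inE js orbT.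
  have hi := hs i (mem_head _ _).
  have hdi : mu.-integrable axis (EFin \o (fun y => d i * k i y)).
    by apply: eq_integrable (@integrableZl _ _ _ mu axis _ (d i) _ hi).
  split.
    apply: eq_integrable (@integrableD _ _ _ mu axis _ _ _ hdi h1) => // y _ /=.
    by rewrite big_cons.
  under eq_Rintegral do rewrite big_cons.
  by rewrite RintegralD // RintegralZl // h2 big_cons.
move=> hs; have [_ hRe] := linear (fun i => complex.Re (c i)) hs.
have [_ hIm] := linear (fun i => complex.Im (c i)) hs.
have ReE (a : R[i]) (x : R) : complex.Re (a * x%:C) = complex.Re a * x.
  by case: a => a b /=; rewrite mulr0 subr0.
have ImE (a : R[i]) (x : R) : complex.Im (a * x%:C) = complex.Im a * x.
  by case: a => a b /=; rewrite mulr0 add0r.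
have ReS (g : I -> R[i]) : complex.Re (\sum_(i <- s) g i) = \sum_(i <- s) complex.Re (g i).
  by apply: (big_morph (@complex.Re R)) => // -[? ?] [].
have ImS (g : I -> R[i]) : complex.Im (\sum_(i <- s) g i) = \sum_(i <- s) complex.Im (g i).
  by apply: (big_morph (@complex.Im R)) => // -[? ?] [].
apply/eqP; rewrite eq_complex ReS ImS /=; apply/andP; split; apply/eqP.
- under [RHS]eq_bigr do rewrite ReE; rewrite -hRe; apply: eq_Rintegral => y _.
  by rewrite ReS; apply: eq_bigr => i _; rewrite ReE.
- under [RHS]eq_bigr do rewrite ImE; rewrite -hIm; apply: eq_Rintegral => y _.
  by rewrite ImS; apply: eq_bigr => i _; rewrite ImE.
Qed.

Lemma Lvalue1_sum (I : eqType) (s : seq I) (c : I -> R[i]) (k : I -> R -> R) (f : R[i] -> R[i]) :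
  {in s, forall i, mu.-integrable axis (EFin \o k i)} ->
  (forall y, 0 < y -> f ('i%C * y%:C) = \sum_(i <- s) c i * (k i y)%:C) ->
  Lvalue1 f = 2 * pi%:C * \sum_(i <- s) c i * (\int[mu]_(y in axis) k i y)%:C.
Proof.
move=> hs fE; rewrite /Lvalue1.
have -> : Cintegral axis (fun y : R => f ('i%C * y%:C) * 'i%C) =
    Cintegral axis (fun y => \sum_(i <- s) (c i * 'i%C) * (k i y)%:C).
  have e y : y \in axis -> f ('i%C * y%:C) * 'i%C = \sum_(i <- s) (c i * 'i%C) * (k i y)%:C.
    rewrite inE /= in_itv /= andbT => y0; rewrite fE // mulr_suml.
    by apply: eq_bigr => i _; ring.
  by congr Complex; apply: eq_Rintegral => y y0; rewrite e.
rewrite Cintegral_sum // !mulr_sumr; apply: eq_bigr => i _.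
rewrite (_ : _ * (_ * 'i%C * _) = - 'i%C ^+ 2 * (2 * pi%:C * (c i * (\int[mu]_(y in axis) k i y)%:C))).
  by rewrite sqr_i opprK mul1r.
by ring.
Qed.

End Lvalues.

Section Eigenforms.
Variable R : realType.

(** The coefficient of K_3(j / u, 1)(u tau) in the eigenform; for u = 4 the
    index j = 3 is coprime to u but does not occur. *)
Definition eigencoef (u j : nat) : R[i] :=
  match u, j with
  | 3, 2 => 3 * 'i%C
  | 4, 3 => 0
  | 6, 5 => 9 * 'i%C
  | 12, 5 => 3 * (Num.sqrt 5)%:C
  | 12, 7 => - (3 * ((Num.sqrt 5)%:C * ('i%C * (Num.sqrt 3)%:C)))
  | 12, 11 => - (9 * ('i%C * (Num.sqrt 3)%:C))
  | _, _ => 1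
  end.

Lemma K3_imag_frac (u j : nat) (y : R) : (u %| 12)%N -> 0 < y ->
  K3 (j%:R / u%:R) (u%:R * ('i%C * y%:C)) =
  (eta_quotient (ratr (j%:R / u%:R)) (u%:R * y))%:C.
Proof.
move=> /dvdnP[k uk] y0.
have u0 : (0 < u)%N by rewrite -(ltn_pmul2l (m := k)) // ?muln0 -?uk //; case: k uk.
have -> : u%:R * ('i%C * y%:C) = 'i%C * (u%:R * y)%:C by rewrite rmorphM rmorph_nat mulrCA.
apply: (@K3_imag _ _ (k * j)%N); last by rewrite mulr_gt0 ?ltr0n.
have e : 12 = k%:R * u%:R :> rat by rewrite -natrM -uk.
rewrite e -pmulrn natrM.
by field; rewrite pnatr_eq0 -lt0n.
Qed.

Lemma f_sharp_imag (u : nat) (y : R) : u \in [:: 2; 3; 4; 6; 12]%N -> 0 < y ->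
  f_sharp u ('i%C * y%:C) = \sum_(1 <= j < u | coprime j u)
    eigencoef u j * (eta_quotient (ratr (j%:R / u%:R)) (u%:R * y))%:C.
Proof.
move=> hu y0; transitivity (\sum_(1 <= j < u | coprime j u)
    eigencoef u j * K3 (j%:R / u%:R) (u%:R * ('i%C * y%:C))); last first.
  apply: eq_bigr => j _; rewrite K3_imag_frac //.
  by move: hu; rewrite !inE => /or4P[/eqP->|/eqP->|/eqP->|/orP[]/eqP->].
rewrite -big_filter; move: hu; rewrite !inE => /or4P[/eqP->|/eqP->|/eqP->|/orP[]/eqP->].
- rewrite (_ : [seq _ <- _ | _] = [:: 1%N]) // big_seq1 /f_sharp /eigencoef mul1r.
  by rewrite /f_12_3_c_a.
- rewrite (_ : [seq _ <- _ | _] = [:: 1; 2]%N) // !big_cons big_nil addr0 /f_sharp /eigencoef.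
  by rewrite mul1r /f_27_3_b_b.
- rewrite (_ : [seq _ <- _ | _] = [:: 1; 3]%N) // !big_cons big_nil addr0 /f_sharp /eigencoef.
  by rewrite mul1r mul0r addr0 /f_16_3_c_a.
- rewrite (_ : [seq _ <- _ | _] = [:: 1; 5]%N) // !big_cons big_nil addr0 /f_sharp /eigencoef.
  by rewrite mul1r /f_108_3_c_b.
- rewrite (_ : [seq _ <- _ | _] = [:: 1; 5; 7; 11]%N) // !big_cons big_nil addr0 /f_sharp /eigencoef.
  have e (a b c d s t w : R[i]) :
    a + s * b - t * c - w * d = a + (s * b + (- t * c + - w * d)) by ring.
  by rewrite mul1r -e /f_432_3_g_e.
Qed.

Lemma algebraic_root (n : nat) (c : rat) (z : R[i]) : (0 < n)%N ->
  z ^+ n = ratr c -> algebraic_number z.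
Proof.
move=> n0 zc; exists ('X^n - c%:P); first by rewrite -size_poly_gt0 size_XnsubC.
by rewrite rmorphB /= map_polyXn map_polyC /= /root !hornerE zc subrr.
Qed.

Lemma algebraic_nat (n : nat) : algebraic_number (n%:R : R[i]).
Proof. by apply: (@algebraic_root 1 n%:R) => //; rewrite rmorph_nat. Qed.

Lemma algebraic_i : algebraic_number ('i%C : R[i]).
Proof. by apply: (@algebraic_root 2 (-1)) => //; rewrite sqr_i rmorphN1. Qed.

Lemma algebraic_sqrt (n : nat) : algebraic_number ((Num.sqrt n%:R)%:C : R[i]).
Proof.
by apply: (@algebraic_root 2 n%:R) => //; rewrite -rmorphXn /= sqr_sqrtr // !rmorph_nat.
Qed.

Lemma algebraic_eigencoef (u j : nat) : algebraic_number (eigencoef u j).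
Proof.
have hm (z w : R[i]) : algebraic_number z -> algebraic_number w -> algebraic_number (z * w).
  exact: algebraic_mul.
have h3 : algebraic_number ('i%C * (Num.sqrt 3)%:C : R[i]).
  by apply: hm algebraic_i (algebraic_sqrt 3).
rewrite /eigencoef.
case: u => [|[|[|[|[|[|[|[|[|[|[|[|[|u]]]]]]]]]]]]]; try exact: (algebraic_nat 1).
- case: j => [|[|[|j]]]; try exact: (algebraic_nat 1).
  exact: hm (algebraic_nat 3) algebraic_i.
- case: j => [|[|[|[|j]]]]; try exact: (algebraic_nat 1).
  exact: (algebraic_nat 0).
- case: j => [|[|[|[|[|[|j]]]]]]; try exact: (algebraic_nat 1).
  exact: hm (algebraic_nat 9) algebraic_i.
- case: j => [|[|[|[|[|[|[|[|[|[|[|[|j]]]]]]]]]]]]; try exact: (algebraic_nat 1).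
  + exact: hm (algebraic_nat 3) (algebraic_sqrt 5).
  + by apply: algebraic_opp; apply: hm (algebraic_nat 3) (hm _ _ (algebraic_sqrt 5) h3).
  + by apply: algebraic_opp; apply: hm (algebraic_nat 9) h3.
Qed.

(** Its u-th power is 3^(-3 j). *)
Lemma algebraic_power3 (u j : nat) : (0 < u)%N ->
  algebraic_number ((3 `^ (- (3 * (j%:R / u%:R))))%:C : R[i]).
Proof.
move=> u0; apply: (@algebraic_root u (3 ^- (3 * j))) => //.
have -> : ratr (3 ^- (3 * j)) = (3 ^- (3 * j))%:C :> R[i].
  by rewrite !fmorphV !rmorphXn !rmorph_nat.
rewrite -rmorphXn /= -powR_mulrn ?powR_ge0 // -powRrM; congr (_%:C).
rewrite -powR_mulrn // -powRN; congr (_ `^ _).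
by rewrite natrM; field; rewrite pnatr_eq0 -lt0n.
Qed.

End Eigenforms.

Lemma hyp3F2_K3E (R : realType) (r : rat) : hyp3F2_K3 R r = limn (series (hypterm (ratr r : R))).
Proof.
rewrite /hyp3F2_K3; congr (limn (series _)); apply/funext => k.
rewrite /hypterm /hcoef; have := fact_neq0 R k.
by move: (k`!%:R) => f f0; field.
Qed.

Theorem corollary2 (R : realType) (u : nat)
    (hu : u \in [:: 2; 3; 4; 6; 12]%N) :
  exists (alpha : R[i]) (beta : nat -> R[i]),
    [/\ algebraic_number alpha,
        alpha != 0,
        forall j : nat, (1 <= j < u)%N -> coprime j u ->
          algebraic_number (beta j)
      & alpha * pi%:C * Lvalue1 (@f_sharp R u) =
        \sum_(1 <= j < u | coprime j u)
          beta j * (hyp3P2_K3 R (j%:R / u%:R))%:C].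
Proof.
have u0 : (0 < u)%N by move: hu; rewrite !inE => /or4P[/eqP->|/eqP->|/eqP->|/orP[]/eqP->].
have u0R : 0 < u%:R :> R by rewrite ltr0n.
have rE j : ratr (j%:R / u%:R) = j%:R / u%:R :> R by rewrite fmorph_div !rmorph_nat.
(* The quotient of pi (2 pi) times the j-th period by the value of 3P2. *)
pose scale (j : nat) : R := Num.sqrt 3%:R / 2%:R * 3 `^ (- (3 * (j%:R / u%:R))) / u%:R.
have mul_alg (z w : R[i]) : algebraic_number z -> algebraic_number w -> algebraic_number (z * w).
  exact: algebraic_mul.
exists 1, (fun j => eigencoef R u j * (scale j)%:C); split.
- exact: (algebraic_nat R 1).
- exact: oner_neq0.
- move=> j _ _; apply: (mul_alg _ _); first exact: algebraic_eigencoef.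
  rewrite /scale !rmorphM !fmorphV !rmorph_nat.
  have alg_inv n : algebraic_number (n%:R^-1 : R[i]) by apply/algebraic_inv/algebraic_nat.
  apply: (mul_alg _ _ _ (alg_inv u)); apply: (mul_alg _ _); last exact: algebraic_power3.
  exact: mul_alg (algebraic_sqrt R 3) (alg_inv 2%N).
have r01 j : j \in [seq j <- index_iota 1 u | coprime j u] -> 0 < (j%:R / u%:R : R) < 1.
  rewrite mem_filter mem_index_iota => /and3P[_ j1 ju].
  by rewrite divr_gt0 ?ltr0n //= ltr_pdivrMr // mul1r ltr_nat.
rewrite -[RHS]big_filter.
rewrite (@Lvalue1_sum _ _ [seq j <- index_iota 1 u | coprime j u] (eigencoef R u)
  (fun j y => eta_quotient (j%:R / u%:R) (u%:R * y))); first last.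
- move=> y y0; rewrite f_sharp_imag // -[LHS]big_filter.
  by apply: eq_bigr => j _; rewrite rE.
- by move=> j /r01 h; apply: eta_quotient_integrable.
rewrite mul1r !mulr_sumr; apply: eq_big_seq => j /r01 h.
rewrite eta_quotient_period // /hyp3P2_K3 hyp3F2_K3E rE.
rewrite -[2 in LHS](rmorph_nat (real_complex R)).
rewrite [LHS](_ : _ = eigencoef R u j * (pi%:C * ((2%:R)%:C * pi%:C) *
  ((2 * pi * u%:R * 3 `^ (3 * (j%:R / u%:R)))^-1 *
   (Beta (j%:R / u%:R) (1 - j%:R / u%:R) * limn (series (hypterm (j%:R / u%:R)))))%:C)); last by ring.
rewrite -[RHS]mulrA; congr (_ * _).
rewrite -!(rmorphM (real_complex R)) /=; congr (_%:C); rewrite /scale.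
have s3 : Num.sqrt 3 * Num.sqrt 3 = 3 :> R by rewrite -expr2 sqr_sqrtr.
have -> : 3 `^ (- (3 * (j%:R / u%:R))) = (3 `^ (3 * (j%:R / u%:R)))^-1 :> R by rewrite powRN.
have := powR_gt0 (3 * (j%:R / u%:R)) (ltr0n R 3).
have := pi_gt0 R; move: (@pi R) (_ `^ _) (Beta _ _) (limn _) => p z B S p0 z0.
transitivity (p / (u%:R * z) * B * S); first by field; rewrite !gt_eqF.
transitivity ((Num.sqrt 3 * Num.sqrt 3) / 3 * (p / (u%:R * z) * B * S)); last by field; rewrite !gt_eqF.
by rewrite s3 divff ?mul1r.
Qed.
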